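(* Let $(G,+)$ be an abelian group and $\Bbbk$ a field. The rack homology $\mathrm{HR}_\bullet(G,\Bbbk)$ of $G$ (with its conjugation rack structure) is a connected coZinbiel-associative bialgebra, for its coZinbiel coproduct $\Delta_\prec$ and the associative product $\star$ induced by the rack morphism $+:G\times G\to G$. Moreover, for all $n\in\mathbb N$ there is an isomorphism $$\mathrm{HR}_n(G,\Bbbk)\simeq \mathrm T^n(\Bbbk[G\setminus\{0\}]),$$ and if the characteristic of $\Bbbk$ is $0$, then under this isomorphism and the isomorphism $\mathrm H_n(G,\Bbbk)\simeq\Lambda^n(G\otimes\Bbbk)$ the natural morphism $\mathrm S_n:\mathrm{HR}_n(G,\Bbbk)\to \mathrm H_n(G,\Bbbk)$ is the canonical map $\mathrm T^n(\Bbbk[G\setminus\{0\}])\to\Lambda^n(G\otimes\Bbbk)$, $g_1\otimes\cdots\otimes g_n\mapsto (g_1\otimes1)\wedge\cdots\wedge(g_n\otimes 1)$.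
   Context: **Rack homology.** A pointed rack is a set $X$ with an operation $\lhd$ satisfying $(k\lhd h)\lhd g=(k\lhd g)\lhd(h\lhd g)$, with each $-\lhd g$ bijective, and an element $e$ with $e\lhd g=e$, $g\lhd e=g$. A group is a pointed rack via conjugation $h\lhd g=g^{-1}hg$ (for abelian $G$: $h\lhd g=h$, with $e=0$). $\mathrm{CR}_n(X,\Bbbk)$ is $\Bbbk[X^n]$ modulo the span of tuples with some entry equal to $e$, with differential $d=\sum_{i=1}^n(-1)^{i+1}(d_{i,1}-d_{i,0})$, where $d_{i,0}$ deletes $x_i$ and $d_{i,1}(x_1,\dots,x_n)=(x_1\lhd x_i,\dots,x_{i-1}\lhd x_i,x_{i+1},\dots,x_n)$. $\mathrm{HR}_\bullet(X,\Bbbk)$ is its homology. Here $\Bbbk[G\setminus\{0\}]$ is the free module on the set $G\setminus\{0\}$. **coZinbiel coproduct.** Let $\tau(a\otimes b)=(-1)^{|a||b|}b\otimes a$. A (non-counital) graded coZinbiel coalgebra is a graded vector space $\overline C$ with $\Delta^-_\prec:\overline C\to\overline C\otimes\overline C$ such that $(\Delta^-_\prec\otimes\mathrm{id})\Delta^-_\prec=(\mathrm{id}\otimes\Delta^-_\prec+\mathrm{id}\otimes\tau\Delta^-_\prec)\Delta^-_\prec$. On $C=\overline C\oplus\Bbbk$ set $\Delta_\prec(x)=\Delta_\prec^-(x)+x\otimes1$ and $\Delta(x)=x\otimes1+1\otimes x+\Delta^-_\prec(x)+\tau\Delta^-_\prec(x)$ for $x\in\overline C$, and $\Delta(1)=1\otimes1$.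 It is connected if $\overline C=\bigcup_{r\ge1}F_r\overline C$, where $F_1\overline C=\ker\Delta_\prec^-$ and $F_r\overline C=\{x:\Delta_\prec^-(x)\in F_{r-1}\overline C\otimes F_{r-1}\overline C\}$ for $r>1$. On $\overline{\mathrm{HR}}_\bullet(X,\Bbbk)=\bigoplus_{n\ge1}\mathrm{HR}_n(X,\Bbbk)$ the coZinbiel coproduct $\Delta^-_\prec$ is induced by $$[x_1,\dots,x_n]\mapsto\sum_{p+q=n,\;p,q\ge1}\ \sum_{\sigma\in\mathrm{Sh}^1_{p,q}}\epsilon(\sigma)[x_1,x_{\sigma(2)},\dots,x_{\sigma(p)}]\otimes[x^\sigma_{p+1},\dots,x^\sigma_{p+q}],$$ with $\mathrm{Sh}^1_{p,q}$ the permutations $\sigma$ of $\{1,\dots,p+q\}$ increasing on $\{1,\dots,p\}$ and on $\{p+1,\dots,p+q\}$ with $\sigma(1)=1$, and $x_i^\sigma=(\cdots(x_{\sigma(i)}\lhd x_{i_1})\lhd\cdots)\lhd x_{i_k}$, where $i_1<\dots<i_k$ are the elements of $\{\sigma(1),\dots,\sigma(p)\}$ larger than $\sigma(i)$. (For abelian $G$, $x_i^\sigma=x_{\sigma(i)}$.) **coZinbiel-associative bialgebra.** A graded vector space $H=\overline H\oplus\Bbbk$ with a counital coZinbiel coproduct $\Delta_\prec$ and a unital associative product $\star$ satisfying the semi-Hopf relation $\Delta_\prec\circ\star=\star_\otimes\circ(\Delta_\prec\otimes\Delta)$ (on $\overline H\otimes H$), where $\star_\otimes\big((a\otimes b)\otimes(c\otimes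 d)\big)=(-1)^{|b||c|}(a\star c)\otimes(b\star d)$. **Product.** $\star$ is the composite of $\mathrm{CR}_\bullet(G,\Bbbk)\otimes\mathrm{CR}_\bullet(G,\Bbbk)\to\mathrm{CR}_\bullet(G\times G,\Bbbk)$, $(g_1,\dots,g_p)\otimes(h_1,\dots,h_q)\mapsto((g_1,0),\dots,(g_p,0),(0,h_1),\dots,(0,h_q))$, with the map induced by $+:G\times G\to G$; that is, $(g_1,\dots,g_p)\star(g_{p+1},\dots,g_{p+q})=(g_1,\dots,g_{p+q})$. **Group homology.** $\mathrm H_\bullet(G,\Bbbk)$ is the homology of the normalized bar complex. In characteristic $0$ the isomorphism $\Lambda^n(G\otimes\Bbbk)\simeq \mathrm H_n(G,\Bbbk)$ is given by the Pontryagin product: $(g_1\otimes1)\wedge\dots\wedge(g_n\otimes1)\mapsto\sum_{\sigma\in\mathbb S_n}\epsilon(\sigma)[(g_{\sigma(1)},\dots,g_{\sigma(n)})]$. The natural morphism $\mathrm S_n$ is, for abelian $G$, induced by $(g_1,\dots,g_n)\mapsto\sum_{\sigma\in\mathbb S_n}\epsilon(\sigma)(g_{\sigma(1)},\dots,g_{\sigma(n)})$. *)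

(* Defs.v *)
From HB Require Import structures.
From mathcomp Require Import all_boot all_fingroup all_algebra.
From mathcomp Require Import generic_quotient ring_quotient finmap monalg boolp.

Set Implicit Arguments.
Unset Strict Implicit.
Unset Printing Implicit Defensive.

Import GRing.Theory.
Local Open Scope ring_scope.
Local Open Scope quotient_scope.

Section FreeLift.
Variables (k : fieldType) (S : choiceType) (U : lmodType k).

Definition free_lift (f : S -> U) (c : {malg k[S]}) : U :=
  \sum_(s <- msupp c) c@_s *: f s.

Lemma free_liftEw f (c : {malg k[S]}) (D : {fset S}) : (msupp c `<=` D)%fset ->
  free_lift f c = \sum_(s <- D) c@_s *: f s.
Proof.
move=> cD; apply: big_fset_incl => // s _ /mcoeff_outdom ->.
by rewrite scale0r.
Qed.

Lemma free_lift_is_linear f : linear (free_lift f).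
Proof.
move=> a c d; set D := (msupp (a *: c + d) `|` (msupp c `|` msupp d))%fset.
rewrite !(@free_liftEw _ _ D) ?fsubsetUl //; last first.
- by rewrite fsubsetU // fsubsetUl orbT.
- by rewrite fsubsetU // fsubsetUr orbT.
rewrite scaler_sumr -big_split /=; apply: eq_bigr => s _.
by rewrite mcoeffD mcoeffZ scalerDl scalerA.
Qed.

HB.instance Definition _ f :=
  GRing.isLinear.Build k {malg k[S]} U *:%R (free_lift f) (free_lift_is_linear f).

Lemma free_liftE f s : free_lift f << s >> = f s.
Proof.
rewrite (@free_liftEw _ _ [fset s]%fset) ?msuppU_le //.
by rewrite big_seq_fset1 mcoeffUU scale1r.
Qed.

End FreeLift.

Lemma free_ext (k : fieldType) (S : choiceType) (U : lmodType k)
    (f g : {linear {malg k[S]} -> U}) :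
  (forall s, f << s >> = g << s >>) -> f =1 g.
Proof.
move=> fg c; rewrite [c]monalgE !linear_sum; apply: eq_bigr => s _ /=.
have -> : << c@_s *g s >> = c@_s *: << s >> :> {malg k[S]}.
  by apply/malgP => t; rewrite mcoeffZ !mcoeffU mulrnAr mulr1.
by rewrite !linearZ /= fg.
Qed.

Section Quotient.
Variables (k : fieldType) (V : lmodType k).

Definition span (R : V -> Prop) : {pred V} := fun v =>
  `[< exists (n : nat) (c : 'I_n -> k) (r : 'I_n -> V),
        (forall i, R (r i)) /\ v = \sum_i c i *: r i >].

Variable R : V -> Prop.

Lemma mem_span r : R r -> r \in span R.
Proof.
move=> Rr; apply/asboolP; exists 1, (fun=> 1), (fun=> r); split => //.
by rewrite big_ord1 scale1r.
Qed.

Lemma span_submod_closed : submod_closed (span R).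
Proof.
split=> [|a u v /asboolP[m [c [r [Rr ->]]]] /asboolP[n [d [s [Rs ->]]]]].
  apply/asboolP; exists 0, (fun=> 0), (fun=> 0); split; first by case.
  by rewrite big_ord0.
apply/asboolP; exists (m + n),
  (fun i => match split i with inl j => a * c j | inr j => d j end),
  (fun i => match split i with inl j => r j | inr j => s j end); split.
  by move=> i; case: split.
rewrite big_split_ord /= scaler_sumr; congr (_ + _); apply: eq_bigr => i _.
  by rewrite (unsplitK (inl i)) scalerA.
by rewrite (unsplitK (inr i)).
Qed.

HB.instance Definition _ :=
  GRing.isSubmodClosed.Build k V (span R) span_submod_closed.

Definition quo : Type := Quotient.quot (span R : zmodClosed V).

HB.instance Definition _ := GRing.Zmodule.on quo.
HB.instance Definition _ := ZmodQuotient.on quo.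

Definition quo_pi (v : V) : quo := \pi_quo v.

Lemma quo_pi_eq u v : (quo_pi u == quo_pi v) = (u - v \in span R).
Proof. by rewrite /quo_pi -Quotient.idealrBE. Qed.

Lemma quo_reprK x : quo_pi (repr x) = x.
Proof. exact: reprK. Qed.

Lemma quo_pi_repr v : repr (quo_pi v) - v \in span R.
Proof. by rewrite -quo_pi_eq quo_reprK. Qed.

Lemma quo_piD u v : quo_pi (u + v) = quo_pi u + quo_pi v.
Proof. exact: raddfD. Qed.

Definition quo_scale (a : k) (x : quo) : quo := quo_pi (a *: repr x).

Lemma quo_scaleE a v : quo_scale a (quo_pi v) = quo_pi (a *: v).
Proof.
by apply/eqP; rewrite quo_pi_eq -scalerBr rpredZ // quo_pi_repr.
Qed.

Lemma quo_scaleA a b x : quo_scale a (quo_scale b x) = quo_scale (a * b) x.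
Proof. by rewrite -[x]quo_reprK !quo_scaleE scalerA. Qed.
Lemma quo_scale1 : left_id 1 quo_scale.
Proof. by move=> x; rewrite -[x]quo_reprK quo_scaleE scale1r. Qed.
Lemma quo_scaleDr : right_distributive quo_scale +%R.
Proof.
move=> a x y; rewrite -[x]quo_reprK -[y]quo_reprK -quo_piD !quo_scaleE.
by rewrite -quo_piD scalerDr.
Qed.
Lemma quo_scaleDl x : {morph quo_scale^~ x : a b / a + b}.
Proof.
by move=> a b; rewrite -[x]quo_reprK !quo_scaleE -quo_piD scalerDl.
Qed.

HB.instance Definition _ := GRing.Zmodule_isLmodule.Build k quo
  quo_scaleA quo_scale1 quo_scaleDr quo_scaleDl.

Lemma quo_pi_is_linear : linear quo_pi.
Proof. by move=> a u v; rewrite quo_piD -quo_scaleE. Qed.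
HB.instance Definition _ :=
  GRing.isLinear.Build k V quo *:%R quo_pi quo_pi_is_linear.

Lemma quo_pi_rel r : R r -> quo_pi r = 0.
Proof.
by move=> Rr; apply/eqP; rewrite -(linear0 quo_pi) quo_pi_eq subr0 mem_span.
Qed.

Section Lift.
Variables (U : lmodType k) (f : {linear V -> U}).
Hypothesis fR : forall r, R r -> f r = 0.

Definition quo_lift (x : quo) : U := f (repr x).

Lemma lin_span v : v \in span R -> f v = 0.
Proof.
case/asboolP => n [c [r [Rr ->]]]; rewrite linear_sum big1 // => i _.
by rewrite linearZ /= fR // scaler0.
Qed.

Lemma quo_liftE v : quo_lift (quo_pi v) = f v.
Proof. by apply/eqP; rewrite -subr_eq0 -linearB lin_span ?quo_pi_repr. Qed.

Lemma quo_lift_is_linear : linear quo_lift.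
Proof.
move=> a x y; rewrite -[x]quo_reprK -[y]quo_reprK -linearP !quo_liftE.
by rewrite linearP.
Qed.

End Lift.
End Quotient.
Arguments quo_pi {k V R} v.

Definition quo_map (k : fieldType) (V U : lmodType k) (R : V -> Prop)
    (f : {linear V -> U}) (fR : forall r, R r -> f r = 0) :
  {linear quo R -> U} :=
  HB.pack (quo_lift f : quo R -> U)
    (GRing.isLinear.Build k (quo R) U *:%R (quo_lift f) (quo_lift_is_linear fR)).

Lemma quo_mapE (k : fieldType) (V U : lmodType k) (R : V -> Prop)
    (f : {linear V -> U}) (fR : forall r, R r -> f r = 0) v :
  quo_map fR (quo_pi v) = f v.
Proof. exact: quo_liftE. Qed.

Section Tensor.
Variables (k : fieldType) (V W : lmodType k).

Inductive tens_rel : {malg k[(V * W)%type]} -> Prop :=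
| TensRelL a v v' w :
    tens_rel (<< (a *: v + v', w) >> - (a *: << (v, w) >> + << (v', w) >>))
| TensRelR a v w w' :
    tens_rel (<< (v, a *: w + w') >> - (a *: << (v, w) >> + << (v, w') >>)).

Definition tens : lmodType k := quo tens_rel.

Definition pure (v : V) (w : W) : tens := quo_pi << (v, w) >>.

Section Lift.
Variables (U : lmodType k) (f : V -> W -> U).

Definition bilin := (forall w, linear (f^~ w)) /\ (forall v, linear (f v)).

(* Meaningful only when f is bilinear: see tens_liftE and tens_lift_linear. *)
Definition tens_lift (t : tens) : U :=
  free_lift (fun p : V * W => f p.1 p.2) (repr t).

Hypothesis f_bilin : bilin.

Lemma bilin_rel r : tens_rel r -> free_lift (fun p : V * W => f p.1 p.2) r = 0.
Proof.
case: f_bilin => fl fr; case=> [a v v' w|a v w w'];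
  rewrite linearB linearD linearZ /= !free_liftE /=.
  by rewrite fl subrr.
by rewrite fr subrr.
Qed.

Lemma tens_liftE v w : tens_lift (pure v w) = f v w.
Proof. exact: (etrans (quo_liftE bilin_rel _) (free_liftE _ _)). Qed.

Lemma tens_lift_linear : linear tens_lift.
Proof. exact: (quo_lift_is_linear bilin_rel). Qed.

End Lift.
End Tensor.

Reserved Notation "v ⊗ w" (at level 40, left associativity).
Notation "v ⊗ w" := (pure v w) : ring_scope.

Lemma pure_bilin (k : fieldType) (V W : lmodType k) : bilin (@pure k V W).
Proof.
split=> [w a v v'|v a w w']; apply/eqP; rewrite -subr_eq0 /pure -linearP;
  rewrite -linearB; apply/eqP/quo_pi_rel.
- exact: TensRelL.
- exact: TensRelR.
Qed.

Lemma pure0l (k : fieldType) (V W : lmodType k) (w : W) : (0 : V) ⊗ w = 0.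
Proof.
have := (pure_bilin V W).1 w (-1) 0 0.
by rewrite scaler0 addr0 scaleN1r addNr.
Qed.

Lemma pure0r (k : fieldType) (V W : lmodType k) (v : V) : v ⊗ (0 : W) = 0.
Proof.
have := (pure_bilin V W).2 v (-1) 0 0.
by rewrite scaler0 addr0 scaleN1r addNr.
Qed.

Definition tens_map (k : fieldType) (V V' W W' : lmodType k)
    (f : V -> V') (g : W -> W') : tens V W -> tens V' W' :=
  tens_lift (fun v w => f v ⊗ g w).

Definition tens_assoc (k : fieldType) (U V W : lmodType k) :
    tens (tens U V) W -> tens U (tens V W) :=
  tens_lift (fun t w => tens_lift (fun u v => u ⊗ (v ⊗ w)) t).

Section DirectSum.
Variables (k : fieldType) (V : nat -> lmodType k).

Definition dfun : Type := forall n, V n.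

HB.instance Definition _ := gen_eqMixin dfun.
HB.instance Definition _ := gen_choiceMixin dfun.

Definition dfun0 : dfun := fun=> 0.
Definition dfunN (x : dfun) : dfun := fun n => - x n.
Definition dfunD (x y : dfun) : dfun := fun n => x n + y n.
Definition dfunZ (a : k) (x : dfun) : dfun := fun n => a *: x n.

Fact dfunDA : associative dfunD.
Proof. by move=> x y z; apply/functional_extensionality_dep => n; apply: addrA. Qed.
Fact dfunDC : commutative dfunD.
Proof. by move=> x y; apply/functional_extensionality_dep => n; apply: addrC. Qed.
Fact dfun0D : left_id dfun0 dfunD.
Proof. by move=> x; apply/functional_extensionality_dep => n; apply: add0r. Qed.
Fact dfunND : left_inverse dfun0 dfunN dfunD.
Proof. by move=> x; apply/functional_extensionality_dep => n; apply: addNr. Qed.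

HB.instance Definition _ :=
  GRing.isZmodule.Build dfun dfunDA dfunDC dfun0D dfunND.

Fact dfunZA a b x : dfunZ a (dfunZ b x) = dfunZ (a * b) x.
Proof. by apply/functional_extensionality_dep => n; apply: scalerA. Qed.
Fact dfunZ1 : left_id 1 dfunZ.
Proof. by move=> x; apply/functional_extensionality_dep => n; apply: scale1r. Qed.
Fact dfunZDr : right_distributive dfunZ +%R.
Proof. by move=> a x y; apply/functional_extensionality_dep => n; apply: scalerDr. Qed.
Fact dfunZDl x : {morph dfunZ^~ x : a b / a + b}.
Proof. by move=> a b; apply/functional_extensionality_dep => n; apply: scalerDl. Qed.

HB.instance Definition _ := GRing.Zmodule_isLmodule.Build k dfun
  dfunZA dfunZ1 dfunZDr dfunZDl.

Definition fin_support : {pred dfun} := fun x =>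
  `[< exists N, forall n, (N <= n)%N -> x n = 0 >].

Fact fin_support_submod_closed : submod_closed fin_support.
Proof.
split=> [|a x y /asboolP[M xM] /asboolP[N yN]]; apply/asboolP; first by exists 0.
exists (maxn M N) => n; rewrite geq_max => /andP[Mn Nn].
by rewrite -[LHS]/(a *: x n + y n) xM // yN // scaler0 addr0.
Qed.

HB.instance Definition _ :=
  GRing.isSubmodClosed.Build k dfun fin_support fin_support_submod_closed.

Record dsum_type : predArgType := DSum {dsum_fun : dfun; _ : dsum_fun \in fin_support}.
HB.instance Definition _ := [isSub for dsum_fun].
HB.instance Definition _ := [Choice of dsum_type by <:].
HB.instance Definition _ := [SubChoice_isSubZmodule of dsum_type by <:].
HB.instance Definition _ := [SubZmodule_isSubLmodule of dsum_type by <:].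

Definition dsum : lmodType k := dsum_type.

Definition component (x : dsum) (n : nat) : V n := dsum_fun x n.
Arguments component : simpl never.

Fact dinj_subproof n (v : V n) : dfwith dfun0 v \in fin_support.
Proof.
apply/asboolP; exists n.+1 => m nm; apply: dfwith_out.
by rewrite neq_ltn nm.
Qed.
Definition dinj n (v : V n) : dsum := DSum (dinj_subproof v).

Fact dsum_bound_subproof (x : dsum) :
  exists N, forall n, (N <= n)%N -> component x n = 0.
Proof. by case: x => x xP; apply/asboolP. Qed.
Definition dsum_bound (x : dsum) : nat := projT1 (cid (dsum_bound_subproof x)).

(* Meaningful only when every f n is linear: see dlift_linear and dlift_dinj. *)
Definition dlift (U : lmodType k) (f : forall n, V n -> U) (x : dsum) : U :=
  \sum_(n < dsum_bound x) f n (component x n).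

Lemma componentP (a : k) (x y : dsum) n :
  component (a *: x + y) n = a *: component x n + component y n.
Proof. by []. Qed.

Lemma dsum_ext (x y : dsum) : (forall n, component x n = component y n) -> x = y.
Proof. by move=> xy; apply/val_inj/functional_extensionality_dep. Qed.

Lemma component_dinj n (v : V n) : component (dinj v) n = v.
Proof. exact: dfwith_in. Qed.

Lemma component_dinj_neq m n (v : V n) : n != m -> component (dinj v) m = 0.
Proof. exact: dfwith_out. Qed.

Section Lift.
Variables (U : lmodType k) (f : forall n, V n -> U).
Hypothesis f_linear : forall n, linear (@f n).

Lemma dlift_f0 n : f (0 : V n) = 0.
Proof.
by have := @f_linear n (-1) 0 0; rewrite scaler0 addr0 scaleN1r addNr.
Qed.

Lemma dliftEw (x : dsum) N : (forall n, (N <= n)%N -> component x n = 0) ->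
  dlift f x = \sum_(n < N) f (component x n).
Proof.
rewrite /dlift /dsum_bound; case: cid => /= M xM xN.
have key P Q (xQ : forall n, (Q <= n)%N -> component x n = 0) : (P <= Q)%N ->
    (forall n, (P <= n)%N -> component x n = 0) ->
    \sum_(n < Q) f (component x n) = \sum_(n < P) f (component x n).
  move=> PQ xP; rewrite -!(big_mkord xpredT (fun n => f (component x n))).
  rewrite (big_cat_nat (n := P)) //= [X in _ + X]big1_seq ?addr0 // => i.
  by rewrite mem_index_iota => /andP[_ /andP[Pi _]]; rewrite xP // dlift_f0.
case: (leqP M N) => [MN|/ltnW NM]; first by rewrite (key _ _ xN MN xM).
exact: key.
Qed.

Lemma dlift_linear : linear (dlift f).
Proof.
move=> a x y; have [M xM] := dsum_bound_subproof x.
have [N yN] := dsum_bound_subproof y.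
have xM' n : (maxn M N <= n)%N -> component x n = 0.
  by rewrite geq_max => /andP[/xM].
have yN' n : (maxn M N <= n)%N -> component y n = 0.
  by rewrite geq_max => /andP[_ /yN].
have xyMN n : (maxn M N <= n)%N -> component (a *: x + y) n = 0.
  by move=> le; rewrite componentP xM' // yN' // scaler0 addr0.
rewrite (dliftEw xM') (dliftEw yN') (dliftEw xyMN).
rewrite scaler_sumr -big_split /=; apply: eq_bigr => n _.
exact: f_linear.
Qed.

Lemma dlift_dinj n (v : V n) : dlift f (dinj v) = f v.
Proof.
have vn m : (n < m)%N -> component (dinj v) m = 0.
  by move=> nm; rewrite component_dinj_neq // neq_ltn nm.
rewrite (dliftEw vn).
rewrite big_ord_recr /= component_dinj big1 ?add0r // => i _.
by rewrite component_dinj_neq ?dlift_f0 // neq_ltn ltn_ord orbT.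
Qed.

End Lift.
End DirectSum.

Lemma dinj0 (k : fieldType) (V : nat -> lmodType k) n : dinj (0 : V n) = 0.
Proof.
apply: dsum_ext => m; have [<-|nm] := eqVneq n m; first exact: component_dinj.
exact: component_dinj_neq.
Qed.

Lemma dinj_linear (k : fieldType) (V : nat -> lmodType k) n :
  linear (@dinj k V n).
Proof.
move=> a u v; apply: dsum_ext => m; rewrite componentP.
have [<-|nm] := eqVneq n m; first by rewrite !component_dinj.
by rewrite !component_dinj_neq // scaler0 addr0.
Qed.

Lemma dlift_fun_linear (k : fieldType) (V : nat -> lmodType k)
    (U : lmodType k) (f g h : forall n, V n -> U) a x :
  (forall n v, f n v = a *: g n v + h n v) ->
  dlift f x = a *: dlift g x + dlift h x.
Proof.
move=> fgh; rewrite /dlift scaler_sumr -big_split /=.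
by apply: eq_bigr => n _; rewrite fgh.
Qed.

Section Homology.
Variables (k : fieldType) (U V W : lmodType k).
Variables (f : {linear U -> V}) (g : {linear V -> W}).

Definition is_cycle : {pred V} := fun x => g x == 0.

Fact is_cycle_submod_closed : submod_closed is_cycle.
Proof.
split=> [|a x y /eqP gx /eqP gy]; first exact/eqP/linear0.
by apply/eqP; rewrite linearP gx gy scaler0 addr0.
Qed.

HB.instance Definition _ :=
  GRing.isSubmodClosed.Build k V is_cycle is_cycle_submod_closed.

Record cycles : predArgType := Cycle {chain_of : V; _ : chain_of \in is_cycle}.
HB.instance Definition _ := [isSub for chain_of].
HB.instance Definition _ := [Choice of cycles by <:].
HB.instance Definition _ := [SubChoice_isSubZmodule of cycles by <:].
HB.instance Definition _ := [SubZmodule_isSubLmodule of cycles by <:].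

(* The relators are the boundaries that lie in ker g. *)
Definition homology : lmodType k :=
  quo (fun z : cycles => exists u, f u = chain_of z).

(* c is a cycle and h is its class. *)
Definition represents (c : V) (h : homology) :=
  exists2 z : cycles, chain_of z = c & h = quo_pi z.

End Homology.

Section Multilinear.
Variables (k : fieldType) (V : lmodType k) (n : nat).

Definition upd (t : n.-tuple V) (i : 'I_n) (v : V) : n.-tuple V :=
  [tuple if j == i then v else tnth t j | j < n].

Inductive multilin_rel : {malg k[n.-tuple V]} -> Prop :=
| MultilinRel a t i u v : multilin_rel
    (<< upd t i (a *: u + v) >> - (a *: << upd t i u >> + << upd t i v >>)).

Inductive altern_rel : {malg k[n.-tuple V]} -> Prop :=
| AlternMultilin r of multilin_rel r : altern_rel r
| AlternRel (t : n.-tuple V) i j of i != j & tnth t i = tnth t j :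
    altern_rel << t >>.

Definition tens_pow : lmodType k := quo multilin_rel.
Definition ext_pow : lmodType k := quo altern_rel.

Definition pure_pow (t : n.-tuple V) : tens_pow := quo_pi << t >>.
Definition wedge (t : n.-tuple V) : ext_pow := quo_pi << t >>.

End Multilinear.

Section TensToExt.
Variables (k : fieldType) (V W : lmodType k) (f : {linear V -> W}) (n : nat).

Let F : {linear {malg k[n.-tuple V]} -> ext_pow W n} :=
  free_lift (fun t : n.-tuple V => wedge [tuple f (tnth t i) | i < n]).

Fact tens_to_ext_subproof r : multilin_rel r -> F r = 0.
Proof.
case=> a t i u v; rewrite linearB linearD linearZ /= !free_liftE.
set t' := [tuple f (tnth t j) | j < n].
have fupd w : [tuple f (tnth (upd t i w) j) | j < n] = upd t' i (f w).
  by apply/eq_from_tnth => j; rewrite !tnth_mktuple; case: eqP.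
rewrite /wedge !fupd -linearZ -linearD -linearB; apply: quo_pi_rel.
by rewrite linearP; apply/AlternMultilin/MultilinRel.
Qed.

(* v_1 (x) ... (x) v_n |-> f v_1 /\ ... /\ f v_n *)
Definition tens_to_ext : {linear tens_pow V n -> ext_pow W n} :=
  quo_map tens_to_ext_subproof.

End TensToExt.

Section ScalarExtension.
Variables (G : zmodType) (k : fieldType).

(* Presentation of G (x)_Z k as a k-module by generators (g, a). *)
Inductive scal_rel : {malg k[(G * k)%type]} -> Prop :=
| ScalRelL g h a : scal_rel (<< (g + h, a) >> - (<< (g, a) >> + << (h, a) >>))
| ScalRelR g a b : scal_rel (<< (g, a + b) >> - (<< (g, a) >> + << (g, b) >>))
| ScalRelZ g a b : scal_rel (<< (g, a * b) >> - a *: << (g, b) >>).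

Definition scal_ext : lmodType k := quo scal_rel.
Definition scal_pure (g : G) (a : k) : scal_ext := quo_pi << (g, a) >>.

End ScalarExtension.

Record pointed_rack := PointedRack {
  rack_sort :> choiceType;
  rack_op : rack_sort -> rack_sort -> rack_sort;
  rack_pt : rack_sort;
  rack_distr : forall a b c,
    rack_op (rack_op a b) c = rack_op (rack_op a c) (rack_op b c);
  rack_bij : forall b, bijective (fun a => rack_op a b);
  rack_op_pt : forall a, rack_op rack_pt a = rack_pt;
  rack_pt_op : forall a, rack_op a rack_pt = a
}.

Section ConjRack.
Variable G : zmodType.

Definition conj_op (h g : G) : G := - g + h + g.

Fact conj_opE h g : conj_op h g = h.
Proof. by rewrite /conj_op addrC addNKr. Qed.

Fact conj_distr a b c :
  conj_op (conj_op a b) c = conj_op (conj_op a c) (conj_op b c).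
Proof. by rewrite !conj_opE. Qed.
Fact conj_bij b : bijective (fun a => conj_op a b).
Proof. by exists id => a; rewrite conj_opE. Qed.
Fact conj_op_pt a : conj_op 0 a = 0.
Proof. exact: conj_opE. Qed.
Fact conj_pt_op a : conj_op a 0 = a.
Proof. exact: conj_opE. Qed.

Definition conj_rack : pointed_rack :=
  PointedRack conj_distr conj_bij conj_op_pt conj_pt_op.

End ConjRack.

Section RackComplex.
Variables (k : fieldType) (X : pointed_rack).
Local Notation "a ◁ b" := (rack_op a b) (at level 40).

Inductive degenerate n : {malg k[n.-tuple X]} -> Prop :=
| Degenerate (t : n.-tuple X) of rack_pt X \in t : degenerate << t >>.

Definition CR n : lmodType k := quo (@degenerate n).

Definition CR_word n (t : n.-tuple X) : CR n := quo_pi << t >>.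

Section Lift.
Variables (n : nat) (U : lmodType k) (f : n.-tuple X -> U).
Hypothesis f0 : forall t : n.-tuple X, rack_pt X \in t -> f t = 0.

Fact CR_lift_subproof r : degenerate r -> free_lift f r = 0.
Proof. by case=> t tP; rewrite free_liftE f0. Qed.
Definition CR_lift : {linear CR n -> U} := quo_map CR_lift_subproof.

Lemma CR_liftE t : CR_lift (CR_word t) = f t.
Proof. by rewrite /CR_lift quo_mapE; apply: free_liftE. Qed.

End Lift.

Lemma CR_ext n (U : lmodType k) (f g : {linear CR n -> U}) :
  (forall t, f (CR_word t) = g (CR_word t)) -> f =1 g.
Proof.
move=> fg x; rewrite -[x]quo_reprK.
exact: (@free_ext _ _ _ (f \o quo_pi) (g \o quo_pi)).
Qed.

Lemma CR_word0 n (t : n.-tuple X) : rack_pt X \in t -> CR_word t = 0.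
Proof. by move=> tP; apply: quo_pi_rel. Qed.

Definition face0 n (t : n.-tuple X) (i : 'I_n) : n.-1.-tuple X :=
  [tuple tnth t (lift i j) | j < n.-1].

Definition face1 n (t : n.-tuple X) (i : 'I_n) : n.-1.-tuple X :=
  [tuple if (lift i j < i)%N then tnth t (lift i j) ◁ tnth t i
         else tnth t (lift i j) | j < n.-1].

(* The index i starts at 0, so that (-1)^(i+1) becomes (-1)^i. *)
Definition rack_bnd n (t : n.-tuple X) : CR n.-1 :=
  \sum_(i < n) (-1) ^+ i *: (CR_word (face1 t i) - CR_word (face0 t i)).

Fact rack_bnd0 n (t : n.-tuple X) : rack_pt X \in t -> rack_bnd t = 0.
Proof.
case/tnthP => i ti; rewrite /rack_bnd big1 // => j _.
have [<-|/eqP ij] := eqVneq i j.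
  suff -> : face1 t i = face0 t i by rewrite subrr scaler0.
  by apply/eq_from_tnth => l; rewrite !tnth_mktuple -ti rack_pt_op if_same.
have /unlift_some[l il _] : j != i by apply/eqP => ji; apply: ij.
rewrite !CR_word0 ?subrr ?scaler0 //; apply/tnthP; exists l;
  by rewrite tnth_mktuple -il -ti // rack_op_pt if_same.
Qed.

(* For n = 0 the sum rack_bnd is empty and this is the zero map. *)
Definition rack_d n : {linear CR n -> CR n.-1} := CR_lift (@rack_bnd0 n).

Definition HR n : lmodType k := homology (rack_d n.+1) (rack_d n).

Definition HR_represents n : CR n -> HR n -> Prop :=
  @represents _ _ _ _ (rack_d n.+1) (rack_d n).

End RackComplex.

Record rack_hom (X Y : pointed_rack) := RackHom {
  rack_hom_fun :> X -> Y;
  rack_homM : forall a b,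
    rack_hom_fun (rack_op a b) = rack_op (rack_hom_fun a) (rack_hom_fun b);
  rack_hom_pt : rack_hom_fun (rack_pt X) = rack_pt Y
}.

Section AddHom.
Variable G : zmodType.

Definition add_pair (x : G * G) : G := x.1 + x.2.

Fact add_pairM (a b : conj_rack (G * G)%type) :
  add_pair (rack_op a b) = rack_op (add_pair a : conj_rack G) (add_pair b).
Proof. by rewrite /= !conj_opE. Qed.
Fact add_pair_pt :
  add_pair (rack_pt (conj_rack (G * G)%type)) = rack_pt (conj_rack G).
Proof. exact: addr0. Qed.

Definition add_hom : rack_hom (conj_rack (G * G)%type) (conj_rack G) :=
  @RackHom (conj_rack (G * G)%type) (conj_rack G) add_pair add_pairM add_pair_pt.

End AddHom.

Section RackMap.
Variables (k : fieldType) (X Y : pointed_rack) (f : rack_hom X Y) (n : nat).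

Let F (t : n.-tuple X) : CR k Y n := CR_word k (map_tuple f t).

Fact CR_map_subproof t : rack_pt X \in t -> F t = 0.
Proof.
by move=> tP; apply: CR_word0; rewrite -(rack_hom_pt f); apply: map_f.
Qed.

Definition CR_map : {linear CR k X n -> CR k Y n} := CR_lift CR_map_subproof.

End RackMap.

Section RackProduct.
Variables (k : fieldType) (G : zmodType).
Local Notation X := (conj_rack G).
Local Notation X2 := (conj_rack (G * G)%type).

Definition cross_word p q (s : p.-tuple X) (t : q.-tuple X) : CR k X2 (p + q) :=
  CR_word k (cat_tuple (map_tuple (fun g : G => (g, 0) : X2) s)
                       (map_tuple (fun h : G => (0, h) : X2) t)).

Fact cross_word0r p q (s : p.-tuple X) (t : q.-tuple X) :
  rack_pt X \in t -> cross_word s t = 0.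
Proof.
move=> tP; apply: CR_word0; rewrite mem_cat; apply/orP; right.
by apply/mapP; exists (0 : G).
Qed.

Fact cross_word0l p q (s : p.-tuple X) (b : CR k X q) : rack_pt X \in s ->
  CR_lift (@cross_word0r p q s) b = 0.
Proof.
move=> sP; pose z : {linear CR k X q -> CR k X2 (p + q)} := \0.
apply: (CR_ext (g := z)) => t; rewrite CR_liftE.
apply: CR_word0; rewrite mem_cat; apply/orP; left.
by apply/mapP; exists (0 : G).
Qed.

(* The bilinear extension of cross_word. *)
Definition CR_cross p q (a : CR k X p) (b : CR k X q) : CR k X2 (p + q) :=
  CR_lift (fun s => @cross_word0l p q s b) a.

Lemma CR_crossE p q (s : p.-tuple X) (t : q.-tuple X) :
  CR_cross (CR_word k s) (CR_word k t) = cross_word s t.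
Proof. by rewrite /CR_cross !CR_liftE. Qed.

Definition CR_star p q (a : CR k X p) (b : CR k X q) : CR k X (p + q) :=
  CR_map k (add_hom G) (p + q) (CR_cross a b).

Lemma CR_starE p q (s : p.-tuple X) (t : q.-tuple X) :
  CR_star (CR_word k s) (CR_word k t) = CR_word k (cat_tuple s t).
Proof.
rewrite /CR_star CR_crossE /CR_map CR_liftE; congr (CR_word k _).
apply/val_inj; rewrite /= map_cat -!map_comp.
by congr (_ ++ _); apply: map_id_in => g _ /=; rewrite /add_pair /= ?addr0 ?add0r.
Qed.

End RackProduct.

Section BarComplex.
Variables (k : fieldType) (G : zmodType).

Inductive bar_degenerate n : {malg k[n.-tuple G]} -> Prop :=
| BarDegenerate (t : n.-tuple G) of 0 \in t : bar_degenerate << t >>.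

Definition bar n : lmodType k := quo (@bar_degenerate n).

Definition bar_word n (t : n.-tuple G) : bar n := quo_pi << t >>.

Lemma bar_word0 n (t : n.-tuple G) : 0 \in t -> bar_word t = 0.
Proof. by move=> tP; apply: quo_pi_rel. Qed.

(* The faces (g_2, .., g_n), (.., g_i + g_(i+1), ..) and (g_1, .., g_(n-1)), *)
(* for i = 0, for 0 < i < n and for i = n.                                   *)
Definition bar_face n (t : n.-tuple G) (i : 'I_n.+1) : n.-1.-tuple G :=
  [tuple if (j.+1 < i)%N then t`_j else
         if j.+1 == i then t`_j + t`_j.+1 else t`_j.+1 | j < n.-1].

(* The condition 0 < n makes the differential vanish in degree 0. *)
Definition bar_bnd n (t : n.-tuple G) : bar n.-1 :=
  \sum_(i < n.+1 | (0 < n)%N) (-1) ^+ i *: bar_word (bar_face t i).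

Fact bar_bnd0 n (t : n.-tuple G) : 0 \in t -> bar_bnd t = 0.
Proof.
case: n t => [|n] t; first by case/tnthP => -[].
case/tnthP => i ti; rewrite /bar_bnd /=.
have t0 : t`_i = 0 by rewrite -tnth_nth -ti.
pose i0 := widen_ord (leqnSn n.+1) i; pose i1 := lift ord0 i.
rewrite (eq_bigl xpredT) // (bigD1 i0) //= (bigD1 i1) /=; last first.
  by rewrite -val_eqE /= neq_ltn ltnSn orbT.
rewrite big1 ?addr0 => [|j /andP[j0 j1]].
  suff -> : bar_face t i1 = bar_face t i0.
    by rewrite exprS mulN1r scaleNr subrr.
  apply/eq_from_tnth => j; rewrite !tnth_mktuple /= /bump /= add1n !ltnS eqSS.
  have [ji|ij|ji] := ltngtP j i.
  - move: ji; rewrite leq_eqVlt => /orP[/eqP ->|->//].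
    by rewrite ltnn eqxx t0 addr0.
  - rewrite ltnNge (leq_trans (ltnW ij) (leqnSn j)) /= gtn_eqF //.
    by rewrite ltnS ltnW.
  - by rewrite ji ltnNge leqnSn /= gtn_eqF // t0 add0r.
rewrite bar_word0 ?scaler0 //.
have {}j0 : j != i :> nat by [].
have {}j1 : j != i.+1 :> nat by [].
have [ji|ij] := leqP j i.
  have {}ji : (j < i)%N by rewrite ltn_neqAle j0.
  have ii : (i.-1 < n)%N by rewrite prednK ?(leq_ltn_trans _ ji) // -ltnS.
  apply/tnthP; exists (Ordinal ii); rewrite tnth_mktuple /=.
  rewrite prednK ?(leq_ltn_trans _ ji) // ltnNge (ltnW ji) /=.
  by rewrite gtn_eqF.
have {}ij : (i.+1 < j)%N by rewrite ltn_neqAle eq_sym j1.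
have ii : (i < n)%N by have := ltn_ord j; rewrite -ltnS => /(leq_trans ij).
by apply/tnthP; exists (Ordinal ii); rewrite tnth_mktuple /= ij.
Qed.

Let F n : {linear {malg k[n.-tuple G]} -> bar n.-1} := free_lift (@bar_bnd n).

Fact bar_d_subproof n r : bar_degenerate r -> F n r = 0.
Proof. by case=> t tP; rewrite -(bar_bnd0 tP); apply: free_liftE. Qed.

Definition bar_d n : {linear bar n -> bar n.-1} := quo_map (@bar_d_subproof n).

Definition group_homology n : lmodType k := homology (bar_d n.+1) (bar_d n).

Definition bar_represents n : bar n -> group_homology n -> Prop :=
  @represents _ _ _ _ (bar_d n.+1) (bar_d n).

(* Pontryagin product of the classes of the entries of t. *)
Definition antisym n (t : n.-tuple G) : bar n :=
  \sum_(s : {perm 'I_n}) (-1) ^+ s *: bar_word [tuple tnth t (s i) | i < n].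

Fact antisym0 n (t : n.-tuple (conj_rack G)) :
  rack_pt (conj_rack G) \in t -> antisym t = 0.
Proof.
case/tnthP => i ti; rewrite /antisym big1 // => s _.
rewrite bar_word0 ?scaler0 //; apply/tnthP; exists ((s^-1)%g i).
by rewrite tnth_mktuple permKV -ti.
Qed.

Definition CR_antisym n : {linear CR k (conj_rack G) n -> bar n} :=
  CR_lift (@antisym0 n).

End BarComplex.

Section CoZinbiel.
Variables (k : fieldType) (C : nat -> lmodType k).
Local Notation Cbar := (dsum C).

Definition twist : tens Cbar Cbar -> tens Cbar Cbar :=
  tens_lift (fun a b => dlift (fun m (a' : C m) => dlift (fun n (b' : C n) =>
    (-1) ^+ (m * n) *: (dinj b' ⊗ dinj a')) b) a).

Lemma twistE m n (a : C m) (b : C n) :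
  twist (dinj a ⊗ dinj b) = (-1) ^+ (m * n) *: (dinj b ⊗ dinj a).
Proof.
have [pl pr] := pure_bilin Cbar Cbar.
have lin_b p (a' : C p) q :
    linear (fun b' : C q => (-1) ^+ (p * q) *: (dinj b' ⊗ dinj a')).
  move=> c b' b''; rewrite dinj_linear pl scalerDr !scalerA.
  by rewrite [c * _]mulrC.
have lin_a y p : linear (fun a' : C p => dlift (fun q (b' : C q) =>
    (-1) ^+ (p * q) *: (dinj b' ⊗ dinj a')) y).
  move=> c a' a''; apply: dlift_fun_linear => q b'.
  by rewrite dinj_linear pr scalerDr !scalerA [c * _]mulrC.
rewrite /twist tens_liftE => [|]; last first.
  split=> [y|x c y y']; first by apply: dlift_linear => p; apply: lin_a.
  by apply: dlift_fun_linear => p a'; apply: dlift_linear => q; apply: lin_b.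
rewrite dlift_dinj => [|p]; last exact: lin_a.
by rewrite dlift_dinj => // q; apply: lin_b.
Qed.

Inductive tens_homogeneous n : tens Cbar Cbar -> Prop :=
| TensHomogeneous p q (a : C p) (b : C q) of (p + q)%N = n :
    tens_homogeneous n (dinj a ⊗ dinj b).

Record coZinbiel_coalgebra (D : Cbar -> tens Cbar Cbar) : Prop := {
  coZ_linear : linear D;
  coZ_graded : forall n (x : C n), D (dinj x) \in span (tens_homogeneous n);
  coZ_relation : forall x,
    tens_assoc (tens_map D id (D x)) =
    tens_map id D (D x) + tens_map id (twist \o D) (D x)
}.

Section Filtration.
Variable D : Cbar -> tens Cbar Cbar.

(* coradical r is F_(r+1). *)
Fixpoint coradical (r : nat) : Cbar -> Prop :=
  match r with
  | 0 => fun x => D x = 0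
  | r'.+1 => fun x => D x \in span (fun t =>
      exists a b, [/\ coradical r' a, coradical r' b & t = a ⊗ b])
  end.

Definition connected := forall x, exists r, coradical r x.

End Filtration.

(* H = C (+) k with k in degree 0; the regular module k^o is k as a k-module. *)
Definition augment : lmodType k := (Cbar * k^o)%type.
Local Notation H := augment.

Definition aug_incl (x : Cbar) : H := (x, 0).
Definition aug_unit : H := (0, 1).

Definition aug_homogeneous n (h : H) :=
  (forall m, m != n -> component h.1 m = 0) /\ (n != 0%N -> h.2 = 0).

(* Sum of f n h_n over the homogeneous components h_n of h. *)
Definition aug_lift (U : lmodType k) (f : nat -> H -> U) (h : H) : U :=
  dlift (fun n (x : C n) => f n (dinj x, 0)) h.1 + f 0%N (0, h.2).

Variables (D : Cbar -> tens Cbar Cbar) (star : H -> H -> H).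

Definition coproduct_prec (x : Cbar) : tens H H :=
  aug_incl x ⊗ aug_unit + tens_map aug_incl aug_incl (D x).

(* coproduct (x + c 1) = x (x) 1 + 1 (x) x + D x + twist (D x) + c (1 (x) 1) *)
Definition coproduct (h : H) : tens H H :=
  aug_incl h.1 ⊗ aug_unit + aug_unit ⊗ aug_incl h.1
  + tens_map aug_incl aug_incl (D h.1 + twist (D h.1))
  + h.2 *: (aug_unit ⊗ aug_unit).

(* (a (x) b, c (x) d) |-> (-1)^(|b||c|) (a * c) (x) (b * d) *)
Definition star_tens (t u : tens H H) : tens H H :=
  tens_lift (fun a b => tens_lift (fun c d =>
    aug_lift (fun m b' => aug_lift (fun n c' =>
      (-1) ^+ (m * n) *: (star a c' ⊗ star b' d)) c) b) u) t.

Record coZinbiel_assoc_bialgebra : Prop := {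
  bialg_coZ : coZinbiel_coalgebra D;
  bialg_bilin : bilin star;
  bialg_graded : forall m n x y, aug_homogeneous m x -> aug_homogeneous n y ->
    aug_homogeneous (m + n) (star x y);
  bialg_assoc : associative star;
  bialg_1l : left_id aug_unit star;
  bialg_1r : right_id aug_unit star;
  (* C * H is contained in C, so that coproduct_prec applies to it. *)
  bialg_ideal : forall (x : Cbar) (y : H), (star (aug_incl x) y).2 = 0;
  bialg_semi_hopf : forall (x : Cbar) (y : H),
    coproduct_prec (star (aug_incl x) y).1 =
    star_tens (coproduct_prec x) (coproduct y)
}.

End CoZinbiel.

Section RackCoproduct.
Variables (k : fieldType) (X : pointed_rack).
Local Notation "a ◁ b" := (rack_op a b) (at level 40).

(* Permutations of {0, .., n-1} that are increasing on {0, .., p-1} and on *)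
(* {p, .., n-1} and fix 0.                                                 *)
Definition shuffle1 n p (s : {perm 'I_n}) : bool :=
  [forall i : 'I_n, forall j : 'I_n,
     (i < j)%N && ((j < p)%N || (p <= i)%N) ==> (s i < s j)%N]
  && [forall i : 'I_n, (i == 0%N :> nat) ==> (s i == i)].

(* x_i^s: the entry of index s i acted on, in increasing order, by the *)
(* entries of index l > s i with l in s {0, .., p-1}.                  *)
Definition shuffle_act n p (s : {perm 'I_n}) (t : n.-tuple X) (i : 'I_n) : X :=
  foldl (fun x l => x ◁ tnth t l) (tnth t (s i))
    [seq l : 'I_n <- enum 'I_n | (s i < l)%N && ((s^-1)%g l < p)%N].

Definition left_ord n (p : 'I_n.+1) (j : 'I_p) : 'I_n :=
  widen_ord (leq_ord p) j.
Definition right_ord n (p : 'I_n.+1) (j : 'I_(n - p)) : 'I_n :=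
  cast_ord (subnKC (leq_ord p)) (rshift p j).

Local Notation CRtot := (dsum (CR k X)).

Definition unshuffle n (t : n.-tuple X) : tens CRtot CRtot :=
  \sum_(p < n.+1 | (0 < p < n)%N) \sum_(s : {perm 'I_n} | shuffle1 p s)
    (-1) ^+ s *:
      (dinj (CR_word k [tuple tnth t (s (left_ord j)) | j < p]) ⊗
       dinj (CR_word k [tuple shuffle_act p s t (right_ord j) | j < n - p])).

Fact unshuffle0 n (t : n.-tuple X) : rack_pt X \in t -> unshuffle t = 0.
Proof.
case/tnthP => i ti; rewrite /unshuffle big1 // => p _; rewrite big1 // => s _.
pose i' := (s^-1)%g i; have si' : s i' = i by rewrite permKV.
have [i'p|pi'] := ltnP i' p.
  rewrite (@CR_word0 _ _ p) ?dinj0 ?pure0l ?scaler0 //.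
  apply/tnthP; exists (Ordinal i'p); rewrite tnth_mktuple.
  have -> : left_ord (Ordinal i'p) = i' by apply/val_inj.
  by rewrite si'.
rewrite (@CR_word0 _ _ (n - p)) ?dinj0 ?pure0r ?scaler0 //.
have lt : (i' - p < n - p)%N by rewrite ltn_sub2r // (leq_ltn_trans pi').
apply/tnthP; exists (Ordinal lt); rewrite tnth_mktuple.
have -> : right_ord (Ordinal lt) = i' by apply/val_inj; rewrite /= subnKC.
rewrite /shuffle_act si' -ti; elim: [seq _ <- _ | _] => //= l ls.
by rewrite rack_op_pt.
Qed.

Definition CR_coproduct n : {linear CR k X n -> tens CRtot CRtot} :=
  CR_lift (@unshuffle0 n).

(* CRtens_d is a (x) b |-> d a (x) b + (-1)^|a| a (x) d b. *)
Definition CRtot_d : CRtot -> CRtot := dlift (fun n c => dinj (rack_d k X n c)).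
Definition CRtens_d : tens CRtot CRtot -> tens CRtot CRtot :=
  tens_lift (fun a b => CRtot_d a ⊗ b +
    dlift (fun n (a' : CR k X n) => (-1) ^+ n *: (dinj a' ⊗ CRtot_d b)) a).

(* V with its component of degree 0 replaced by the zero module. *)
Definition positive_part (V : nat -> lmodType k) (n : nat) : lmodType k :=
  if n is m.+1 then V m.+1 else 'rV[k]_0.

Definition HRbar : nat -> lmodType k := positive_part (HR k X).

Definition HRbar_represents (c : CRtot) (h : dsum HRbar) :=
  component c 0 = 0 /\
  forall n, HR_represents (component c n.+1) (component h n.+1 : HR k X n.+1).

(* D is induced by the chain map CR_coproduct through the Kunneth isomorphism *)
(* HR (x) HR = H(CR (x) CR): for a cycle z, D [z] = sum_i [a_i] (x) [b_i] with *)
(* a_i, b_i cycles such that sum_i a_i (x) b_i is homologous to the coproduct *)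
(* of z. This determines D.                                                   *)
Definition coproduct_induced (D : dsum HRbar -> tens (dsum HRbar) (dsum HRbar)) :=
  forall n (z : CR k X n.+1) (h : HR k X n.+1), HR_represents z h ->
  exists (m : nat) (a b : 'I_m -> CRtot) (a' b' : 'I_m -> dsum HRbar),
    [/\ forall i, HRbar_represents (a i) (a' i),
        forall i, HRbar_represents (b i) (b' i),
        exists u, CR_coproduct n.+1 z = \sum_i a i ⊗ b i + CRtens_d u &
        D (dinj (h : HRbar n.+1)) = \sum_i a' i ⊗ b' i].

(* The inclusion of HR_n in HRbar (+) k, where e0 identifies HR_0 with k. *)
Definition HR_incl (e0 : HR k X 0 -> k^o) n : HR k X n -> augment HRbar :=
  if n is m.+1 then fun h => (dinj (h : HRbar m.+1), 0) else fun h => (0, e0 h).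

End RackCoproduct.

Section RackHomologyAbelian.
Variables (k : fieldType) (G : zmodType).
Local Notation X := (conj_rack G).

Definition product_induced (e0 : HR k X 0 -> k^o)
    (star : augment (HRbar k X) -> augment (HRbar k X) -> augment (HRbar k X)) :=
  forall p q (a : CR k X p) (b : CR k X q) (x : HR k X p) (y : HR k X q),
  HR_represents a x -> HR_represents b y ->
  exists2 z : HR k X (p + q), HR_represents (CR_star a b) z &
    star (HR_incl e0 x) (HR_incl e0 y) = HR_incl e0 z.

Definition antisym_induced n (S : HR k X n -> group_homology k G n) :=
  forall (a : CR k X n) (x : HR k X n), HR_represents a x ->
  bar_represents (CR_antisym k G n a) (S x).

Definition nonzero : choiceType := {g : G | g != 0}.
Definition free_nonzero : lmodType k := {malg k[nonzero]}.

Definition nonzero_to_scal : {linear free_nonzero -> scal_ext G k} :=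
  free_lift (fun g : nonzero => scal_pure (val g) (1 : k)).

End RackHomologyAbelian.

(* Main.v *)
Require Import Defs.
From HB Require Import structures.
From mathcomp Require Import all_boot all_fingroup all_algebra.
From mathcomp Require Import finmap monalg boolp zify.
Set Implicit Arguments.
Unset Strict Implicit.
Unset Printing Implicit Defensive.
Import GRing.Theory.
Local Open Scope ring_scope.

(** Conjugation in an abelian group G is trivial, so the two families of faces
    of the rack complex coincide and its differential is zero (rack_d_abelian).
    Hence HR_n is CR_n, the space of words of length n with the words containing
    0 set to zero, and sending a word to the tensor product of its letters
    identifies it with the tensor power of the free module on the nonzero
    elements (HR_to_tens_bij).

    On words, the product is concatenation and the coZinbiel coproduct is the
    signed sum over the unshuffles that keep the first letter on the left. This
    is the tensor algebra on primitive letters, and the axioms reduce to three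
    facts about sums over unshuffles, each proved by induction on the word: the
    two ways to unshuffle into three factors agree (ushsum_assoc), exchanging
    the two factors costs the Koszul sign (ushsum_comm), and the unshuffles of a
    concatenation are concatenated from those of its factors (ushsum_cat). The
    coZinbiel relation is the first fact combined with the second
    (coproduct_relation); the semi-Hopf relation is the third (semi_hopf).
    Connectedness holds because both factors of the reduced coproduct of a word
    are strictly shorter than it (coradical_word). Sums over unshuffles agree
    with sums over shuffle permutations because the first letter of the word is
    the first letter of one of the two blocks (sum_shuffle).

    The map S_n sends a word to the antisymmetrized bar chain of its letters. So
    the last assertion amounts to the Pontryagin isomorphism from the exterior
    powers of the scalar extension of G to the homology of G in characteristic
    0. This homology is computed from homogeneous chains, spanned by words
    (v_0, .., v_n) in G, modulo the translations by G (to_barK, bar_lift). The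
    prism over a chain is a homotopy from the identity to the translation by g
    (bnd_prism), so on coinvariants it maps cycles to cycles. It gives an
    operator on homology that is additive in g, because prisms over a 2-simplex
    fill the difference (bnd_prism2, prism_homD), and whose square is zero
    because it is so on chains (prismK). Iterating it on the unit therefore
    defines a linear map on exterior powers (pontryagin), and an iterated prism
    is the antisymmetrization of a bar word (to_bar_iterated).

    This map is injective because sending a bar word to the exterior product of
    its letters kills boundaries (bar_wedge_bnd) and, after the Pontryagin map,
    gives multiplication by n! (homology_wedgeK). It is surjective because
    iterated prisms span the homology (prism_spanned_generated). Indeed a cycle
    modulo translations by G is already one modulo translations by a finitely
    generated subgroup (coinv_finite), and generators are added one at a time.
    A generator of finite order m modulo the previous subgroup is handled by
    averaging m translates. For a generator t of infinite order, the boundary of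
    a cycle a is (T - 1) b, where T is the translation by t, modulo the previous
    translations; T - 1 is injective there (tr_sub_inj), so b is itself a cycle,
    and subtracting from a the prism over b by t leaves a cycle for the previous
    subgroup. *)

(** * Identities in abelian groups *)

(** Expressions in the language of abelian groups over a list of atoms; such an
    expression is determined by the integer coefficients of its atoms. *)
Inductive zexp := ZVar of nat | ZZero | ZAdd of zexp & zexp | ZOpp of zexp.

Fixpoint zeval (V : zmodType) (e : seq V) (t : zexp) : V :=
  match t with
  | ZVar i => e`_i
  | ZZero => 0
  | ZAdd t1 t2 => zeval e t1 + zeval e t2
  | ZOpp t1 => - zeval e t1
  end.

Fixpoint zcoef (t : zexp) (i : nat) : int :=
  match t with
  | ZVar j => (i == j)%:Z
  | ZZero => 0
  | ZAdd t1 t2 => zcoef t1 i + zcoef t2 i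
  | ZOpp t1 => - zcoef t1 i
  end.

Lemma zevalE (V : zmodType) (e : seq V) t :
  zeval e t = \sum_(i < size e) e`_i *~ zcoef t i.
Proof.
elim: t => [j||t1 IH1 t2 IH2|t IH] /=.
- have [je|ej] := ltnP j (size e).
    rewrite (bigD1 (Ordinal je)) //= eqxx big1 ?addr0 // => i ij.
    by rewrite (negPf (ij : (i : nat) != j)).
  rewrite nth_default // big1 // => i _.
  by rewrite ltn_eqF // (leq_trans (ltn_ord i)).
- by rewrite big1.
- by rewrite IH1 IH2 -big_split; apply: eq_bigr => i _; rewrite mulrzDr.
- by rewrite IH -sumrN; apply: eq_bigr => i _; rewrite mulrNz.
Qed.

(** The hypothesis is decided by computation, which proves the conclusion by
    reflection. *)
Lemma zeval_eq (V : zmodType) (e : seq V) t1 t2 :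
  all (fun i => zcoef t1 i == zcoef t2 i) (iota 0 (size e)) ->
  zeval e t1 = zeval e t2.
Proof.
move=> /allP t12; rewrite !zevalE; apply: eq_bigr => i _.
by rewrite (eqP (t12 i _)) // mem_iota ltn_ord.
Qed.

Ltac zindex x e :=
  match e with
  | x :: _ => constr:(0%N)
  | ?y :: _ =>
      let same := match goal with |- _ => unify x y end in constr:(0%N)
  | _ :: ?e' => let n := zindex x e' in constr:(n.+1)
  end.
Ltac zinsert x e :=
  match e with
  | _ => let n := zindex x e in constr:(e)
  | _ => constr:(x :: e)
  end.
Ltac zatoms t e :=
  lazymatch t with
  | @Algebra.add _ ?a ?b => let e1 := zatoms a e in zatoms b e1
  | @Algebra.opp _ ?a => zatoms a e
  | @Algebra.zero _ => constr:(e)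
  | _ => zinsert t e
  end.
Ltac zreify t e :=
  lazymatch t with
  | @Algebra.add _ ?a ?b =>
      let u := zreify a e in let v := zreify b e in constr:(ZAdd u v)
  | @Algebra.opp _ ?a => let u := zreify a e in constr:(ZOpp u)
  | @Algebra.zero _ => constr:(ZZero)
  | _ => let n := zindex t e in constr:(ZVar n)
  end.
(** Proves the identities that hold in every abelian group. *)
Ltac zmod := rewrite /=;
  lazymatch goal with
  | |- @eq ?T ?a ?b =>
    let e0 := zatoms a (@nil T) in
    let e := zatoms b e0 in
    let u := zreify a e in
    let v := zreify b e in
    exact: (@zeval_eq _ e u v isT)
  end.

(** * Linear maps, subspaces and maps induced on homology *)

Local Notation span := Defs.span.

Section LinearTools.
Variable k : fieldType.

Definition mklin (U V : lmodType k) (f : U -> V) (fL : linear f) :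
  {linear U -> V} := HB.pack f (GRing.isLinear.Build k U V *:%R f fL).

Lemma mklinE (U V : lmodType k) (f : U -> V) (fL : linear f) x :
  mklin fL x = f x.
Proof. by []. Qed.

Definition subspace (V : lmodType k) (P : V -> Prop) :=
  P 0 /\ forall a u v, P u -> P v -> P (a *: u + v).

Section Subspace.
Variables (V : lmodType k) (P : V -> Prop).
Hypothesis PS : subspace P.

Lemma subspaceD u v : P u -> P v -> P (u + v).
Proof. by move=> Pu Pv; rewrite -[u]scale1r; apply: PS.2. Qed.
Lemma subspaceZ a u : P u -> P (a *: u).
Proof. by move=> Pu; rewrite -[_ *: _]addr0; apply: PS.2 => //; apply: PS.1. Qed.
Lemma subspace_sum I (r : seq I) (Q : pred I) F :
  (forall i, Q i -> P (F i)) -> P (\sum_(i <- r | Q i) F i).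
Proof.
move=> PF; apply: (big_ind P) => //; first exact: PS.1.
exact: subspaceD.
Qed.
Lemma subspace_sum_seq (I : eqType) (r : seq I) F :
  (forall i, i \in r -> P (F i)) -> P (\sum_(i <- r) F i).
Proof.
move=> PF; rewrite big_seq_cond; apply: subspace_sum => i /andP[ir _].
exact: PF.
Qed.
End Subspace.

Lemma lin0 (V U : lmodType k) (f : V -> U) : linear f -> f 0 = 0.
Proof.
by move=> fL; have := fL (-1) 0 0; rewrite scaler0 addr0 scaleN1r addNr.
Qed.

Lemma subspace_eq (V U : lmodType k) (f g : V -> U) :
  linear f -> linear g -> subspace (fun x => f x = g x).
Proof.
move=> fL gL; split=> [|a u v fu fv]; first by rewrite !lin0.
by rewrite fL gL fu fv.
Qed.

Lemma subspace_preim (V U : lmodType k) (f : V -> U) (P : U -> Prop) :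
  linear f -> subspace P -> subspace (fun x => P (f x)).
Proof.
move=> fL PS; split=> [|a u v fu fv]; first by rewrite lin0 //; apply: PS.1.
by rewrite fL; apply: PS.2.
Qed.

Lemma subspace_span (V : lmodType k) (R : V -> Prop) :
  subspace (fun x => x \in span R).
Proof. by split=> [|a u v Ru Rv]; [exact: rpred0 | rewrite rpredD ?rpredZ]. Qed.

Lemma linear_comp (U V W : lmodType k) (f : V -> W) (g : U -> V) :
  linear f -> linear g -> linear (fun x => f (g x)).
Proof. by move=> fL gL a u v; rewrite gL fL. Qed.

Lemma linear_add (U V : lmodType k) (f g : U -> V) :
  linear f -> linear g -> linear (fun x => f x + g x).
Proof. by move=> fL gL a u v; rewrite fL gL scalerDr addrACA. Qed.

Lemma linear_sub (U V : lmodType k) (f g : U -> V) :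
  linear f -> linear g -> linear (fun x => f x - g x).
Proof. by move=> fL gL a u v; rewrite fL gL scalerBr; zmod. Qed.

Lemma linear_scale (U V : lmodType k) (f : U -> V) (c : k) :
  linear f -> linear (fun x => c *: f x).
Proof. by move=> fL a u v; rewrite fL scalerDr !scalerA mulrC. Qed.

Lemma span_ind (V : lmodType k) (R : V -> Prop) (P : V -> Prop) :
  subspace P -> (forall r, R r -> P r) -> forall v, v \in span R -> P v.
Proof.
move=> PS PR v /asboolP[n [c [r [Rr ->]]]].
by apply: subspace_sum => // i _; apply: subspaceZ => //; apply: PR.
Qed.

Lemma malg_ind (S : choiceType) (P : {malg k[S]} -> Prop) :
  subspace P -> (forall s, P << s >>) -> forall c, P c.
Proof.
move=> PS Pw c; rewrite [c]monalgE; apply: subspace_sum => // s _ /=.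
have -> : << c@_s *g s >> = c@_s *: << s >> :> {malg k[S]}.
  by apply/malgP => t; rewrite mcoeffZ !mcoeffU mulrnAr mulr1.
exact: subspaceZ.
Qed.

Lemma quo_ind (V : lmodType k) (R : V -> Prop) (P : quo R -> Prop) :
  (forall v, P (quo_pi v)) -> forall x, P x.
Proof. by move=> Pv x; rewrite -[x]quo_reprK. Qed.

Lemma quo_pi_eq0 (V : lmodType k) (R : V -> Prop) (v : V) :
  quo_pi v = 0 :> quo R <-> v \in span R.
Proof.
rewrite -(linear0 (quo_pi : V -> quo R)).
split=> [/eqP|Rv]; last apply/eqP; by rewrite quo_pi_eq subr0.
Qed.

Lemma tens_ind (V W : lmodType k) (P : tens V W -> Prop) :
  subspace P -> (forall v w, P (v ⊗ w)) -> forall t, P t.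
Proof.
move=> PS Pp; apply: quo_ind; apply: malg_ind; last by case.
exact: (subspace_preim (linearP quo_pi)).
Qed.

Lemma tens_map_bilin (V V' W W' : lmodType k) (f : V -> V') (g : W -> W') :
  linear f -> linear g -> bilin (fun v w => f v ⊗ g w).
Proof.
move=> fL gL; have [pl pr] := pure_bilin V' W'.
by split=> [w|v] a x y; rewrite ?fL ?gL ?pl ?pr.
Qed.

End LinearTools.

Section HomologyMap.
Variables (k : fieldType) (U V W U' V' W' : lmodType k).
Variables (f : {linear U -> V}) (g : {linear V -> W}).
Variables (f' : {linear U' -> V'}) (g' : {linear V' -> W'}).

Definition cls (z : V) (gz : g z = 0) : homology f g :=
  quo_pi (Cycle (introT eqP gz) : cycles g).

Lemma cls_represents z (gz : g z = 0) : represents z (cls gz).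
Proof. by exists (Cycle (introT eqP gz)). Qed.

Lemma represents_ind (P : homology f g -> Prop) :
  (forall z (gz : g z = 0), P (cls gz)) -> forall x, P x.
Proof.
move=> Pz; apply: quo_ind; case=> z gz; have := Pz z (elimT eqP gz).
by rewrite /cls (bool_irrelevance (introT eqP (elimT eqP gz)) gz).
Qed.

Lemma represents_linear a z x w y : represents z x -> represents w y ->
  represents (a *: z + w) (a *: x + y : homology f g).
Proof.
case=> z' <- -> [w' <- ->]; exists (a *: z' + w'); first by [].
by rewrite linearP.
Qed.

Lemma represents_subspace (X : lmodType k) (p : X -> V)
    (q : X -> homology f g) : linear p -> linear q ->
  subspace (fun a => represents (p a) (q a)).
Proof.
move=> pL qL; split=> [|a u v ru rv]; last first.
  by rewrite pL qL; apply: represents_linear.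
by rewrite (lin0 pL) (lin0 qL); exists 0; rewrite ?linear0.
Qed.

Lemma chain_of_linear : linear (@chain_of k V W g).
Proof. by []. Qed.

Lemma represents_boundary z (x y : homology f g) :
  represents z x -> represents z y -> x = y.
Proof.
by move=> [z' <- ->] [w' zw ->]; congr quo_pi; apply/val_inj.
Qed.

Lemma represents_homologous z w u (x y : homology f g) :
  represents z x -> represents w y -> z = w + f u -> x = y.
Proof.
move=> [z' <- ->] [w' <- ->] zwu; apply/eqP; rewrite quo_pi_eq.
by apply: mem_span; exists u; rewrite -[RHS]/(chain_of z' - chain_of w') zwu
  addrC addKr.
Qed.

Section Lift.
Variables (X : lmodType k) (h : {linear V -> X}).
Hypothesis hB : forall u, h (f u) = 0.

Fact homology_lift_rel (z : cycles g) : (exists u, f u = chain_of z) ->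
  mklin (linear_comp (linearP h) chain_of_linear) z = 0.
Proof. by case=> u /= <-. Qed.
Definition homology_lift : {linear homology f g -> X} :=
  quo_map homology_lift_rel.
Lemma homology_liftE z x : represents z x -> homology_lift x = h z.
Proof. by case=> z' <- ->; rewrite /homology_lift quo_mapE. Qed.
End Lift.

Variable phi : {linear V -> V'}.
Hypothesis phiZ : forall z, g z = 0 -> g' (phi z) = 0.
Hypothesis phiB : forall u, g (f u) = 0 -> exists u', f' u' = phi (f u).

Fact homology_map_cycle (z : cycles g) : phi (chain_of z) \in is_cycle g'.
Proof. by apply/eqP/phiZ/eqP; case: z. Qed.

Definition homology_map_fun (z : cycles g) : homology f' g' :=
  quo_pi (Cycle (homology_map_cycle z)).

Fact homology_map_linear : linear homology_map_fun.
Proof.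
move=> a x y; rewrite /homology_map_fun -linearP; congr quo_pi.
by apply/val_inj; rewrite /= linearP.
Qed.

Fact homology_map_rel (z : cycles g) : (exists u, f u = chain_of z) ->
  mklin homology_map_linear z = 0.
Proof.
case=> u fu; have gfu : g (f u) = 0 by apply/eqP; rewrite fu; case: z {fu}.
have [u' fu'] := phiB gfu.
by apply: quo_pi_rel; exists u'; rewrite fu' fu.
Qed.

Definition homology_map : {linear homology f g -> homology f' g'} :=
  quo_map homology_map_rel.

Lemma homology_map_represents z x :
  represents z x -> represents (phi z) (homology_map x).
Proof.
case=> z' <- ->; exists (Cycle (homology_map_cycle z')) => //.
by rewrite /homology_map quo_mapE.
Qed.

End HomologyMap.

(** * Multilinear maps *)

Section Multilinear.
Variables (k : fieldType) (V U : lmodType k) (n : nat).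

Lemma upd_id (t : n.-tuple V) i : upd t i (tnth t i) = t.
Proof.
by apply/eq_from_tnth => j; rewrite tnth_mktuple; case: eqP => // ->.
Qed.

Definition multilinear (f : n.-tuple V -> U) :=
  forall t i, linear (fun v => f (upd t i v)).

Lemma multilin_rel_lift (f : n.-tuple V -> U) : multilinear f ->
  forall r, multilin_rel r -> free_lift f r = 0.
Proof.
move=> fL r [a t i u v].
by rewrite linearB linearD linearZ /= !free_liftE fL subrr.
Qed.

(** The entries of t are expanded in the spanning set one at a time, from the
    first; m counts the entries that are still arbitrary. *)
Lemma multilinear_eq0 (B : V -> Prop) (f : n.-tuple V -> U) :
  (forall v, v \in span B) -> multilinear f ->
  (forall t, (forall i, B (tnth t i)) -> f t = 0) -> forall t, f t = 0.
Proof.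
move=> Bspan fL fB t.
suff key m : (m <= n)%N ->
    forall t, (forall i : 'I_n, (m <= i)%N -> B (tnth t i)) -> f t = 0.
  by apply: (key n) => // i; rewrite leqNgt ltn_ord.
elim: m => [_ {}t tB|m IHm mn {}t tB]; first by apply: fB => i; apply: tB.
pose i := Ordinal mn; rewrite -(upd_id t i).
have := Bspan (tnth t i); move: (tnth t i) => v.
apply: (span_ind (P := fun v => f (upd t i v) = 0)).
  split=> [|a u w fu fw]; first exact: lin0 (fL t i).
  by rewrite fL fu fw scaler0 addr0.
move=> {}v Bv; apply: (IHm (ltnW mn)) => j mj; rewrite tnth_mktuple.
case: eqVneq => // ji; apply: tB; rewrite ltn_neqAle mj andbT.
by apply: contraNneq ji => mj'; apply/eqP/val_inj.
Qed.

End Multilinear.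

Section FoldMultilinear.
Variables (k : fieldType) (V U : lmodType k) (op : V -> U -> U) (x0 : U).
Hypothesis op_bilin : bilin op.

Lemma foldr_linear (s1 s2 : seq V) :
  linear (fun v => foldr op x0 (s1 ++ v :: s2)).
Proof.
elim: s1 => [|u s1 IH] /=; first exact: op_bilin.1.
by move=> a v w; rewrite IH (op_bilin.2 u).
Qed.

Lemma upd_cat n (t : n.-tuple V) (i : 'I_n) v :
  upd t i v = take i t ++ v :: drop i.+1 t :> seq V.
Proof.
apply: (@eq_from_nth _ v) => [|j].
  by rewrite size_tuple size_cat /= size_takel ?size_drop size_tuple // ?subnKC
    // ?subnSK // ?addnS ?subnKC // ltnW.
rewrite size_tuple => jn; rewrite -(tnth_nth _ _ (Ordinal jn)) tnth_mktuple.
rewrite nth_cat size_takel ?size_tuple; last exact: ltnW.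
rewrite (_ : (Ordinal jn == i) = (j == i :> nat)) //.
case: (ltngtP j i) => [ji|ij|ji]; last by rewrite ji subnn.
- by rewrite nth_take // (tnth_nth v).
- case ji: (j - i)%N => [|m]; first by move: ij; rewrite -subn_gt0 ji.
  rewrite /= nth_drop (tnth_nth v) /=; congr nth.
  by rewrite addSn -addnS -ji subnKC // ltnW.
Qed.

(** Changing one entry of the tuple changes one letter of the word, at which the
    fold splits (upd_cat, foldr_linear). *)
Lemma foldr_multilinear n (U' : lmodType k) (h : U -> U') : linear h ->
  multilinear (fun t : n.-tuple V => h (foldr op x0 t)).
Proof. by move=> hL t i a v w; rewrite !upd_cat foldr_linear hL. Qed.

End FoldMultilinear.

(** Proves linearity of combinations and composites of linear maps. *)
Ltac lin :=
  lazymatch goal with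
  | |- linear (fun x => @Algebra.add _ (@?f x) (Algebra.opp (@?g x))) =>
      apply: (@linear_sub _ _ _ f g); lin
  | |- linear (fun x => @Algebra.add _ (@?f x) (@?g x)) =>
      apply: (@linear_add _ _ _ f g); lin
  | |- linear (fun x => GRing.scale ?c (@?f x)) =>
      apply: (@linear_scale _ _ _ f c); lin
  | |- linear (fun x => x) => by move=> ? ? ?
  | |- linear (fun x => 0) => by move=> ? ? ?; rewrite scaler0 addr0
  | |- linear (fun x => ?h (@?f x)) =>
      apply: (@linear_comp _ _ _ _ h f); [exact: linearP | lin]
  | |- _ => exact: linearP
  end.

(** * Homogeneous chains of a group *)
(** The words of length n.+1 span the chains of degree n; the empty word is the
    augmentation degree. Operators on chains are defined by recursion on words,
    through the cone mcons, which prepends a vertex. *)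
Definition words (k : fieldType) (S : choiceType) : lmodType k :=
  {malg k[seq S]}.

Definition word (k : fieldType) (S : choiceType) (s : seq S) : words k S :=
  << s >>.

Definition word_lift (k : fieldType) (S : choiceType) (U : lmodType k)
    (f : seq S -> U) : {linear words k S -> U} := free_lift f.

Lemma word_liftE (k : fieldType) (S : choiceType) (U : lmodType k)
    (f : seq S -> U) s : word_lift f (word k s) = f s.
Proof. exact: free_liftE. Qed.

Lemma word_ind (k : fieldType) (S : choiceType) (P : words k S -> Prop) :
  subspace P -> (forall s, P (word k s)) -> forall a, P a.
Proof. exact: malg_ind. Qed.

HB.lock Definition mcons (k : fieldType) (S : choiceType) (v : S)
    (a : words k S) : words k S :=
  word_lift (fun s => word k (v :: s)) a.

Fact mcons_linear (k : fieldType) (S : choiceType) (v : S) :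
  linear (@mcons k S v).
Proof. by rewrite mcons.unlock; exact: linearP. Qed.
HB.instance Definition _ (k : fieldType) (S : choiceType) (v : S) :=
  GRing.isLinear.Build k (words k S) (words k S) *:%R (@mcons k S v)
    (mcons_linear v).

Lemma mconsE (k : fieldType) (S : choiceType) (v : S) s :
  mcons v (word k s) = word k (v :: s).
Proof. by rewrite mcons.unlock; apply: word_liftE. Qed.

Lemma mcons_ind (k : fieldType) (S : choiceType) (P : words k S -> Prop) :
  subspace P -> P (word k [::]) ->
  (forall v a, P a -> P (mcons v a)) -> forall a, P a.
Proof.
move=> PS P0 Pc; apply: word_ind => //; elim=> // v s IH.
by rewrite -mconsE; apply: Pc.
Qed.

(** The alternating sum of the deletions of a vertex: the boundary of a cone
    with apex v is its base minus the cone over the boundary of the base. *)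
Fixpoint bnd_word (k : fieldType) (G : zmodType) (s : seq G) : words k G :=
  if s is v :: s' then word k s' - @mcons k G v (bnd_word k s') else 0.
HB.lock Definition bnd (k : fieldType) (G : zmodType) (a : words k G) :
  words k G := word_lift (@bnd_word k G) a.
Fact bnd_linear (k : fieldType) (G : zmodType) : linear (@bnd k G).
Proof. by rewrite bnd.unlock; exact: linearP. Qed.
HB.instance Definition _ (k : fieldType) (G : zmodType) :=
  GRing.isLinear.Build k (words k G) (words k G) *:%R (@bnd k G)
    (@bnd_linear k G).

HB.lock Definition tr (k : fieldType) (G : zmodType) (g : G) (a : words k G) :
  words k G := word_lift (fun s : seq G => word k [seq v + g | v <- s]) a.
Fact tr_linear (k : fieldType) (G : zmodType) (g : G) : linear (@tr k G g).
Proof. by rewrite tr.unlock; exact: linearP. Qed.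
HB.instance Definition _ (k : fieldType) (G : zmodType) (g : G) :=
  GRing.isLinear.Build k (words k G) (words k G) *:%R (@tr k G g)
    (@tr_linear k G g).

(** The triangulation of the product of a simplex with an interval: the sum over
    i of (-1)^i (v_0, .., v_i, v_i + g, .., v_n + g). *)
Fixpoint prism_word (k : fieldType) (G : zmodType) (g : G) (s : seq G) :
    words k G :=
  if s is v :: s' then
    @mcons k G v (tr g (word k s)) - @mcons k G v (prism_word k g s')
  else 0.
HB.lock Definition prism (k : fieldType) (G : zmodType) (g : G)
  (a : words k G) : words k G := word_lift (prism_word k g) a.
Fact prism_linear (k : fieldType) (G : zmodType) (g : G) :
  linear (@prism k G g).
Proof. by rewrite prism.unlock; exact: linearP. Qed.
HB.instance Definition _ (k : fieldType) (G : zmodType) (g : G) :=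
  GRing.isLinear.Build k (words k G) (words k G) *:%R (@prism k G g)
    (@prism_linear k G g).

(** The triangulation of the product of a simplex with the triangle 0, g, g + h:
    the sum over i <= j of (-1)^(j - i)
    (v_0, .., v_i, v_i + g, .., v_j + g, v_j + g + h, .., v_n + g + h). *)
Fixpoint prism2_word (k : fieldType) (G : zmodType) (g h : G) (s : seq G) :
    words k G :=
  if s is v :: s' then
    @mcons k G v (prism h (tr g (word k s))) +
    @mcons k G v (prism2_word k g h s')
  else 0.
HB.lock Definition prism2 (k : fieldType) (G : zmodType) (g h : G)
  (a : words k G) : words k G := word_lift (prism2_word k g h) a.
Fact prism2_linear (k : fieldType) (G : zmodType) (g h : G) :
  linear (@prism2 k G g h).
Proof. by rewrite prism2.unlock; exact: linearP. Qed.
HB.instance Definition _ (k : fieldType) (G : zmodType) (g h : G) :=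
  GRing.isLinear.Build k (words k G) (words k G) *:%R (@prism2 k G g h)
    (@prism2_linear k G g h).

Section HomogeneousChains.
Variables (k : fieldType) (G : zmodType).
Local Notation M := (words k G).
Local Notation word := (@word k G).
Local Notation "v · a" := (@mcons k G v a) (at level 30, right associativity).
Implicit Types (a b c : M) (v g h : G).

Lemma mcons0 v : v · (0 : M) = 0. Proof. exact: linear0. Qed.
Lemma mconsB v a b : v · (a - b) = v · a - v · b.
Proof. exact: linearB. Qed.
Lemma mconsD v a b : v · (a + b) = v · a + v · b.
Proof. exact: linearD. Qed.
Lemma trB g a b : tr g (a - b) = tr g a - tr g b. Proof. exact: linearB. Qed.
Lemma bndB a b : bnd (a - b) = bnd a - bnd b. Proof. exact: linearB. Qed.
Lemma bndD a b : bnd (a + b) = bnd a + bnd b. Proof. exact: linearD. Qed.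
Lemma prismB g a b : prism g (a - b) = prism g a - prism g b.
Proof. exact: linearB. Qed.
Lemma prism2B g h a b : prism2 g h (a - b) = prism2 g h a - prism2 g h b.
Proof. exact: linearB. Qed.

Lemma bndE s : bnd (word s) = bnd_word k s. Proof. by rewrite bnd.unlock;
  apply: word_liftE. Qed.
Lemma trE g s : tr g (word s) = word [seq v + g | v <- s].
Proof. by rewrite tr.unlock; apply: word_liftE. Qed.
Lemma prismE g s : prism g (word s) = prism_word k g s.
Proof. by rewrite prism.unlock; apply: word_liftE. Qed.
Lemma prism2E g h s : prism2 g h (word s) = prism2_word k g h s.
Proof. by rewrite prism2.unlock; apply: word_liftE. Qed.

Lemma bnd_nil : bnd (word [::]) = 0. Proof. exact: bndE. Qed.
Lemma tr_nil g : tr g (word [::]) = word [::]. Proof. exact: trE. Qed.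
Lemma prism_nil g : prism g (word [::]) = 0. Proof. exact: prismE. Qed.
Lemma prism2_nil g h : prism2 g h (word [::]) = 0.
Proof. exact: prism2E. Qed.

Lemma bnd_cons v a : bnd (v · a) = a - v · bnd a.
Proof.
move: a; apply: word_ind => [|s]; last by rewrite mconsE !bndE.
by apply: subspace_eq; lin.
Qed.

Lemma tr_cons g v a : tr g (v · a) = (v + g) · tr g a.
Proof.
move: a; apply: word_ind => [|s]; last by rewrite mconsE !trE mconsE.
by apply: subspace_eq; lin.
Qed.

Lemma prism_cons g v a : prism g (v · a) = v · tr g (v · a) - v · prism g a.
Proof.
move: a; apply: word_ind => [|s]; last by rewrite mconsE !prismE.
by apply: subspace_eq; lin.
Qed.

Lemma prism2_cons g h v a :
  prism2 g h (v · a) = v · prism h (tr g (v · a)) + v · prism2 g h a.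
Proof.
move: a; apply: word_ind => [|s]; last by rewrite mconsE !prism2E.
by apply: subspace_eq; lin.
Qed.

(** Operators are compared by induction on words; the empty word is the only
    base case since every other word is a cone. *)
Lemma chain_eq (f1 f2 : M -> M) : linear f1 -> linear f2 ->
  f1 (word [::]) = f2 (word [::]) ->
  (forall v a, f1 a = f2 a -> f1 (v · a) = f2 (v · a)) -> f1 =1 f2.
Proof.
move=> f1L f2L f0 fc; apply: mcons_ind => //; exact: subspace_eq.
Qed.

Lemma bndK a : bnd (bnd a) = 0.
Proof.
move: a; apply: chain_eq => [||| v a IH]; [lin | lin | |].
- by rewrite bnd_nil (linear0 (@bnd k G)).
by rewrite !bnd_cons bndB bnd_cons IH mcons0 subr0 subrr.
Qed.

Lemma bnd_tr g a : bnd (tr g a) = tr g (bnd a).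
Proof.
move: a; apply: chain_eq => [||| v a IH]; [lin | lin | |].
- by rewrite tr_nil bnd_nil (linear0 (tr g)).
by rewrite tr_cons !bnd_cons trB tr_cons IH.
Qed.

Lemma trD g h a : tr g (tr h a) = tr (g + h) a.
Proof.
move: a; apply: chain_eq => [||| v a IH]; [lin | lin | |].
- by rewrite !tr_nil.
by rewrite !tr_cons IH [g + h]addrC addrA.
Qed.

Lemma tr0 a : tr 0 a = a.
Proof.
move: a; apply: chain_eq => [||| v a IH]; [lin | lin | |].
- exact: tr_nil.
by rewrite !tr_cons IH addr0.
Qed.

Lemma prism_tr g h a : prism g (tr h a) = tr h (prism g a).
Proof.
move: a; apply: chain_eq => [||| v a IH]; [lin | lin | |].
- by rewrite tr_nil prism_nil (linear0 (tr h)).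
rewrite tr_cons !prism_cons trB !tr_cons IH !trD.
by rewrite [g + h]addrC addrAC.
Qed.

(** The prism is a chain homotopy from the identity to the translation by g. *)
Lemma bnd_prism g a : bnd (prism g a) = tr g a - a - prism g (bnd a).
Proof.
move: a; apply: chain_eq => [||| v a IH]; [lin | lin | |].
- by rewrite prism_nil bnd_nil tr_nil (linear0 (@bnd k G)) (linear0 (prism
  g)); zmod.
rewrite prism_cons bndB !bnd_cons IH tr_cons bnd_cons bnd_tr.
rewrite prismB prism_cons !tr_cons !mconsB.
zmod.
Qed.

(** For i <= j the simplex (v_0, .., v_i, v_i + g, .., v_j + g, v_j + 2 g, ..)
    arises twice, according to which of the two steps is made first, and with
    opposite signs. *)
Lemma prismK g a : prism g (prism g a) = 0.
Proof.
move: a; apply: chain_eq => [||| v a IH]; [lin | lin | |].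
- by rewrite prism_nil (linear0 (prism g)).
rewrite !(prism_cons, prismB, prism_tr) IH.
rewrite !(tr_cons, trB, mconsB, mcons0).
by zmod.
Qed.

(** The three prisms over the sides of the triangle 0, g, g + h bound, up to the
    prisms over the boundary of a. *)
Lemma bnd_prism2 g h a : bnd (prism2 g h a) = prism2 g h (bnd a)
  + (prism h (tr g a) - prism (h + g) a + prism g a).
Proof.
move: a; apply: chain_eq => [||| v a IH]; [lin | lin | |].
- by rewrite tr_nil !prism_nil prism2_nil bnd_nil (linear0 (@bnd k G))
  (linear0 (prism2 g h)); zmod.
rewrite prism2_cons bndD !bnd_cons IH bnd_prism bnd_tr prism2B prism2_cons.
rewrite !prism_cons !tr_cons !bnd_cons !prism_cons !trB !tr_cons !trD.
rewrite !(mconsB, mconsD, prismB, prism_cons, tr_cons, trD).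
rewrite (_ : v + (h + g) = v + g + h); last by rewrite [h + g]addrC addrA.
by zmod.
Qed.

Lemma span_map (U V : lmodType k) (f : U -> V) (R : U -> Prop) (S : V -> Prop) :
  linear f -> (forall r, R r -> f r \in span S) ->
  forall x, x \in span R -> f x \in span S.
Proof.
move=> fL fR; apply: span_ind => //.
exact: (subspace_preim fL (subspace_span _)).
Qed.

Lemma span_sub (V : lmodType k) (R S : V -> Prop) :
  (forall r, R r -> r \in span S) -> forall x, x \in span R -> x \in span S.
Proof. by move=> RS; apply: span_ind => //; apply: subspace_span. Qed.

(** * Chains modulo translations *)
Inductive degenerate_chain : M -> Prop :=
| DegenerateHead v a : degenerate_chain (v · v · a)
| DegenerateCons v a of degenerate_chain a : degenerate_chain (v · a).

(** The relations that present the normalized chains modulo translations by H.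
    The empty word is among them, so that vertices become cycles. *)
Inductive coinv_rel (H : G -> Prop) : M -> Prop :=
| CoinvNil : coinv_rel H (word [::])
| CoinvDegenerate a of degenerate_chain a : coinv_rel H a
| CoinvTr h a of H h : coinv_rel H (tr h a - a).

Local Notation D := (span degenerate_chain).
Local Notation N H := (span (coinv_rel H)).

Lemma mcons_D v a : a \in D -> v · a \in D.
Proof.
by apply: span_map => [|r rD]; [exact: linearP | apply/mem_span/DegenerateCons].
Qed.

Lemma head_D v a : v · v · a \in D.
Proof. exact/mem_span/DegenerateHead. Qed.

Lemma tr_D g a : a \in D -> tr g a \in D.
Proof.
apply: span_map => [|r]; first exact: linearP.
elim=> [v {}a|v {}a _ IH]; rewrite !tr_cons; first exact: head_D.
exact: mcons_D.
Qed.

Lemma bnd_D a : a \in D -> bnd a \in D.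
Proof.
apply: span_map => [|r]; first exact: linearP.
elim=> [v {}a|v {}a aD IH].
  by rewrite !bnd_cons mconsB (_ : _ - _ = v · v · bnd a) ?head_D //; zmod.
by rewrite bnd_cons; apply: rpredB; [exact: mem_span | exact: mcons_D].
Qed.

Lemma prism_D g a : a \in D -> prism g a \in D.
Proof.
apply: span_map => [|r]; first exact: linearP.
elim=> [v {}a|v {}a aD IH].
  rewrite !prism_cons !tr_cons mconsB.
  by apply: rpredB; [apply/mcons_D/head_D | rewrite rpredB ?head_D].
rewrite prism_cons tr_cons; apply: rpredB; apply: mcons_D => //.
by apply: mcons_D; apply: tr_D; apply: mem_span.
Qed.

Lemma prism2_D g h a : a \in D -> prism2 g h a \in D.
Proof.
apply: span_map => [|r]; first exact: linearP.
elim=> [v {}a|v {}a aD IH]; rewrite !prism2_cons.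
  rewrite mconsD; apply: rpredD; last by rewrite rpredD ?head_D.
  by apply/mcons_D/prism_D/tr_D/head_D.
apply: rpredD; apply: mcons_D => //.
by apply: prism_D; apply: tr_D; apply/mem_span/DegenerateCons.
Qed.

Lemma prism2_tr g h l a : prism2 g h (tr l a) = tr l (prism2 g h a).
Proof.
move: a; apply: chain_eq => [||| v a IH]; [lin | lin | |].
- by rewrite tr_nil prism2_nil (linear0 (@tr k G l)).
rewrite tr_cons !prism2_cons IH -(tr_cons l v a) trD [g + l]addrC -trD.
by rewrite prism_tr (linearD (@tr k G l)) /= !(tr_cons l).
Qed.

Section Coinvariants.
Variable H : G -> Prop.

Lemma degenerate_N a : a \in D -> a \in N H.
Proof. by apply: span_sub => r rD; apply/mem_span/CoinvDegenerate. Qed.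

(** An operator that commutes with translations passes to coinvariants. *)
Lemma coinv_map (f : {linear M -> M}) : f (word [::]) \in N H ->
  (forall a, a \in D -> f a \in D) ->
  (forall h a, f (tr h a) = tr h (f a)) -> forall a, a \in N H -> f a \in N H.
Proof.
move=> f0 fD ftr; apply: span_map => [|r]; first exact: linearP.
case=> [//|a aD|h a Hh]; first by apply/degenerate_N/fD/mem_span.
by rewrite linearB ftr; apply/mem_span/CoinvTr.
Qed.

Lemma bnd_N a : a \in N H -> bnd a \in N H.
Proof.
apply: coinv_map => [|b|h b]; rewrite /= ?bnd_nil ?rpred0 ?bnd_tr //.
exact: bnd_D.
Qed.

Lemma tr_N g a : a \in N H -> tr g a \in N H.
Proof.
apply: coinv_map => [|b|h b] /=; rewrite ?tr_nil; last by rewrite !trD addrC.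
  exact/mem_span/CoinvNil.
exact: tr_D.
Qed.

Lemma prism_N g a : a \in N H -> prism g a \in N H.
Proof.
apply: coinv_map => [|b|h b]; rewrite /= ?prism_nil ?rpred0 ?prism_tr //.
exact: prism_D.
Qed.

Lemma prism2_N g h a : a \in N H -> prism2 g h a \in N H.
Proof.
apply: coinv_map => [|b|l b]; rewrite /= ?prism2_nil ?rpred0 ?prism2_tr //.
exact: prism2_D.
Qed.

Lemma nil_N : word [::] \in N H. Proof. exact/mem_span/CoinvNil. Qed.

Lemma tr_sub_N h a : H h -> tr h a - a \in N H.
Proof. by move=> Hh; apply/mem_span/CoinvTr. Qed.

End Coinvariants.

Lemma coinv_mono (H H' : G -> Prop) a : (forall h, H h -> H' h) ->
  a \in N H -> a \in N H'.
Proof.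
move=> HH; apply: span_sub => r [|b bD|h b Hh]; apply: mem_span.
- exact: CoinvNil.
- exact: CoinvDegenerate.
- by apply: CoinvTr; apply: HH.
Qed.

(** Membership in the subgroup generated by s, by recursion on s, since the
    generators are added one at a time. *)
Fixpoint generated (s : seq G) (g : G) : Prop :=
  if s is t :: s' then exists y : int, generated s' (g - t *~ y) else g = 0.

Lemma generatedB s g h :
  generated s g -> generated s h -> generated s (g - h).
Proof.
elim: s g h => [|t s IH] g h /=; first by move=> -> ->; rewrite subr0.
case=> y gy [z hz]; exists (y - z); have := IH _ _ gy hz.
by congr generated; rewrite mulrzBr; zmod.
Qed.

Lemma generated0 s : generated s 0.
Proof. by elim: s => //= t s IH; exists 0; rewrite mulr0z subr0. Qed.

Lemma generatedN s g : generated s g -> generated s (- g).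
Proof. by rewrite -sub0r; apply: generatedB; apply: generated0. Qed.

Lemma generatedD s g h :
  generated s g -> generated s h -> generated s (g + h).
Proof. by move=> sg sh; rewrite -[h]opprK; apply/generatedB/generatedN. Qed.

Lemma generated_cons t s g : generated s g -> generated (t :: s) g.
Proof. by move=> sg; exists 0; rewrite mulr0z subr0. Qed.

Lemma generated_head t s y : generated (t :: s) (t *~ y).
Proof. by exists y; rewrite subrr; apply: generated0. Qed.

Lemma generated_mem s g : g \in s -> generated s g.
Proof.
elim: s => // t s IH; rewrite inE => /orP[/eqP ->|gs].
  by rewrite -[t]mulr1z; apply: generated_head.
exact/generated_cons/IH.
Qed.

(** A linear combination of relations involves finitely many translations. *)
Lemma coinv_finite a : a \in N (fun _ => True) -> exists s, a \in N (generated s).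
Proof.
have catl s1 s2 g : generated s1 g -> generated (s1 ++ s2) g.
  elim: s1 g => [|t s1 IH] g /=; first by move=> ->; apply: generated0.
  by case=> y gy; exists y; apply: IH.
have catr s1 s2 g : generated s2 g -> generated (s1 ++ s2) g.
  by elim: s1 => // t s1 IH /IH; apply: generated_cons.
apply: (span_ind (P := fun a => exists s, a \in N (generated s))).
  split=> [|c u v [s us] [s' vs]]; first by exists [::]; apply: rpred0.
  exists (s ++ s'); rewrite rpredD ?rpredZ //.
    by apply: coinv_mono us => h; apply: catl.
  by apply: coinv_mono vs => h; apply: catr.
move=> r [|b bD|h b _].
- by exists [::]; apply: nil_N.
- by exists [::]; apply/degenerate_N/mem_span.
- by exists [:: h]; apply/tr_sub_N/generated_mem; rewrite inE.
Qed.

Section AddGenerator.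
Variables (s : seq G) (t : G).
Local Notation H := (generated s).
Local Notation H' := (generated (t :: s)).

(** The operator T^m - 1 is a multiple of T - 1, where T is the translation
    by t. *)
Lemma tr_nat_sub a m : exists b, tr (t *+ m) a - a = tr t b - b.
Proof.
elim: m => [|m [b mb]].
  by exists 0; rewrite mulr0n tr0 (linear0 (@tr k G t)) !subrr.
exists (b + tr (t *+ m) a); rewrite mulrS -trD (linearD (@tr k G t)).
set x := tr (t *+ m) a in mb *.
by apply: (@etrans _ _ ((tr t b - b) + (tr t x - x))); [rewrite -mb |]; zmod.
Qed.

Lemma tr_int_sub a y : exists b, tr (t *~ y) a - a = tr t b - b.
Proof.
case: y => m; first exact: tr_nat_sub.
have [b mb] := tr_nat_sub (tr (t *~ Negz m) a) m.+1.
exists (- b); rewrite (linearN (@tr k G t)); move: mb.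
rewrite trD NegzE mulrNz -pmulrn subrr tr0 => mb.
by rewrite -[LHS]opprB mb; zmod.
Qed.

(** Modulo the translations by the subgroup generated by s, only the
    translation by t remains, and its powers are absorbed by tr_int_sub. *)
Lemma coinv_cons a : a \in N H' ->
  exists b, a - (tr t b - b) \in N H.
Proof.
apply: (span_ind (P := fun a => exists b, a - (tr t b - b) \in N H)).
  split=> [|c u v [b ub] [b' vb]].
    by exists 0; rewrite (linear0 (@tr k G t)) !subrr rpred0.
  exists (c *: b + b'); rewrite (linearP (@tr k G t)).
  rewrite (_ : _ - _ = c *: (u - (tr t b - b)) + (v - (tr t b' - b'))).
    by rewrite rpredD ?rpredZ.
  by rewrite !scalerBr; zmod.
move=> r [|b bD|h b [y hy]].
- by exists 0; rewrite (linear0 (@tr k G t)) !subrr subr0 nil_N.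
- by exists 0; rewrite (linear0 (@tr k G t)) !subrr subr0;
  apply/degenerate_N/mem_span.
have [c bc] := tr_int_sub b y; exists c; rewrite -bc.
rewrite -[h](subrK (t *~ y)) -trD.
set x := tr (t *~ y) b; rewrite (_ : _ - _ = tr (h - t *~ y) x - x); last by zmod.
exact: tr_sub_N.
Qed.

End AddGenerator.

(** The projection onto the words with first vertex in Q. It respects the
    translations by H when Q is a union of cosets of H (head_proj_N). *)
Definition head_proj (Q : G -> bool) : {linear M -> M} :=
  word_lift (fun s => if s is v :: _ then if Q v then word s else 0 else 0).

Lemma head_projE Q s : head_proj Q (word s) =
  if s is v :: _ then if Q v then word s else 0 else 0.
Proof. exact: word_liftE. Qed.

Lemma head_proj_cons Q v a : head_proj Q (v · a) = if Q v then v · a else 0.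
Proof.
move: a; apply: word_ind => [|s]; last by rewrite mconsE head_projE.
apply: subspace_eq; first by lin.
by case: (Q v); lin.
Qed.

Lemma head_proj_N (H : G -> Prop) Q a :
  (forall h v, H h -> Q (v + h) = Q v) ->
  a \in N H -> head_proj Q a \in N H.
Proof.
move=> QH; apply: span_map => [|r]; first exact: linearP.
case=> [|b bD|h b Hh].
- by rewrite head_projE rpred0.
- have [->|->] : head_proj Q b = b \/ head_proj Q b = 0; last exact: rpred0.
    by case: bD => [v c|v c _]; rewrite head_proj_cons; case: (Q v); auto.
  exact/mem_span/CoinvDegenerate.
rewrite (_ : head_proj Q _ = tr h (head_proj Q b) - head_proj Q b).
  exact: tr_sub_N.
rewrite linearB; congr (_ - _); move: b; apply: chain_eq; [lin|lin| |].
  by rewrite tr_nil head_projE (linear0 (@tr k G h)).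
move=> v b _; rewrite tr_cons !head_proj_cons QH //.
by case: (Q v); rewrite ?tr_cons // (linear0 (@tr k G h)).
Qed.

Lemma eventually_avoid (T : eqType) (P : T -> nat -> Prop) (s : seq T) :
  (forall x i j, P x i -> P x j -> i = j) ->
  exists B, forall x, x \in s -> ~ P x B.
Proof.
move=> Puniq; suff [B BP] : exists B, forall m x,
  (B <= m)%N -> x \in s -> ~ P x m.
  by exists B => x; apply: BP.
elim: s => [|x s [B BP]]; first by exists 0%N.
have [[i Pi]|nP] := pselect (exists i, P x i); last first.
  exists B => m y Bm; rewrite inE => /orP[/eqP -> Px|]; last exact: BP.
  by apply: nP; exists m.
exists (maxn B i.+1) => m y; rewrite geq_max => /andP[Bm im].
rewrite inE => /orP[/eqP -> Px|]; last exact: BP.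
by move: im; rewrite (Puniq _ _ _ Pi Px) ltnn.
Qed.

(** A translation of infinite order modulo H has no nonzero fixed vector among
    the H-coinvariants: a large power of it moves a chain away from the cosets
    of H in which the chain is supported. *)
Lemma tr_sub_inj s t b : (forall m, ~ generated s (t *+ m.+1)) ->
  tr t b - b \in N (generated s) -> b \in N (generated s).
Proof.
set H := generated s => tH tb.
have pow m : tr (t *+ m) b - b \in N H.
  elim: m => [|m IH]; first by rewrite mulr0n tr0 subrr rpred0.
  rewrite mulrSr -trD; set c := tr t b.
  rewrite (_ : _ - b = tr (t *+ m) (c - b) + (tr (t *+ m) b - b)).
    by rewrite rpredD //; apply: tr_N.
  by rewrite trB; zmod.
(* A pair of words of b determines at most one power of t that moves the first
   vertex of one into the coset of the first vertex of the other. *)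
pose supp : seq (seq G) := enum_fset (msupp b).
pose P (x : seq G * seq G) m := H (head 0 x.1 + t *+ m - head 0 x.2).
have Puniq x i j : P x i -> P x j -> i = j.
  wlog ij : i j / (i <= j)%N => [th Pi Pj|Pi Pj].
    by case/orP: (leq_total i j) => ij; [|symmetry]; apply: th.
  case: ltngtP ij => // ij _; case: (tH (j - i).-1).
  rewrite prednK ?subn_gt0 // mulrnBr ?(ltnW ij) //.
  by have := generatedB Pj Pi; congr (H _); zmod.
(* The translation by B t moves every word of b outside the cosets of Q. *)
have [B BP] := eventually_avoid [seq (w, w') | w <- supp, w' <- supp] Puniq.
pose Q v := `[< exists2 w, w \in supp & H (v - head 0 w) >].
have QH h v : H h -> Q (v + h) = Q v.
  move=> Hh; apply/asbool_equiv_eq; split=> -[w ws vw]; exists w => //.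
    by have := generatedB vw Hh; congr (H _); zmod.
  by have := generatedD vw Hh; congr (H _); zmod.
have bE : b = \sum_(w <- supp) b@_w *: word w.
  rewrite {1}[b]monalgE; apply: eq_bigr => w _.
  by apply/malgP => u; rewrite mcoeffZ !mcoeffU mulrnAr mulr1.
have pb : head_proj Q b - b \in N H.
  rewrite {1 2}bE linear_sum -sumrB; apply: (subspace_sum_seq (subspace_span _)).
  move=> w ws; rewrite linearZ -scalerBr; apply: rpredZ.
  rewrite head_projE; case: w ws => [|v w] ws.
    by rewrite sub0r rpredN nil_N.
  suff -> : Q v by rewrite subrr rpred0.
  by apply/asboolP; exists (v :: w) => //=; rewrite subrr; apply: generated0.
have ptb : head_proj Q (tr (t *+ B) b) = 0.
  rewrite bE !linear_sum /= big_seq big1 // => w ws.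
  rewrite !linearZ /= trE head_projE; case: w ws => [|v w] ws /=.
    by rewrite scaler0.
  case Qv: (Q _); last by rewrite scaler0.
  case/asboolP: Qv => w' w's vw'.
  case: (BP (v :: w, w')); last exact: vw'.
  by apply/allpairsP; exists (v :: w, w').
have := head_proj_N QH (pow B); rewrite linearB ptb sub0r => pbN.
rewrite (_ : b = - (- head_proj Q b) - (head_proj Q b - b)); last by zmod.
by rewrite rpredB // rpredN.
Qed.

(** * Iterated prisms span the homology *)
Inductive iterated_prism (H : G -> Prop) : M -> Prop :=
| IterNil : iterated_prism H (word [:: 0])
| IterPrism t a of H t & iterated_prism H a : iterated_prism H (prism t a).

Lemma bnd_iterated (H : G -> Prop) a :
  iterated_prism H a -> bnd a \in N H.
Proof.
elim=> [|t {}a Ht _ IH].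
  by rewrite -mconsE bnd_cons bnd_nil mcons0 subr0 nil_N.
by rewrite bnd_prism rpredB ?tr_sub_N //; apply: prism_N.
Qed.

(** Modulo translations by H and boundaries, a is a combination of iterated
    prisms. *)
Definition prism_spanned (H : G -> Prop) a := exists c u,
  c \in span (iterated_prism H) /\ a - c - bnd u \in N H.

(** The cone with apex 0 contracts the chains, apart from degree 0 where it
    leaves multiples of the vertex 0. *)
Lemma prism_spanned_trivial a : bnd a \in N (fun g => g = 0) ->
  prism_spanned (fun g => g = 0) a.
Proof.
move=> aN; suff [c cI ac] : exists2 c,
    c \in span (iterated_prism (fun g => g = 0)) & 0 · bnd a - c \in N (fun g
      => g = 0).
  exists c, (0 · a); split=> //; rewrite bnd_cons.
  by rewrite (_ : _ - _ = 0 · bnd a - c) //; zmod.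
move: aN; apply: (span_ind (P := fun x => exists2 c,
    c \in span (iterated_prism (fun g => g = 0)) & 0 · x - c \in N (fun g => g
      = 0))).
  split=> [|e u v [c cI uc] [c' cI' vc]].
    by exists 0; rewrite ?rpred0 // mcons0 subrr rpred0.
  exists (e *: c + c'); first by rewrite rpredD ?rpredZ.
  rewrite (linearP (@mcons k G 0)).
  rewrite (_ : _ - _ = e *: (0 · u - c) + (0 · v - c')).
    by rewrite rpredD ?rpredZ.
  by rewrite scalerBr; zmod.
move=> r [|b bD|h b ->].
- exists (word [:: 0]); first exact/mem_span/IterNil.
  by rewrite mconsE subrr rpred0.
- exists 0; rewrite ?rpred0 // subr0; apply/degenerate_N/mcons_D; exact: mem_span.
- by exists 0; rewrite ?rpred0 // tr0 subrr mcons0 subrr rpred0.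
Qed.

Hypothesis k_char0 : forall m, (m.+1)%:R != 0 :> k.

(** Induction on the generators: the boundary of a is (T - 1) b modulo the
    translations by the smaller subgroup, where T is the translation by t. *)
Lemma prism_spanned_generated s a : bnd a \in N (generated s) ->
  prism_spanned (generated s) a.
Proof.
elim: s a => [|t s IH] a; first exact: prism_spanned_trivial.
move=> /coinv_cons[b abN].
have sub c : c \in N (generated s) -> c \in N (generated (t :: s)).
  by apply: coinv_mono; apply: generated_cons.
have subI c : c \in span (iterated_prism (generated s)) ->
    c \in span (iterated_prism (generated (t :: s))).
  apply: span_sub => r rI; apply: mem_span; elim: rI => [|h d Hh _].
    exact: IterNil.
  by apply: IterPrism; apply: generated_cons.
have [[m mt]|inf] := pselect (exists m, generated s (t *+ m.+1)).
  (* If m.+1 t lies in the smaller subgroup, the sum S of the translates kills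
     (T - 1) b, so S a is a cycle there; it is m.+1 times a modulo the larger
     subgroup, whence the coefficient e. *)
  pose S c := \sum_(j < m.+1) tr (t *+ j) c.
  have SL : linear S.
    move=> e x y; rewrite /S scaler_sumr -big_split; apply: eq_bigr => j _.
    exact: linearP.
  have StB c : S (tr t c) - S c = tr (t *+ m.+1) c - c.
    rewrite /S big_ord_recr [X in _ - X]big_ord_recl /= mulr0n tr0.
    rewrite trD -mulrSr (eq_bigr (fun j : 'I_m => tr (t *+ j.+1) c)).
      by zmod.
    by move=> j _; rewrite trD -mulrSr.
  have SN c : c \in N (generated s) -> S c \in N (generated s).
    by move=> cN; rewrite rpred_sum // => j _; apply: tr_N.
  have bS : bnd (S a) = S (bnd a).
    by rewrite /S linear_sum; apply: eq_bigr => j _; apply: bnd_tr.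
  have : bnd (S a) \in N (generated s).
    have SD x y : S (x + y) = S x + S y := linearD (mklin SL) x y.
    have SB x y : S (x - y) = S x - S y := linearB (mklin SL) x y.
    rewrite bS -[bnd a](subrK (tr t b - b)) SD.
    by apply: rpredD; [exact: SN | rewrite SB StB; exact: tr_sub_N].
  case/IH => c [u [cI Sa]].
  pose e : k := (m.+1)%:R^-1.
  exists (e *: c), (e *: u); split; first exact/subI/rpredZ.
  have aS : a - e *: S a \in N (generated (t :: s)).
    rewrite (_ : _ - _ = - (e *: \sum_(j < m.+1) (tr (t *+ j) a - a))).
      rewrite rpredN rpredZ // rpred_sum // => j _; apply: tr_sub_N.
      by rewrite pmulrn; apply: generated_head.
    rewrite sumrB sumr_const card_ord scalerBr -scaler_nat scalerA mulVf //.
    by rewrite scale1r /S; zmod.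
  rewrite (linearZ_LR (@bnd k G)) /=.
  rewrite (_ : _ - _ = (a - e *: S a) + e *: (S a - c - bnd u)); last first.
    by rewrite !scalerBr; zmod.
  by apply: rpredD => //; apply/rpredZ/sub.
have {}inf m : ~ generated s (t *+ m.+1) by move=> mt; apply: inf; exists m.
(* Otherwise b is a cycle by tr_sub_inj, hence homologous to a combination c of
   iterated prisms; removing from a the prism over c and (T - 1) u leaves a
   cycle for the smaller subgroup. *)
have : bnd b \in N (generated s).
  apply: (tr_sub_inj inf); move: (bnd_N abN).
  by rewrite !bndB bndK bnd_tr sub0r rpredN.
case/IH => c [u [cI bc]].
have cN : bnd c \in N (generated s).
  move: cI; apply: (span_ind (P := fun x => bnd x \in N (generated s))).
    exact: (subspace_preim (linearP _) (subspace_span _)).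
  exact: bnd_iterated.
have : bnd (a - prism t c - (tr t u - u)) \in N (generated s).
  rewrite !bndB bnd_prism bnd_tr.
  set y := b - c - bnd u in bc.
  rewrite (_ : _ - _ = (bnd a - (tr t b - b)) + prism t (bnd c) + (tr t y - y)).
    apply: rpredD; first by apply: rpredD => //; apply: prism_N.
    by apply: rpredB => //; apply: tr_N.
  by rewrite /y !trB; zmod.
case/IH => c' [u' [cI' ac]].
exists (c' + prism t c), u'; split.
  apply: rpredD; first exact: subI.
  move: cI.
  apply: span_map => [|r rI]; first exact: linearP.
  apply: mem_span; apply: IterPrism.
    by rewrite -[t]mulr1z; apply: generated_head.
  elim: rI => [|h d Hh _ dI]; first exact: IterNil.
  by apply: IterPrism dI; apply: generated_cons.
rewrite (_ : _ - _ = (a - prism t c - (tr t u - u) - c' - bnd u') +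
  (tr t u - u)); last by zmod.
apply: rpredD; first exact: sub.
apply: tr_sub_N.
by rewrite -[t]mulr1z; apply: generated_head.
Qed.

End HomogeneousChains.

(** * Comparison with the bar complex *)

Section BarComparison.
Variables (k : fieldType) (G : zmodType).
Local Notation M := (words k G).
Local Notation word := (@word k G).
Local Notation "v · a" := (@mcons k G v a) (at level 30, right associativity).
Local Notation N := (span (coinv_rel (fun _ : G => True))).

(** The bar word of a simplex with vertices v :: s, and the simplex with first
    vertex v of a bar word: the two passages between homogeneous and
    inhomogeneous chains. *)
Fixpoint steps (v : G) (s : seq G) : seq G :=
  if s is u :: s' then (u - v) :: steps u s' else [::].

Fixpoint partial_sums (v : G) (s : seq G) : seq G :=
  v :: (if s is g :: s' then partial_sums (v + g) s' else [::]).

Lemma size_steps v s : size (steps v s) = size s.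
Proof. by elim: s v => //= u s IH v; rewrite IH. Qed.

Lemma size_partial_sums v s : size (partial_sums v s) = (size s).+1.
Proof. by elim: s v => //= u s IH v; rewrite IH. Qed.

Lemma partial_sumsK v s :
  exists s', partial_sums v s = v :: s' /\ steps v s' = s.
Proof.
elim: s v => [|g s IH] v /=; first by exists [::].
have [s' [-> ss']] := IH (v + g).
by exists (v + g :: s'); rewrite /= ss' addrAC subrr add0r.
Qed.

Lemma stepsK v s : partial_sums v (steps v s) = v :: s.
Proof. by elim: s v => //= u s IH v; rewrite addrC subrK IH. Qed.

Lemma partial_sums_tr v g s :
  partial_sums (v + g) s = [seq u + g | u <- partial_sums v s].
Proof. by elim: s v => //= u s IH v; rewrite -IH addrAC. Qed.

Lemma nth_steps v s j : (j < size s)%N ->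
  (steps v s)`_j = (v :: s)`_j.+1 - (v :: s)`_j.
Proof. by elim: s v j => // u s IH v [|j] //= js; rewrite IH. Qed.

Definition step_word (s : seq G) : M :=
  if s is v :: s' then word (steps v s') else 0.
Definition step_map (a : M) : M := word_lift step_word a.
HB.instance Definition _ := GRing.Linear.copy step_map (word_lift step_word).

Lemma step_mapE s : step_map (word s) = step_word s.
Proof. exact: word_liftE. Qed.

Lemma step_map_cons v u a : step_map (v · u · a) = (u - v) · step_map (u · a).
Proof.
move: a; apply: word_ind => [|s]; last by rewrite !mconsE !step_mapE mconsE.
by apply: subspace_eq; lin.
Qed.

Lemma step_map_tr g a : step_map (tr g a) = step_map a.
Proof.
move: a; apply: word_ind => [|s]; first by apply: subspace_eq; lin.
rewrite trE !step_mapE; case: s => //= v s; congr word.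
elim: s v => //= u s IH v; rewrite IH; congr (_ :: _).
by rewrite opprD addrACA subrr addr0.
Qed.

(** The projection of words onto the bar chains of degree n. *)
Definition bar_of n (s : seq G) : bar k G n :=
  if size s == n then bar_word k [tuple s`_i | i < n] else 0.
Definition to_bar n (a : M) : bar k G n := word_lift (bar_of n) a.
HB.instance Definition _ n :=
  GRing.Linear.copy (to_bar n) (word_lift (bar_of n)).

Lemma to_barE n s : to_bar n (word s) = bar_of n s.
Proof. exact: word_liftE. Qed.

Lemma bar_of_tuple n (t : n.-tuple G) : bar_of n t = bar_word k t.
Proof.
rewrite /bar_of size_tuple eqxx; congr bar_word.
by apply/eq_from_tnth => i; rewrite tnth_mktuple (tnth_nth 0).
Qed.

Lemma bar_of0 n (s : seq G) : 0 \in s -> bar_of n s = 0.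
Proof.
rewrite /bar_of; case: eqP => // sn s0; apply: bar_word0.
have ns : (index (0 : G)%R s < n)%N by rewrite -sn index_mem.
apply/tnthP; exists (Ordinal ns).
by rewrite tnth_mktuple /= nth_index.
Qed.

(** A repeated vertex becomes the letter 0 in the bar word. *)
Definition zero_word (x : M) := exists2 s : seq G, 0 \in s & x = word s.

Lemma to_bar_zero_word n x : x \in span zero_word -> to_bar n x = 0.
Proof.
apply: (span_ind (P := fun x => to_bar n x = 0)).
  by apply: subspace_eq; lin.
by move=> r [s s0 ->]; rewrite to_barE bar_of0.
Qed.

Lemma zero_word_cons v x : x \in span zero_word -> v · x \in span zero_word.
Proof.
apply: span_map => [|r [s s0 ->]]; first exact: linearP.
by rewrite mconsE; apply: mem_span; exists (v :: s) => //; rewrite inE s0 orbT.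
Qed.

Lemma zero_word_cons0 x : 0 · x \in span zero_word.
Proof.
move: x; apply: word_ind => [|s].
  exact: (subspace_preim (linearP _) (subspace_span _)).
by rewrite mconsE; apply: mem_span; exists (0 :: s) => //; rewrite inE eqxx.
Qed.

Lemma step_map_degenerate a : degenerate_chain a ->
  step_map a \in span zero_word.
Proof.
have head b : degenerate_chain b -> exists v c, b = v · c.
  by case=> [v c|v c _]; exists v; eexists.
elim=> [v {}a|v {}a aD IH].
  by rewrite step_map_cons subrr zero_word_cons0.
have [u [c ac]] := head _ aD; rewrite ac step_map_cons -ac.
exact: zero_word_cons.
Qed.

(** The comparison map (v_0, .., v_n) |-> [v_1 - v_0, .., v_n - v_(n-1)]. *)
Definition to_bar_steps n (a : M) : bar k G n := to_bar n (step_map a).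
HB.instance Definition _ n :=
  GRing.Linear.copy (to_bar_steps n) (to_bar n \o step_map).

Lemma to_bar_stepsE n v s : to_bar_steps n (word (v :: s)) = bar_of n (steps v s).
Proof. by rewrite /to_bar_steps step_mapE to_barE. Qed.

Lemma to_bar_steps_coinv n r :
  coinv_rel (fun _ : G => True) r -> to_bar_steps n r = 0.
Proof.
case=> [|a aD|h a _]; rewrite /to_bar_steps.
- by rewrite step_mapE linear0.
- exact/to_bar_zero_word/step_map_degenerate.
- by rewrite linearB /= step_map_tr subrr linear0.
Qed.

Definition delete i (s : seq G) := take i s ++ drop i.+1 s.

Lemma size_delete i s : (i < size s)%N -> size (delete i s) = (size s).-1.
Proof.
move=> is_; rewrite size_cat size_take is_ size_drop.
by case: (size s) is_ => // n; rewrite ltnS subSS /= => /subnKC.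
Qed.

Lemma nth_delete i s j : (i < size s)%N ->
  (delete i s)`_j = if (j < i)%N then s`_j else s`_j.+1.
Proof.
move=> is_; rewrite nth_cat size_take is_; case: ltnP => [ji|ij].
  by rewrite nth_take.
by rewrite nth_drop addSn subnKC.
Qed.

Lemma bnd_sum s :
  bnd (word s) = \sum_(i < size s) (-1) ^+ i *: word (delete i s).
Proof.
elim: s => [|v s IH]; first by rewrite bnd_nil big_ord0.
rewrite -mconsE bnd_cons IH big_ord_recl /= expr0 scale1r /delete /= drop0.
rewrite linear_sum -sumrN; congr (_ + _); apply: eq_bigr => i _.
by rewrite (linearZ_LR (@mcons k G v)) /= mconsE exprS mulN1r scaleNr.
Qed.

Definition homogeneous_chain n : M -> Prop :=
  fun x => exists2 s, size s = n & x = word s.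

Lemma bnd_homogeneous n a : a \in span (homogeneous_chain n.+1) ->
  bnd a \in span (homogeneous_chain n).
Proof.
apply: span_map => [|r [s sn ->]]; first exact: linearP.
rewrite bnd_sum rpred_sum // => i _; rewrite rpredZ // mem_span //.
by exists (delete i s) => //; rewrite size_delete // sn.
Qed.

(** Deleting an inner vertex adds the two steps that meet there; deleting an end
    drops a step. *)
Lemma to_bar_delete n v s (i : 'I_n.+2) (t : n.+1.-tuple G) :
  size s = n.+1 -> steps v s = t ->
  to_bar_steps n (word (delete i (v :: s))) = bar_word k (bar_face t i).
Proof.
move=> sn st; have isz : (i < size (v :: s))%N by rewrite /= sn.
have := size_delete isz; have := fun j => nth_delete j isz.
case: (delete i (v :: s)) => [|u r] nthd; first by rewrite /= sn.
rewrite /= sn => -[rn]; rewrite to_bar_stepsE -bar_of_tuple; congr bar_of.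
apply: (@eq_from_nth _ 0) => [|j]; rewrite size_steps rn ?size_tuple // => jn.
rewrite nth_steps ?rn // !nthd -[RHS](tnth_nth _ _ (Ordinal jn)) tnth_mktuple /=.
rewrite -!st.
have st' l : (l < n.+1)%N -> (steps v s)`_l = (v :: s)`_l.+1 - (v :: s)`_l.
  by rewrite -sn; apply: nth_steps.
have jn1 := leq_trans jn (leqnSn n).
rewrite !st' //; have [//|//|_] := ltngtP j.+1 i.
by rewrite /=; zmod.
Qed.

Lemma bar_dE n (t : n.-tuple G) : bar_d k G n (bar_word k t) = bar_bnd k t.
Proof. by rewrite /bar_d quo_mapE; apply: free_liftE. Qed.

Lemma to_bar_steps_bnd n a :
  to_bar_steps n (bnd a) = bar_d k G n.+1 (to_bar_steps n.+1 a).
Proof.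
move: a; apply: word_ind => [|s]; first by apply: subspace_eq; lin.
case: s => [|v s].
  by rewrite bnd_nil /to_bar_steps step_mapE !linear0.
have [sn|sn] := eqVneq (size s) n.+1; last first.
  rewrite to_bar_stepsE /bar_of size_steps (negPf sn) linear0 bnd_sum linear_sum.
  rewrite big1 // => i _; rewrite linearZ_LR /=.
  have := size_delete (ltn_ord i); case: (delete i _) => [|u r] /=.
    by rewrite /to_bar_steps step_mapE linear0 scaler0.
  move=> rs; rewrite to_bar_stepsE /bar_of size_steps.
  suff -> : (size r == n) = false by rewrite scaler0.
  by apply: contraNF sn => /eqP <-; rewrite rs.
pose t : n.+1.-tuple G := [tuple (steps v s)`_i | i < n.+1].
have st : steps v s = t.
  apply: (@eq_from_nth _ 0) => [|j]; rewrite size_steps ?size_tuple // sn => jn.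
  by rewrite -[RHS](tnth_nth _ _ (Ordinal jn)) tnth_mktuple.
rewrite to_bar_stepsE st bar_of_tuple bar_dE bnd_sum linear_sum /= sn /bar_bnd /=.
by apply: eq_bigr => i _; rewrite linearZ_LR /= (to_bar_delete _ sn st).
Qed.

Local Notation Q := (quo (coinv_rel (fun _ : G => True))).

Definition from_bar_word n (t : n.-tuple G) : Q :=
  quo_pi (word (partial_sums 0 t)).

Lemma from_bar0 n r :
  bar_degenerate r -> free_lift (@from_bar_word n) r = 0.
Proof.
case=> t t0; rewrite free_liftE; apply/quo_pi_eq0/degenerate_N.
have {t0} : (0 : G) \in (t : seq G) by [].
elim: (t : seq G) {2}0 => // g s IH v; rewrite inE /= -mconsE.
case/orP=> [/eqP <-|s0]; last by apply/mcons_D/IH.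
rewrite addr0; have [s' [-> _]] := partial_sumsK v s.
by rewrite -mconsE head_D.
Qed.

Definition from_bar n : {linear bar k G n -> Q} := quo_map (@from_bar0 n).

Lemma from_barE n t : from_bar n (bar_word k t) =
  quo_pi (word (partial_sums 0 t)).
Proof. by rewrite /from_bar quo_mapE; apply: free_liftE. Qed.

(** A simplex is the translate of one with first vertex 0. *)
Lemma to_barK n a : a \in span (homogeneous_chain n.+1) ->
  from_bar n (to_bar_steps n a) = quo_pi a.
Proof.
apply: (span_ind (P := fun a => from_bar n (to_bar_steps n a) = quo_pi a)).
  by apply: subspace_eq; lin.
move=> r [[//|v s] [sn] ->]; rewrite to_bar_stepsE.
have ss : size (steps v s) == n by rewrite size_steps -eqSS sn.
have -> : steps v s = Tuple ss by [].
rewrite bar_of_tuple from_barE /=; apply/eqP; rewrite eq_sym quo_pi_eq.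
rewrite -(stepsK v s) -[v]add0r partial_sums_tr add0r -trE.
exact: tr_sub_N.
Qed.

(** A bar chain lifts to chains with first vertex 0. The boundary of the lift
    vanishes modulo translations because it does in the bar complex, where
    to_barK detects it; in degree 0 it is a multiple of the empty word. *)
Lemma bar_lift n (z : bar k G n) : bar_d k G n z = 0 ->
  exists2 a, to_bar_steps n a = z & bnd a \in N.
Proof.
move: z; apply: quo_ind => r zr.
pose f : {linear {malg k[n.-tuple G]} -> M} :=
  free_lift (fun t : n.-tuple G => word (partial_sums 0 t)).
have fs : f r \in span (homogeneous_chain n.+1).
  move: (r); apply: malg_ind => [|t].
    exact: (subspace_preim (linearP _) (subspace_span _)).
  rewrite /f /= free_liftE; apply: mem_span; exists (partial_sums 0 t) => //.
  by rewrite size_partial_sums size_tuple.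
have fr : to_bar_steps n (f r) = quo_pi r.
  move: (r); apply: malg_ind => [|t].
    by apply: subspace_eq; [apply: (linear_comp (linearP _) (linearP f)) | lin].
  rewrite /f /= free_liftE; have [s [-> st]] := partial_sumsK 0 t.
  by rewrite to_bar_stepsE st bar_of_tuple.
exists (f r) => //; move: zr; rewrite -fr => zr.
have {}fs := bnd_homogeneous fs.
case: n r f fs fr zr => [|n] r f fs fr zr.
  move: fs; apply: span_sub => _ [[|//] _ ->]; exact: nil_N.
by apply/quo_pi_eq0; rewrite -(to_barK fs) to_bar_steps_bnd zr linear0.
Qed.

End BarComparison.

(** * Permuted words and antisymmetrization *)

Section PermutedWords.
Variable T : Type.

Definition insert i (x : T) (s : seq T) := take i s ++ x :: drop i s.

Lemma nth_insert x0 i x s : (i <= size s)%N -> nth x0 (insert i x s) i = x.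
Proof. by move=> le_is; rewrite nth_cat size_takel // ltnn subnn. Qed.

Lemma nth_insert_bump x0 i x s j : (i <= size s)%N ->
  nth x0 (insert i x s) (bump i j) = nth x0 s j.
Proof.
move=> le_is; rewrite nth_cat size_takel // /bump; case: (leqP i j) => ij.
  by rewrite add1n ltnNge leqW // subSn //= nth_drop subnKC.
by rewrite add0n ij nth_take.
Qed.

Definition perm_seq n (t : n.-tuple T) (s : {perm 'I_n}) : seq T :=
  [seq tnth t (s i) | i <- enum 'I_n].

Lemma size_perm_seq n (t : n.-tuple T) s : size (perm_seq t s) = n.
Proof. by rewrite size_map size_enum_ord. Qed.

Lemma nth_perm_seq x0 n (t : n.-tuple T) s (i : 'I_n) :
  nth x0 (perm_seq t s) i = tnth t (s i).
Proof. by rewrite (nth_map i) ?size_enum_ord // nth_ord_enum. Qed.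

(** lift_perm i ord0 s puts the first letter x at position i and arranges the
    other letters according to s. *)
Lemma perm_seq_lift n x (t : n.-tuple T) i (s : {perm 'I_n}) :
  perm_seq [tuple of x :: t] (lift_perm i ord0 s) = insert i x (perm_seq t s).
Proof.
have le_in : (i <= size (perm_seq t s))%N by rewrite size_perm_seq -ltnS.
have sz : size (insert i x (perm_seq t s)) = n.+1.
  by rewrite size_cat /= addnS -size_cat cat_take_drop size_perm_seq.
apply: (@eq_from_nth _ x) => [|j]; rewrite size_perm_seq ?sz // => jn.
rewrite (nth_perm_seq _ _ _ (Ordinal jn)).
case: (unliftP i (Ordinal jn)) => [j'|] ij.
  rewrite ij lift_perm_lift (_ : j = bump i j'); last first.
    by rewrite -[RHS]/(val (lift i j')) -ij.
  rewrite nth_insert_bump // nth_perm_seq (tnth_nth x) /= .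
  by rewrite (tnth_nth x).
by rewrite ij lift_perm_id (_ : j = i) ?nth_insert // -ij.
Qed.

End PermutedWords.

(** A permutation is determined by the position of 0 and the arrangement of the
    other values. *)
Lemma sum_perm_lift (U : nmodType) n (F : {perm 'I_n.+1} -> U) :
  \sum_s F s = \sum_(i < n.+1) \sum_(s : {perm 'I_n}) F (lift_perm i ord0 s).
Proof.
pose f (x : 'I_n.+1 * {perm 'I_n}) := lift_perm x.1 ord0 x.2.
have f_inj : injective f.
  move=> [i s] [j r] /= fE; rewrite /f /= in fE.
  have ij : i = j.
    by apply: (@perm_inj _ (lift_perm i ord0 s));
      rewrite lift_perm_id fE lift_perm_id.
  congr (_, _) => //; apply/permP => l; apply: (@lift_inj _ ord0).
  by rewrite -(lift_perm_lift i) fE -ij lift_perm_lift.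
have f_bij : bijective f.
  by apply: inj_card_bij => //; rewrite card_prod card_ord !card_Sn factS.
by rewrite pair_big (reindex f) //; apply: onW_bij.
Qed.

Section Antisymmetrization.
Variables (k : fieldType) (G : zmodType).
Local Notation M := (words k G).
Local Notation word := (@word k G).
Local Notation "v · a" := (@mcons k G v a) (at level 30, right associativity).

Definition insertions (g : G) (s : seq G) : M :=
  \sum_(i < (size s).+1) (-1) ^+ i *: word (insert i g s).

Lemma insertions_cons g u s :
  insertions g (u :: s) = word [:: g, u & s] - u · insertions g s.
Proof.
rewrite /insertions big_ord_recl expr0 scale1r /insert /=.
congr (_ + _); rewrite linear_sum -sumrN; apply: eq_bigr => i _.
by rewrite (linearZ_LR (@mcons k G u)) /= mconsE exprS mulN1r scaleNr.
Qed.

Definition insertion_map g (a : M) : M := word_lift (insertions g) a.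
HB.instance Definition _ g :=
  GRing.Linear.copy (insertion_map g) (word_lift (insertions g)).

Lemma insertion_mapE g s : insertion_map g (word s) = insertions g s.
Proof. exact: word_liftE. Qed.

(** The i-th simplex of the prism steps by g after its vertex v_i and otherwise
    like the given simplex. *)
Lemma step_map_prism g a :
  step_map (prism g a) = insertion_map g (step_map a).
Proof.
move: a; apply: word_ind => [|s]; first by apply: subspace_eq; lin.
case: s => [|v s]; first by rewrite prism_nil step_mapE !linear0.
rewrite step_mapE /= insertion_mapE -mconsE.
elim: s v => [|u s IH] v.
  rewrite prism_cons prism_nil mcons0 subr0 tr_cons step_map_cons tr_nil.
  rewrite mconsE step_mapE /= mconsE addrAC subrr add0r /insertions.
  by rewrite big_ord_recl big_ord0 addr0 expr0 scale1r.
have prism_u : prism g (word (u :: s)) =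
    u · (tr g (word (u :: s)) - prism g (word s)).
  by rewrite mconsB -!mconsE prism_cons.
rewrite prism_cons linearB /= tr_cons step_map_cons -tr_cons step_map_tr.
rewrite prism_u step_map_cons -prism_u -(mconsE k u s) IH addrAC subrr add0r.
by rewrite insertions_cons !mconsE step_mapE mconsE.
Qed.

Lemma step_map_iterated (t : seq G) :
  step_map (foldr (@prism k G) (word [:: 0]) t) =
  foldr insertion_map (word [::]) t.
Proof.
elim: t => [|g t IH] /=; first by rewrite step_mapE.
by rewrite step_map_prism IH.
Qed.

(** Inserting letters one after the other in all positions produces every
    permutation once, with the sign of the position at each step. *)
Lemma iterated_insertions n (t : n.-tuple G) :
  foldr insertion_map (word [::]) t =
  \sum_(s : {perm 'I_n}) (-1) ^+ s *: word (perm_seq t s).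
Proof.
elim: n t => [|n IH] t.
  have s1 (s : {perm 'I_0}) : s = 1%g by apply/permP; case.
  rewrite tuple0 (bigD1 1%g) //= odd_perm1 expr0 scale1r big1 ?addr0.
    by rewrite (size0nil (size_perm_seq _ _)).
  by move=> s /eqP[]; apply: s1.
case/tupleP: t => x t; rewrite /= IH sum_perm_lift linear_sum exchange_big /=.
apply: eq_bigr => s _; rewrite linearZ_LR /= insertion_mapE /insertions.
rewrite size_perm_seq scaler_sumr; apply: eq_bigr => i _.
by rewrite perm_seq_lift odd_lift_perm addbF signr_addb scalerA mulrC signr_odd.
Qed.

Lemma to_bar_iterated n (t : n.-tuple G) :
  to_bar_steps n (foldr (@prism k G) (word [:: 0]) t) = antisym k t.
Proof.
rewrite /to_bar_steps step_map_iterated iterated_insertions linear_sum.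
apply: eq_bigr => s _; rewrite linearZ_LR /= to_barE; congr (_ *: _).
rewrite /bar_of size_perm_seq eqxx; congr bar_word.
by apply/eq_from_tnth => i; rewrite !tnth_mktuple nth_perm_seq.
Qed.

Lemma to_bar_iterated_neq n (t : seq G) : size t != n ->
  to_bar_steps n (foldr (@prism k G) (word [:: 0]) t) = 0.
Proof.
move=> tn; rewrite /to_bar_steps step_map_iterated.
rewrite (iterated_insertions (in_tuple t)) linear_sum big1 // => s _.
rewrite linearZ_LR /= to_barE /bar_of size_perm_seq (negPf tn).
exact: scaler0.
Qed.

End Antisymmetrization.

(** * Scalar extension and exterior powers *)

Section ScalarExtensionLift.
Variables (k : fieldType) (G : zmodType).
Local Notation V := (scal_ext G k).

Lemma scal_pureZ (g : G) (a : k) : scal_pure g a = a *: scal_pure g 1.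
Proof.
apply/eqP; rewrite -subr_eq0 /scal_pure -linearZ_LR -linearB /=; apply/eqP.
by apply: quo_pi_rel; rewrite -{1}[a]mulr1; apply: ScalRelZ.
Qed.

Lemma scal_pureD (g h : G) (a : k) : scal_pure (g + h) a = scal_pure g a +
  scal_pure h a.
Proof.
apply/eqP; rewrite -subr_eq0 /scal_pure -linearD -linearB /=; apply/eqP.
exact/quo_pi_rel/ScalRelL.
Qed.

Lemma scal_pure0 (a : k) : scal_pure (0 : G) a = 0 :> V.
Proof. by apply: (@addrI _ (scal_pure (0 : G) a));
  rewrite -scal_pureD !addr0. Qed.

Lemma scal_ext_ind (P : V -> Prop) : subspace P ->
  (forall g : G, P (scal_pure g 1)) -> forall v, P v.
Proof.
move=> PS Pg; apply: quo_ind; apply: malg_ind => [|[g a]].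
  exact: (subspace_preim (linearP quo_pi)).
by rewrite -[quo_pi _]/(scal_pure g a) scal_pureZ; apply: subspaceZ.
Qed.

Variables (U : lmodType k) (f : G -> U).
Hypothesis fD : forall g h, f (g + h) = f g + f h.

Let F : {linear {malg k[(G * k)%type]} -> U} :=
  free_lift (fun p : G * k => p.2 *: f p.1).

Fact scal_lift_rel r : scal_rel r -> F r = 0.
Proof.
case=> [g h a|g a b|g a b]; rewrite linearB ?linearD ?linearZ_LR /=
  !free_liftE /=.
- by rewrite fD scalerDr -opprD subrr.
- by rewrite scalerDl -opprD subrr.
- by rewrite scalerN scalerA subrr.
Qed.

Definition scal_lift : {linear V -> U} := quo_map scal_lift_rel.

Lemma scal_liftE (g : G) : scal_lift (scal_pure g 1) = f g.
Proof.
by rewrite /scal_lift quo_mapE; apply: etrans (free_liftE _ _) _; rewrite scale1r.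
Qed.

End ScalarExtensionLift.

Section ExteriorPower.
Variables (k : fieldType) (V : lmodType k) (n : nat).
Implicit Types (t : n.-tuple V) (i j : 'I_n).

Lemma wedge_multilinear : multilinear (@wedge k V n).
Proof.
move=> t i a u v; apply/eqP; rewrite -subr_eq0 /wedge -linearP -linearB /=.
by apply/eqP/quo_pi_rel/AlternMultilin/MultilinRel.
Qed.

Lemma wedge_repeat t i j : i != j -> tnth t i = tnth t j -> wedge t = 0.
Proof. by move=> ij tij; apply/quo_pi_rel/(AlternRel ij). Qed.

Lemma updC t i j u v : i != j -> upd (upd t i u) j v = upd (upd t j v) i u.
Proof.
move=> ij; apply/eq_from_tnth => l; rewrite !tnth_mktuple.
by case: eqVneq => // ->; rewrite eq_sym (negPf ij).
Qed.

Lemma wedge_swap t i j u v : i != j ->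
  wedge (upd (upd t i u) j v) = - wedge (upd (upd t i v) j u).
Proof.
move=> ij; pose F x y := wedge (upd (upd t i x) j y).
have FxD x y z : F x (y + z) = F x y + F x z.
  by have := wedge_multilinear (upd t i x) j 1 y z; rewrite !scale1r.
have FDx x y z : F (y + z) x = F y x + F z x.
  rewrite /F !(updC _ _ _ ij).
  by have := wedge_multilinear (upd t j x) i 1 y z; rewrite !scale1r.
have F0 x : F x x = 0.
  apply: (@wedge_repeat _ i j) => //; rewrite !tnth_mktuple eqxx.
  by rewrite (negPf ij) eqxx.
apply/eqP; rewrite -addr_eq0 -[wedge _]/(F u v) -[X in _ + X]/(F v u).
have := F0 (u + v); rewrite FxD !FDx !F0 add0r addr0 addrC => ->.
exact: eqxx.
Qed.

(** The permutation is decomposed into transpositions, each of which changes the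
    sign by wedge_swap. *)
Lemma wedge_perm t (s : {perm 'I_n}) :
  wedge [tuple tnth t (s i) | i < n] = (-1) ^+ s *: wedge t.
Proof.
have [ts -> dts] := prod_tpermP s.
elim: ts t dts => [|[i j] ts IH] t /=.
  rewrite big_nil odd_perm1 expr0 scale1r => _; congr wedge.
  by apply/eq_from_tnth => i; rewrite tnth_mktuple perm1.
case/andP=> /= ij dts; rewrite big_cons odd_mul_tperm ij.
pose t' := [tuple tnth t ((\prod_(t <- ts) tperm t.1 t.2)%g i) | i < n].
rewrite signr_addb -scalerA -(IH t dts) -/t' expr1 scaleN1r.
have t'E : t' = upd (upd t' i (tnth t' i)) j (tnth t' j) by rewrite !upd_id.
rewrite [X in - wedge X]t'E -wedge_swap //; congr wedge.
apply/eq_from_tnth => l; rewrite !tnth_mktuple permM.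
by case: tpermP => [->|->|/eqP/negPf li /eqP/negPf lj];
  rewrite ?eqxx ?(negPf ij) ?li ?lj ?tnth_mktuple.
Qed.

End ExteriorPower.

(** * The Pontryagin map *)

Section PontryaginAction.
Variables (k : fieldType) (G : zmodType).
Local Notation M := (words k G).
Local Notation word := (@word k G).
Local Notation N := (span (coinv_rel (fun _ : G => True))).
Local Notation V := (scal_ext G k).

Definition coinvariants : lmodType k :=
  quo (coinv_rel (k := k) (fun _ : G => True)).
Local Notation Q := coinvariants.

Section Descend.
Variable f : {linear M -> M}.
Hypothesis fN : forall a, a \in N -> f a \in N.

Fact coinv_op_rel r : coinv_rel (fun _ : G => True) r ->
  (quo_pi \o f : M -> Q) r = 0.
Proof. by move=> rR; apply/quo_pi_eq0/fN/mem_span. Qed.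
Definition coinv_op : {linear Q -> Q} := quo_map coinv_op_rel.
Lemma coinv_opE a : coinv_op (quo_pi a) = quo_pi (f a).
Proof. exact: quo_mapE. Qed.
End Descend.

Definition coinv_bnd : {linear Q -> Q} :=
  coinv_op (@bnd_N k G (fun _ => True)).
Definition coinv_prism g : {linear Q -> Q} :=
  coinv_op (@prism_N k G (fun _ => True) g).

Lemma coinv_bndE a : coinv_bnd (quo_pi a) = quo_pi (bnd a).
Proof. exact: coinv_opE. Qed.
Lemma coinv_prismE g a : coinv_prism g (quo_pi a) = quo_pi (prism g a).
Proof. exact: coinv_opE. Qed.

Lemma coinv_tr g a : quo_pi (tr g a) = quo_pi a :> Q.
Proof. by apply/eqP; rewrite quo_pi_eq; apply: tr_sub_N. Qed.

Lemma coinv_bnd_prism g q :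
  coinv_bnd (coinv_prism g q) = - coinv_prism g (coinv_bnd q).
Proof.
move: q; apply: quo_ind => a; rewrite coinv_prismE !coinv_bndE coinv_prismE.
by rewrite bnd_prism !linearB /= coinv_tr subrr sub0r.
Qed.

(** The homology of the coinvariants in all degrees at once, that is with both
    differentials equal to coinv_bnd on the ungraded module. *)
Definition coinv_homology : lmodType k := homology coinv_bnd coinv_bnd.
Local Notation HQ := coinv_homology.

Fact prism_hom_cycle g q :
  coinv_bnd q = 0 -> coinv_bnd (coinv_prism g q) = 0.
Proof. by rewrite coinv_bnd_prism => ->; rewrite linear0 oppr0. Qed.

Fact prism_hom_boundary g u : coinv_bnd (coinv_bnd u) = 0 ->
  exists u', coinv_bnd u' = coinv_prism g (coinv_bnd u).
Proof.
by exists (- coinv_prism g u); rewrite linearN coinv_bnd_prism opprK.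
Qed.

Definition prism_hom g : {linear HQ -> HQ} :=
  homology_map (@prism_hom_cycle g) (@prism_hom_boundary g).

Lemma prism_hom_represents g q (x : HQ) :
  represents q x -> represents (coinv_prism g q) (prism_hom g x).
Proof. exact: homology_map_represents. Qed.

(** The chain homotopy prism2 makes the prism operator additive in g. *)
Lemma prism_homD g h (x : HQ) :
  prism_hom (g + h) x = prism_hom g x + prism_hom h x.
Proof.
move: x; apply: represents_ind => q qZ; have qx := cls_represents coinv_bnd qZ.
have gh := prism_hom_represents (g + h) qx.
have hg : represents (coinv_prism g q + coinv_prism h q)
    (prism_hom g (cls coinv_bnd qZ) + prism_hom h (cls coinv_bnd qZ)).
  have := represents_linear 1 (prism_hom_represents g qx)
    (prism_hom_represents h qx).
  by rewrite !scale1r.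
move: q qZ qx gh hg; apply: quo_ind => a qZ _ gh hg.
apply: (represents_homologous (u := quo_pi (- prism2 g h a)) gh hg).
rewrite !coinv_prismE coinv_bndE linearN /= bnd_prism2 prism_tr !linearN /=.
rewrite !linearD linearN /= coinv_tr [h + g]addrC.
suff -> : quo_pi (prism2 g h (bnd a)) = 0 :> Q by zmod.
by apply/quo_pi_eq0/prism2_N/quo_pi_eq0; rewrite -coinv_bndE.
Qed.

Lemma prism_homK g (x : HQ) : prism_hom g (prism_hom g x) = 0.
Proof.
move: x; apply: represents_ind => q qZ; have qx := cls_represents coinv_bnd qZ.
have := prism_hom_represents g (prism_hom_represents g qx).
move: q qZ qx; apply: quo_ind => a qZ _; rewrite !coinv_prismE prismK linear0.
have r0 : represents (0 : Q) (0 : HQ) by exists 0 => //; rewrite linear0.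
by move=> r; apply: represents_boundary r r0.
Qed.

Lemma prism_homC g h (x : HQ) :
  prism_hom g (prism_hom h x) + prism_hom h (prism_hom g x) = 0.
Proof.
have := prism_homK (g + h) x; rewrite !prism_homD (linearD (prism_hom g)).
by rewrite (linearD (prism_hom h)) !prism_homK add0r addr0.
Qed.

(** The action of the scalar extension that extends the prism operators, which
    are additive in g. *)
Definition act (v : V) (x : HQ) : HQ :=
  scal_lift (fun g h => prism_homD g h x) v.

Lemma act_pure (g : G) x : act (scal_pure g 1) x = prism_hom g x.
Proof. exact: scal_liftE. Qed.

Lemma act_bilin : bilin act.
Proof.
have al x : linear (act^~ x) by exact: linearP.
split=> [x|v]; first exact: al.
move: v; apply: scal_ext_ind => [|g a x y]; last by rewrite !act_pure linearP.
split=> [a x y|b u v uL vL a x y]; first by rewrite !(lin0 (al _)) scaler0 addr0.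
by rewrite !al uL vL !scalerDr !scalerA mulrC addrACA.
Qed.

Lemma actC v w x : act v (act w x) + act w (act v x) = 0.
Proof.
have [al ar] := act_bilin.
have lin1 u y : linear (fun z => act u (act z y)).
  exact: (linear_comp (ar u) (al y)).
move: v; apply: scal_ext_ind => [|g].
  apply: (subspace_eq (f := fun v => act v (act w x) + act w (act v x))).
    exact: (linear_add (al _) (lin1 _ _)).
  by lin.
move: w; apply: scal_ext_ind => [|h]; last by rewrite !act_pure prism_homC.
apply: (subspace_eq (f := fun w => act _ (act w x) + act w (act _ x))).
  exact: (linear_add (lin1 _ _) (al _)).
by lin.
Qed.

(** Alternation passes from the generators to sums because they anticommute
    (actC); this holds in every characteristic. *)
Lemma actK v x : act v (act v x) = 0.
Proof.
move: v x; apply: (scal_ext_ind (P := fun v => forall x, act v (act v x) = 0)).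
  have [al ar] := act_bilin.
  split=> [x|a u v uK vK x]; first by rewrite (lin0 (al _)).
  rewrite !al !(ar u) !(ar v) uK vK scaler0 add0r addr0 -scalerDr.
  by rewrite addrC ?actC -?[act v _ + _]addrC ?actC ?scaler0.
by move=> g x; rewrite !act_pure prism_homK.
Qed.

Fact unit_cycle : coinv_bnd (quo_pi (word [:: 0])) = 0.
Proof.
rewrite coinv_bndE; apply/quo_pi_eq0; rewrite -mconsE bnd_cons bnd_nil mcons0.
by rewrite subr0 nil_N.
Qed.
Definition hom_unit : HQ := cls coinv_bnd unit_cycle.

Definition act_seq (s : seq V) : HQ := foldr act hom_unit s.

Lemma act_mem v s : v \in s -> act v (act_seq s) = 0.
Proof.
elim: s => // u s IH; rewrite inE => /orP[/eqP ->|vs]; first exact: actK.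
have /eqP := actC v u (act_seq s); rewrite addr_eq0 => /eqP /= ->.
by rewrite IH // (lin0 (act_bilin.2 u)) oppr0.
Qed.

Lemma act_seq_repeat s : ~~ uniq s -> act_seq s = 0.
Proof.
elim: s => //= v s IH; rewrite negb_and negbK => /orP[|/IH] s0.
  exact: act_mem.
by rewrite s0 (lin0 (act_bilin.2 v)).
Qed.

Lemma act_seq_pure (s : seq G) :
  represents (quo_pi (foldr (@prism k G) (word [:: 0]) s) : Q)
    (act_seq [seq scal_pure g 1 | g <- s]).
Proof.
elim: s => [|g s IH] /=; first exact: cls_represents.
by rewrite act_pure -coinv_prismE; apply: prism_hom_represents.
Qed.

Definition coinv_to_bar n : {linear Q -> bar k G n} :=
  quo_map (@to_bar_steps_coinv k G n).

Lemma coinv_to_barE n a : coinv_to_bar n (quo_pi a) = to_bar_steps n a.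
Proof. exact: quo_mapE. Qed.

Lemma coinv_to_bar_bnd n q :
  coinv_to_bar n (coinv_bnd q) = bar_d k G n.+1 (coinv_to_bar n.+1 q).
Proof.
move: q; apply: quo_ind => a.
by rewrite coinv_bndE !coinv_to_barE to_bar_steps_bnd.
Qed.

Lemma bar_ind n (P : bar k G n -> Prop) : subspace P ->
  (forall t, P (bar_word k t)) -> forall x, P x.
Proof.
move=> PS Pt; apply: quo_ind; apply: malg_ind => [|t]; last exact: Pt.
exact: (subspace_preim (linearP quo_pi)).
Qed.

Lemma bar_d0 x : bar_d k G 0 x = 0.
Proof.
move: x; apply: bar_ind => [|t]; first by apply: subspace_eq; lin.
by rewrite bar_dE /bar_bnd big_pred0.
Qed.

Fact to_homology_cycle n q : coinv_bnd q = 0 ->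
  bar_d k G n (coinv_to_bar n q) = 0.
Proof.
case: n => [|n] q0; first exact: bar_d0.
by rewrite -coinv_to_bar_bnd q0 linear0.
Qed.

Fact to_homology_boundary n u : coinv_bnd (coinv_bnd u) = 0 ->
  exists u', bar_d k G n.+1 u' = coinv_to_bar n (coinv_bnd u).
Proof. by exists (coinv_to_bar n.+1 u); rewrite coinv_to_bar_bnd. Qed.

Definition to_homology n : {linear HQ -> group_homology k G n} :=
  homology_map (@to_homology_cycle n) (@to_homology_boundary n).

Lemma to_homology_represents n a (x : HQ) : represents (quo_pi a : Q) x ->
  bar_represents (to_bar_steps n a) (to_homology n x).
Proof.
by move=> ax; rewrite -coinv_to_barE; apply: homology_map_represents.
Qed.

Fact pontryagin_rel n r : altern_rel r ->
  free_lift (fun t : n.-tuple V => to_homology n (act_seq t)) r = 0.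
Proof.
case=> [{}r rM|t i j ij tij].
  apply: multilin_rel_lift rM.
  exact: (foldr_multilinear hom_unit act_bilin (linearP (to_homology n))).
rewrite free_liftE act_seq_repeat ?linear0 //.
by apply/negP => /tuple_uniqP/(_ i j tij)/eqP; apply/negP.
Qed.

Definition pontryagin n : {linear ext_pow V n -> group_homology k G n} :=
  quo_map (@pontryagin_rel n).

Lemma pontryagin_represents n (t : n.-tuple G) :
  bar_represents (antisym k t)
    (pontryagin n (wedge [tuple scal_pure (tnth t i) (1 : k) | i < n])).
Proof.
rewrite -to_bar_iterated /pontryagin quo_mapE /= free_liftE.
apply: to_homology_represents.
suff -> : [tuple scal_pure (tnth t i) (1 : k) | i < n] =
    map_tuple (fun g => scal_pure g 1) t by apply: act_seq_pure.
by apply/eq_from_tnth => i; rewrite tnth_mktuple tnth_map.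
Qed.

(** The exterior product of the letters of a bar word: up to the factor n!, the
    inverse of the Pontryagin map. *)
Definition bar_wedge_word n (t : n.-tuple G) : ext_pow V n :=
  wedge [tuple scal_pure (tnth t i) (1 : k) | i < n].

Fact bar_wedge_rel n r :
  bar_degenerate r -> free_lift (@bar_wedge_word n) r = 0.
Proof.
case=> t /tnthP[i ti]; rewrite free_liftE /bar_wedge_word.
set w := mktuple _; have wi : tnth w i = 0 by rewrite tnth_mktuple -ti scal_pure0.
by rewrite -(upd_id w i) wi; apply: lin0 (wedge_multilinear w i).
Qed.

Definition bar_wedge n : {linear bar k G n -> ext_pow V n} :=
  quo_map (@bar_wedge_rel n).

Lemma bar_wedgeE n t : bar_wedge n (bar_word k t) = bar_wedge_word t.
Proof. by rewrite /bar_wedge quo_mapE; apply: free_liftE. Qed.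

Lemma telescope (W : lmodType k) (A : nat -> W) m :
  \sum_(i < m) (-1) ^+ i *: (A i.+1 + A i) = A 0%N - (-1) ^+ m *: A m.
Proof.
elim: m => [|m IH]; first by rewrite big_ord0 expr0 scale1r subrr.
by rewrite big_ord_recr /= IH exprS mulN1r scaleNr scalerDr; zmod.
Qed.

(** Let A l be the exterior product with the l-th letter omitted. By additivity
    the inner face i.+1 has the image A i.+1 + A i, the outer ones have the
    images A 0 and A n, and the alternating sum telescopes. *)
Lemma bar_wedge_bnd n x : bar_wedge n (bar_d k G n.+1 x) = 0.
Proof.
move: x; apply: bar_ind => [|t]; first by apply: subspace_eq; lin.
pose A l := bar_wedge_word [tuple if (j < l)%N then t`_j else t`_j.+1 | j < n].
pose W (i : 'I_n.+2) := @bar_wedge_word n (bar_face t i).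
have W0 : W ord0 = A 0%N by congr bar_wedge_word; apply/eq_from_tnth => j;
  rewrite !tnth_mktuple.
have Wn : W (lift ord0 ord_max) = A n.
  congr bar_wedge_word; apply/eq_from_tnth => j.
  by rewrite !tnth_mktuple /= /bump /= add1n ltnS ltn_ord.
have Wi (i : 'I_n) : W (lift ord0 (widen_ord (leqnSn n) i)) = A i.+1 + A i.
  set T := [tuple scal_pure t`_(if (j < i)%N then j : nat else j.+1) (1 : k) |
    j < n].
  have AE l (v : V) : (forall j : 'I_n, scal_pure
      (if (j < l)%N then t`_j else t`_j.+1) 1 = if j == i then v else tnth T j) ->
      A l = wedge (upd T i v).
    move=> lv; congr wedge; apply/eq_from_tnth => j.
    by rewrite !tnth_mktuple lv tnth_mktuple.
  rewrite (AE i.+1 (scal_pure t`_i 1)) => [|j]; last first.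
    rewrite tnth_mktuple -val_eqE /= ltnS.
    by case: (ltngtP j i) => [||->].
  rewrite (AE i (scal_pure t`_i.+1 1)) => [|j]; last first.
    rewrite tnth_mktuple -val_eqE /=.
    by case: (ltngtP j i) => [||->].
  rewrite -[X in _ = X + _]scale1r -(wedge_multilinear T i) scale1r.
  congr wedge; apply/eq_from_tnth => j; rewrite !tnth_mktuple /= /bump /= add1n.
  rewrite -scal_pureD -val_eqE /= ltnS eqSS.
  by case: (ltngtP j i) => [||->].
rewrite bar_dE.
have -> : bar_wedge n (bar_bnd k t) = \sum_(i < n.+2) (-1) ^+ i *: W i.
  rewrite /bar_bnd linear_sum; apply: eq_bigr => i _.
  by rewrite linearZ_LR; congr (_ *: _); apply: bar_wedgeE.
rewrite big_ord_recl big_ord_recr /= expr0 scale1r W0 Wn.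
rewrite (eq_bigr (fun i : 'I_n => - ((-1) ^+ i *: (A i.+1 + A i)))).
  rewrite sumrN telescope /bump /= add1n exprS mulN1r scaleNr.
  by move: (A 0%N) (_ *: A n) => a b; zmod.
by move=> i _; rewrite Wi /bump /= add1n exprS mulN1r scaleNr.
Qed.

End PontryaginAction.

(** * The Pontryagin map is bijective in characteristic 0 *)

Section PontryaginIsomorphism.
Variables (k : fieldType) (G : zmodType).
Hypothesis k_char0 : forall m, (m.+1)%:R != 0 :> k.
Local Notation V := (scal_ext G k).

Definition homology_wedge n : {linear group_homology k G n -> ext_pow V n} :=
  homology_lift (bar_d k G n) (@bar_wedge_bnd k G n).

Lemma homology_wedgeE n (z : bar k G n) x :
  bar_represents z x -> homology_wedge n x = bar_wedge k G n z.
Proof. exact: homology_liftE. Qed.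

Lemma bar_wedge_antisym n (t : n.-tuple G) :
  bar_wedge k G n (antisym k t) = (n`!)%:R *: bar_wedge_word k t.
Proof.
rewrite /antisym linear_sum -card_Sn -sumr_const scaler_suml.
apply: eq_bigr => s _; rewrite linearZ_LR bar_wedgeE.
rewrite (_ : bar_wedge_word k _ = (-1) ^+ s *: bar_wedge_word k t).
  by rewrite scalerA -signr_addb addbb scale1r.
rewrite /bar_wedge_word -wedge_perm; congr wedge.
by apply/eq_from_tnth => i; rewrite !tnth_mktuple.
Qed.

(** Every term of an antisymmetrization has the same exterior product, the signs
    cancelling; multilinearity reduces the claim to these classes. *)
Lemma homology_wedgeK n w :
  homology_wedge n (pontryagin k G n w) = (n`!)%:R *: w.
Proof.
move: w; apply: quo_ind; apply: malg_ind => [|t].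
  apply: (subspace_eq (f := fun r => homology_wedge n (pontryagin k G n
    (quo_pi r)))).
    exact: (linear_comp (linearP _) (linear_comp (linearP _) (linearP _))).
  exact: (linear_scale _ (linearP quo_pi)).
pose B (v : V) := exists g : G, v = scal_pure g 1.
pose f (t : n.-tuple V) :=
  homology_wedge n (pontryagin k G n (wedge t)) - (n`!)%:R *: wedge t.
suff : f t = 0 by move/eqP; rewrite subr_eq0 => /eqP.
apply: (@multilinear_eq0 _ _ _ _ B).
- apply: scal_ext_ind => [|g]; first exact: subspace_span.
  by apply: mem_span; exists g.
- move=> t' i; apply: linear_sub.
    apply: (linear_comp (linearP _) (linear_comp (linearP _) _)).
    exact: wedge_multilinear.
  exact: (linear_scale _ (wedge_multilinear t' i)).
move=> {}t tB; pose g := [tuple projT1 (cid (tB i)) | i < n].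
have tg : t = [tuple scal_pure (tnth g i) 1 | i < n].
  by apply/eq_from_tnth => i; rewrite !tnth_mktuple; case: (cid _).
rewrite /f [in X in X - _]tg (homology_wedgeE (pontryagin_represents k g)).
by rewrite bar_wedge_antisym [in X in _ - X]tg subrr.
Qed.

(** A bar cycle is lifted to homogeneous chains, where it is homologous to a
    combination of iterated prisms; these become antisymmetrized bar words. *)
Lemma pontryagin_surj n y : exists w, pontryagin k G n w = y.
Proof.
move: y; apply: represents_ind => z zZ; have zy :=
  cls_represents (bar_d k G n.+1) zZ.
have [a az aN] := bar_lift zZ; have [s asN] := coinv_finite aN.
have [c [u [cI acu]]] := prism_spanned_generated k_char0 asN.
have {}acu : to_bar_steps n (a - c - bnd u) = 0.
  move: acu; apply: (span_ind (P := fun x => to_bar_steps n x = 0)).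
    by apply: subspace_eq; lin.
  move=> r rR; apply: to_bar_steps_coinv; case: rR => [|b|h b _].
  - exact: CoinvNil.
  - exact: CoinvDegenerate.
  - exact: CoinvTr.
have [w wc] : exists w, bar_represents (to_bar_steps n c) (pontryagin k G n w).
  move: cI; apply: (span_ind (P := fun c => exists w,
      bar_represents (to_bar_steps n c) (pontryagin k G n w))).
    split=> [|e x y [v xv] [v' yv']].
      by exists 0; rewrite !linear0; exists 0; rewrite // linear0.
    exists (e *: v + v'); rewrite !linearP.
    exact: represents_linear xv yv'.
  move=> r rI; have [t ->] : exists t, r = foldr (@prism k G) (word k [:: 0]) t.
    elim: rI => [|h d _ _ [t ->]]; first by exists [::].
    by exists (h :: t).
  have [tn|tn] := eqVneq (size t) n; last first.
    exists 0; rewrite to_bar_iterated_neq // linear0.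
    by exists 0; rewrite // linear0.
  rewrite -tn; eexists; rewrite (to_bar_iterated k (in_tuple t)).
  exact: pontryagin_represents.
exists w; apply: (represents_homologous (u := - to_bar_steps n.+1 u) wc zy).
rewrite -az linearN -to_bar_steps_bnd; move: acu; rewrite !linearB.
move/eqP; rewrite subr_eq0 subr_eq => /eqP ->.
by rewrite addrAC subrr add0r.
Qed.

Lemma pontryagin_bij n : bijective (pontryagin k G n).
Proof.
have n0 : (n`!)%:R != 0 :> k by rewrite -(prednK (fact_gt0 n)).
apply: (@Bijective _ _ _ (fun y => (n`!)%:R^-1 *: homology_wedge n y)) => [w|y].
  by rewrite homology_wedgeK scalerA mulVf // scale1r.
have [w <-] := pontryagin_surj y.
by rewrite homology_wedgeK scalerA mulVf // scale1r.
Qed.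

End PontryaginIsomorphism.

(** * Sums over unshuffles *)

Section Unshuffles.
Variable T : eqType.
Implicit Types (l : seq T).

(** The ways to split a word into two subwords, with the exponent of the sign of
    the corresponding shuffle: a letter that goes to the right is passed by all
    the later letters that go to the left. *)
Fixpoint unshuffles l : seq (nat * (seq T * seq T)) :=
  if l is x :: l' then
    [seq (u.1, (x :: u.2.1, u.2.2)) | u <- unshuffles l'] ++
    [seq (size u.2.1 + u.1, (u.2.1, x :: u.2.2))%N | u <- unshuffles l']
  else [:: (0%N, ([::], [::]))].

Lemma unshuffles_perm l u : u \in unshuffles l -> perm_eq (u.2.1 ++ u.2.2) l.
Proof.
elim: l u => [|x l IH] u; first by rewrite inE => /eqP ->.
rewrite mem_cat => /orP[] /mapP[v /IH vl ->] /=; first by rewrite perm_cons.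
by rewrite -cat1s perm_catCA perm_cons.
Qed.

End Unshuffles.

HB.lock Definition ushsum (T : eqType) (k : fieldType) (U : lmodType k)
    (F : seq T -> seq T -> U) (l : seq T) : U :=
  \sum_(u <- unshuffles l) (-1) ^+ u.1 *: F u.2.1 u.2.2.

Section UnshuffleSum.
Variables (T : eqType) (k : fieldType).
Implicit Types l : seq T.

Section Sum.
Variable U : lmodType k.
Implicit Types F : seq T -> seq T -> U.

Lemma ushsum_nil F : ushsum F [::] = F [::] [::].
Proof. by rewrite ushsum.unlock big_seq1 expr0 scale1r. Qed.

Lemma ushsum_cons F x l : ushsum F (x :: l) =
  ushsum (fun a b => F (x :: a) b) l +
  ushsum (fun a b => (-1) ^+ size a *: F a (x :: b)) l.
Proof.
rewrite ushsum.unlock big_cat !big_map; congr (_ + _); apply: eq_bigr => u _ /=.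
by rewrite scalerA exprD mulrC.
Qed.

Lemma eq_ushsum F F' l :
  (forall a b, perm_eq (a ++ b) l -> F a b = F' a b) ->
  ushsum F l = ushsum F' l.
Proof.
move=> FF'; rewrite ushsum.unlock big_seq [RHS]big_seq; apply: eq_bigr => u ul.
by rewrite FF' // unshuffles_perm.
Qed.

Lemma ushsumD F F' l :
  ushsum (fun a b => F a b + F' a b) l = ushsum F l + ushsum F' l.
Proof.
by rewrite ushsum.unlock -big_split; apply: eq_bigr => u _; rewrite scalerDr.
Qed.

Lemma ushsum0 F l : (forall a b, perm_eq (a ++ b) l -> F a b = 0) ->
  ushsum F l = 0.
Proof.
move=> F0; rewrite (@eq_ushsum F (fun _ _ => 0)) //.
by rewrite ushsum.unlock big1 // => u _; rewrite scaler0.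
Qed.

Lemma ushsumZ c F l : ushsum (fun a b => c *: F a b) l = c *: ushsum F l.
Proof.
rewrite ushsum.unlock scaler_sumr; apply: eq_bigr => u _.
by rewrite !scalerA mulrC.
Qed.

Lemma ushsum_emptyr (f : seq T -> U) l :
  ushsum (fun a b => if b is [::] then f a else 0) l = f l.
Proof.
elim: l f => [|x l IH] f; first by rewrite ushsum_nil.
rewrite ushsum_cons (IH (fun a => f (x :: a))) ushsum0 ?addr0 // => a b _.
exact: scaler0.
Qed.

Lemma ushsum_emptyl (f : seq T -> U) l :
  ushsum (fun a b => if a is [::] then f b else 0) l = f l.
Proof.
elim: l f => [|x l IH] f; first by rewrite ushsum_nil.
rewrite ushsum_cons ushsum0 // add0r -(IH (fun b => f (x :: b))).
by apply: eq_ushsum => -[|y a] b _; rewrite ?scaler0 // expr0 scale1r.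
Qed.

(** Exchanging the two subwords permutes the unshuffles, and the sign changes by
    that of the exchange of two blocks. *)
Lemma ushsum_comm F l : ushsum F l =
  ushsum (fun a b => (-1) ^+ (size a * size b) *: F b a) l.
Proof.
elim: l F => [|x l IH] F; first by rewrite !ushsum_nil expr0 scale1r.
rewrite !ushsum_cons addrC; congr (_ + _); rewrite IH; apply: eq_ushsum => a b _.
  by rewrite scalerA -exprD /= mulSn addnC.
rewrite scalerA -exprD /= mulnS addnA addnn.
by rewrite -[in RHS]signr_odd oddD odd_double /= signr_odd.
Qed.

(** Both sides are the sum over the splittings into three subwords, with the
    sign of the number of inversions. *)
Lemma ushsum_assoc (F : seq T -> seq T -> seq T -> U) l :
  ushsum (fun a b => ushsum (fun a1 a2 => F a1 a2 b) a) l =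
  ushsum (fun a b => ushsum (fun b1 b2 => F a b1 b2) b) l.
Proof.
elim: l F => [|x l IH] F; first by rewrite !ushsum_nil.
rewrite !ushsum_cons.
under eq_ushsum do rewrite ushsum_cons.
rewrite ushsumD (IH (fun a b c => F (x :: a) b c)) -addrA; congr (_ + _).
under [in RHS]eq_ushsum do rewrite ushsum_cons scalerDr -!ushsumZ.
rewrite ushsumD (IH (fun a b c => (-1) ^+ size a *: F a (x :: b) c)).
congr (_ + _).
transitivity (ushsum (fun a b => ushsum (fun a1 a2 =>
    (-1) ^+ (size a1 + size a2) *: F a1 a2 (x :: b)) a) l).
  apply: eq_ushsum => a b _; rewrite -ushsumZ; apply: eq_ushsum => a1 a2.
  by move/perm_size <-; rewrite size_cat.
rewrite (IH (fun a b c => (-1) ^+ (size a + size b) *: F a b (x :: c))).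
apply: eq_ushsum => a b _; apply: eq_ushsum => b1 b2 _.
by rewrite scalerA -exprD.
Qed.

(** Splitting l ++ m is splitting l and m, with c and b exchanged. *)
Lemma ushsum_cat F l m : ushsum F (l ++ m) =
  ushsum (fun a b => ushsum (fun c d =>
    (-1) ^+ (size b * size c) *: F (a ++ c) (b ++ d)) m) l.
Proof.
elim: l F => [|x l IH] F.
  rewrite ushsum_nil; apply: eq_ushsum => a b _.
  by rewrite mul0n expr0 scale1r.
rewrite /= !ushsum_cons !IH; congr (_ + _); apply: eq_ushsum => a b _.
rewrite -ushsumZ; apply: eq_ushsum => c d _.
rewrite !scalerA -!exprD size_cat /= mulSn; congr (_ ^+ _ *: _).
by rewrite addnC addnA.
Qed.

End Sum.

Lemma ushsum_linear (U W : lmodType k) (f : U -> W) F l : linear f ->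
  f (ushsum F l) = ushsum (fun a b => f (F a b)) l.
Proof.
move=> fL; rewrite -[f]/(mklin fL : U -> W) ushsum.unlock linear_sum.
by apply: eq_bigr => u _; rewrite linearZ_LR.
Qed.

End UnshuffleSum.

(** * Unshuffles as shuffle permutations *)

Section ShufflePermutations.

Definition shuffle n p (s : {perm 'I_n}) : bool :=
  [forall i : 'I_n, forall j : 'I_n,
     (i < j)%N && ((j < p)%N || (p <= i)%N) ==> (s i < s j)%N].

Lemma shuffleP n p (s : {perm 'I_n}) :
  reflect (forall i j : 'I_n, (i < j)%N -> (j < p)%N || (p <= i)%N ->
             (s i < s j)%N) (shuffle p s).
Proof.
apply: (iffP forallP) => [sh i j ij jp|sh i].
  by have /forallP/(_ j) := sh i; rewrite ij jp.
by apply/forallP => j; apply/implyP => /andP[]; apply: sh.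
Qed.

Lemma shuffle1E n p (s : {perm 'I_n.+1}) :
  shuffle1 p s = shuffle p s && (s ord0 == ord0).
Proof.
congr (_ && _); apply/forallP/idP => [/(_ ord0) //|s0 i].
by apply/implyP => /eqP i0; rewrite (_ : i = ord0) //; apply/val_inj.
Qed.

(** The value 0 of a shuffle comes first in one of the two blocks, so at the
    position 0 or p; the remaining values form a shuffle. *)
Lemma shuffle_lift n p i (s : {perm 'I_n}) :
  shuffle p (lift_perm i ord0 s) =
  [&& i == 0%N :> nat, (0 < p)%N & shuffle p.-1 s] ||
  (i == p :> nat) && shuffle p s.
Proof.
set r := lift_perm i ord0 s.
have ri : r i = ord0 by apply: lift_perm_id.
have rl j : r (lift i j) = lift ord0 (s j) by apply: lift_perm_lift.
have lift_lt (a b : 'I_n) : (lift i a < lift i b)%N = (a < b)%N.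
  by rewrite /= /bump; case: (leqP i a); case: (leqP i b); lia.
have block q (iq : (i == 0%N :> nat) && (p == q.+1) || (i ==
  p :> nat) && (p == q))
    (a b : 'I_n) : (lift i b < p)%N || (p <= lift i a)%N =
      (b < q)%N || (q <= a)%N.
  by move: iq; rewrite /= /bump; case: (leqP i a); case: (leqP i b); lia.
have down q : (i == 0%N :> nat) && (p == q.+1) || (i == p :> nat) && (p == q) ->
    shuffle p r = shuffle q s.
  move=> iq; apply/shuffleP/shuffleP => sh.
    move=> a b ab abq; have := sh (lift i a) (lift i b).
    by rewrite lift_lt (block q iq) !rl ltnS; apply.
  move=> x y xy; case: (unliftP i x) => [a|] xE; case: (unliftP i y) => [b|] yE.
  - rewrite xE yE !rl (block q iq) => abq; rewrite /= /bump /= !add1n ltnS.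
    by apply: sh => //; move: xy; rewrite xE yE lift_lt.
  - by move: xy; rewrite xE yE; lia.
  - by rewrite xE yE ri rl.
  - by move: xy; rewrite xE yE ltnn.
have [i0|i_gt0] := posnP i; case: (posnP p) => [p0|p_gt0].
- by rewrite (down p) ?i0 ?p0.
- rewrite (down p.-1); last by rewrite i0 prednK ?eqxx.
  by rewrite i0 (ltn_eqF p_gt0) /= orbF.
- rewrite p0 gtn_eqF //=; apply/negP => /shuffleP sh.
  have lt : (i.-1 < n.+1)%N by rewrite (leq_ltn_trans (leq_pred i)).
  by have := sh (Ordinal lt) i; rewrite ri /= prednK // leqnn => /(_ isT isT).
have [ip|ip] := eqVneq (i : nat) p.
  by rewrite (down p) // ip !eqxx orbT.
apply/negP => /shuffleP sh.
have lt : (i.-1 < n.+1)%N by rewrite (leq_ltn_trans (leq_pred i)).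
have := sh (Ordinal lt) i; rewrite ri /= prednK // leqnn => /(_ isT).
suff -> : (i < p)%N || (p <= i.-1)%N by move/(_ isT).
by move: ip i_gt0; lia.
Qed.

Variables (T : eqType) (k : fieldType) (U : lmodType k).
Implicit Types F : seq T -> seq T -> U.

Definition split_perm F n (t : n.-tuple T) p (s : {perm 'I_n}) : U :=
  (-1) ^+ s *: F (take p (perm_seq t s)) (drop p (perm_seq t s)).

Lemma split_perm_first F n x (t : n.-tuple T) p (s : {perm 'I_n}) :
  split_perm F [tuple of x :: t] p.+1 (lift_perm ord0 ord0 s) =
  split_perm (fun a b => F (x :: a) b) t p s.
Proof. by rewrite /split_perm odd_lift_perm perm_seq_lift /insert take0
  drop0. Qed.

Lemma split_perm_second F n x (t : n.-tuple T) (i : 'I_n.+1) (s : {perm 'I_n}) :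
  split_perm F [tuple of x :: t] i (lift_perm i ord0 s) =
  split_perm (fun a b => (-1) ^+ size a *: F a (x :: b)) t i s.
Proof.
have le_i : (i <= size (perm_seq t s))%N by rewrite size_perm_seq -ltnS.
rewrite /split_perm odd_lift_perm perm_seq_lift addbF /insert.
rewrite take_size_cat ?drop_size_cat ?size_takel // scalerA.
by rewrite signr_addb signr_odd mulrC.
Qed.

(** Both sides obey the same recursion: the first letter goes to the first block
    (the terms A) or to the second one (the terms B), where it passes the whole
    first block. *)
Lemma sum_shuffle F n (t : n.-tuple T) :
  \sum_(p < n.+1) \sum_(s : {perm 'I_n} | shuffle p s) split_perm F t p s =
  ushsum F t.
Proof.
elim: n F t => [|n IH] F t.
  rewrite big_ord1 tuple0 ushsum_nil (bigD1 1%g) /=; last first.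
    by apply/shuffleP => -[].
  rewrite big1 => [|s /andP[_ /eqP[]]]; last by apply/permP; case.
  rewrite addr0 /split_perm odd_perm1 expr0 scale1r.
  by rewrite (size0nil (size_perm_seq _ _)).
case/tupleP: t => x t; rewrite ushsum_cons -!IH.
under eq_bigr => p _ do rewrite big_mkcond sum_perm_lift.
pose A (p : 'I_n.+2) (i : 'I_n.+1) := \sum_(s : {perm 'I_n})
  if [&& i == 0%N :> nat, (0 < p)%N & shuffle p.-1 s] then
    split_perm (fun a b => F (x :: a) b) t p.-1 s else 0.
pose B (p : 'I_n.+2) (i : 'I_n.+1) := \sum_(s : {perm 'I_n})
  if (i == p :> nat) && shuffle p s then
    split_perm (fun a b => (-1) ^+ size a *: F a (x :: b)) t i s else 0.
transitivity (\sum_(p < n.+2) \sum_(i < n.+1) (A p i + B p i)).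
  apply: eq_bigr => p _; apply: eq_bigr => i _; rewrite -big_split.
  apply: eq_bigr => s _ /=; rewrite shuffle_lift.
  have [ip|ip] := eqVneq (i : nat) p.
    rewrite (_ : [&& _, _ & _] = false) ?add0r /=.
      by case: ifP => // _; rewrite -ip split_perm_second.
    by rewrite ip; case: (nat_of_ord p).
  rewrite orbF addr0; case: ifP => // /and3P[/eqP i0 p0 _].
  rewrite (_ : i = ord0); last exact/val_inj.
  by rewrite -{1}(prednK p0) split_perm_first.
under eq_bigr => p _ do rewrite big_split /=.
rewrite big_split /=; congr (_ + _).
  rewrite [LHS]big_ord_recl [X in X + _]big1 ?add0r => [|i _]; last first.
    by rewrite /A big1 // => s _; rewrite andbF.
  apply: eq_bigr => p _; rewrite [LHS]big_ord_recl [X in _ + X]big1 ?addr0.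
    by rewrite /A -big_mkcond.
  by move=> i _; rewrite /A big1.
rewrite exchange_big; apply: eq_bigr => i _.
rewrite (bigD1 (widen_ord (leqnSn _) i)) //= [X in _ + X]big1 ?addr0.
  by rewrite /B -big_mkcond; apply: eq_bigl => s; rewrite eqxx.
move=> p pi; rewrite /B big1 // => s _; case: eqP => // ip.
by case/eqP: pi; apply/val_inj.
Qed.

(** The shuffles that fix 0 are those where the first letter goes to the first
    block; the condition p < n.+1 says that the second block is nonempty. *)
Lemma sum_shuffle1 F n x (t : n.-tuple T) :
  \sum_(p < n.+2 | (0 < p < n.+1)%N) \sum_(s : {perm 'I_n.+1} | shuffle1 p s)
    split_perm F [tuple of x :: t] p s =
  ushsum (fun a b => if b is [::] then 0 else F (x :: a) b) t.
Proof.
rewrite -sum_shuffle big_mkcond big_ord_recl /= add0r; apply: eq_bigr => p _.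
rewrite /= /bump /= add1n ltnS.
have sz s : (drop p (perm_seq t s) == [::]) = ~~ (p < n)%N.
  by rewrite -size_eq0 size_drop size_perm_seq subn_eq0 leqNgt.
case: ifP => pn; last first.
  rewrite big1 // => s _; rewrite /split_perm.
  have := sz s; rewrite pn /=; case: (drop _ _) => // _; exact: scaler0.
rewrite big_mkcond sum_perm_lift big_ord_recl [X in _ + X]big1 ?addr0; last first.
  move=> i _; rewrite big1 // => s _; rewrite shuffle1E.
  set r := lift_perm _ _ _; case: (r ord0 =P ord0) => [r0|]; rewrite ?andbF //.
  have ri : r (lift ord0 i) = ord0 by apply: lift_perm_id.
  by have /(congr1 val) := perm_inj (etrans ri (esym r0)).
rewrite [RHS]big_mkcond; apply: eq_bigr => s _.
rewrite shuffle1E lift_perm_id eqxx andbT shuffle_lift eqxx /= orbF.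
case: ifP => // _; rewrite split_perm_first /split_perm.
by have := sz s; rewrite pn; case: (drop _ _).
Qed.

End ShufflePermutations.

(** * Rack homology of an abelian group *)

Section AbelianRackChains.
Variables (k : fieldType) (G : zmodType).
Local Notation X := (conj_rack G).

Lemma CR_ind n (P : CR k X n -> Prop) : subspace P ->
  (forall t, P (CR_word k t)) -> forall a, P a.
Proof.
move=> PS Pt; apply: quo_ind; apply: malg_ind => [|t]; last exact: Pt.
exact: (subspace_preim (linearP quo_pi)).
Qed.

Lemma rack_d_abelian n (a : CR k X n) : rack_d k X n a = 0.
Proof.
move: a; apply: CR_ind => [|t]; first by apply: subspace_eq; lin.
rewrite /rack_d CR_liftE /rack_bnd big1 // => i _.
suff -> : face1 t i = face0 t i by rewrite subrr scaler0.
by apply/eq_from_tnth => j; rewrite !tnth_mktuple [rack_op _ _]conj_opE if_same.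
Qed.

Definition rack_class n (a : CR k X n) : HR k X n :=
  cls (rack_d k X n.+1) (rack_d_abelian a).

Lemma rack_class_represents n (a : CR k X n) : HR_represents a (rack_class a).
Proof. exact: cls_represents. Qed.

Lemma rack_class_linear n : linear (@rack_class n).
Proof.
move=> c a b; apply: represents_boundary (rack_class_represents _) _.
by apply: represents_linear; apply: rack_class_represents.
Qed.
HB.instance Definition _ n :=
  GRing.isLinear.Build k (CR k X n) (HR k X n) *:%R (@rack_class n)
    (@rack_class_linear n).

Fact chain_rel n (u : CR k X n.+1) :
  idfun (rack_d k X n.+1 u) = 0 :> CR k X n.
Proof. exact: (rack_d_abelian u). Qed.

(** The inverse of rack_class: a class has only one representative, as there are
    no boundaries. *)
Definition chain n : {linear HR k X n -> CR k X n} :=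
  homology_lift (rack_d k X n) (@chain_rel n).

Lemma chainE n (a : CR k X n) x : HR_represents a x -> chain n x = a.
Proof. exact: homology_liftE. Qed.

Lemma rack_classK n (a : CR k X n) : chain n (rack_class a) = a.
Proof. exact/chainE/rack_class_represents. Qed.

Lemma rack_class_eq n (a : CR k X n) x : HR_represents a x -> x = rack_class a.
Proof. by move=> ax; apply: represents_boundary ax (rack_class_represents a). Qed.

Lemma chainK n (x : HR k X n) : rack_class (chain n x) = x.
Proof.
move: x; apply: represents_ind => z zZ.
have zx := cls_represents (rack_d k X n.+1) zZ.
by rewrite (chainE zx) (rack_class_eq zx).
Qed.

Lemma HR_ind n (P : HR k X n -> Prop) : subspace P ->
  (forall t, P (rack_class (CR_word k t))) -> forall x, P x.
Proof.
move=> PS Pt x; rewrite -[x]chainK; move: (chain n x); apply: CR_ind => //.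
exact: (subspace_preim (@rack_class_linear n) PS).
Qed.

End AbelianRackChains.

(** The class of a word in the reduced homology, zero for the empty word, and
    in the augmented one, where the empty word is the unit. *)
HB.lock Definition word_class (k : fieldType) (G : zmodType) (s : seq
  (conj_rack G)) :
    dsum (HRbar k (conj_rack G)) :=
  if s is x :: s' then
    dinj (rack_class (CR_word k (in_tuple (x :: s'))) :
            HRbar k (conj_rack G) (size s').+1)
  else 0.

Section AbelianRackHomology.
Variables (k : fieldType) (G : zmodType).
Local Notation X := (conj_rack G).
Local Notation C := (dsum (HRbar k X)).
Local Notation H := (augment (HRbar k X)).
Local Notation word_class := (@word_class k G).

Lemma word_class_nil : word_class [::] = 0. Proof.
  by rewrite word_class.unlock. Qed.

Lemma word_class_cons x s : word_class (x :: s) =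
  dinj (rack_class (CR_word k (in_tuple (x :: s))) : HRbar k X (size s).+1).
Proof. by rewrite word_class.unlock. Qed.

Definition aug_word (s : seq X) : H :=
  if s is [::] then aug_unit _ else (word_class s, 0).

Lemma word_class_tuple n (t : n.+1.-tuple X) :
  dinj (rack_class (CR_word k t) : HRbar k X n.+1) = word_class t.
Proof.
case: t => -[|x s] sz //; have sn : size s = n by apply: succn_inj; apply/eqP.
case: n / sn sz => sz; rewrite word_class_cons;
  congr (dinj (rack_class (CR_word k _) : HRbar k X _.+1)).
exact: val_inj.
Qed.

Lemma word_class0 (s : seq X) : (0 : G) \in (s : seq G) -> word_class s = 0.
Proof.
case: s => [|x s] s0; first exact: word_class_nil.
rewrite word_class_cons CR_word0 // linear0; exact: dinj0.
Qed.

Lemma aug_word0 (s : seq X) : (0 : G) \in (s : seq G) -> aug_word s = 0.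
Proof. by case: s => // x s s0; rewrite /aug_word word_class0. Qed.

Lemma aug_word_incl x s : aug_word (x :: s) = aug_incl (word_class (x :: s)).
Proof. by []. Qed.

Lemma aug_incl_linear : linear (@aug_incl k (HRbar k X)).
Proof. by move=> a x y; rewrite /aug_incl -[RHS]/(_, _) /= scaler0 addr0. Qed.

Lemma dsum_decomp (V : nat -> lmodType k) (x : dsum V) :
  exists N, x = \sum_(n < N) dinj (component x n).
Proof.
have [N xN] := dsum_bound_subproof x; exists N.
have -> : \sum_(n < N) dinj (component x n) = dlift (@dinj k V) x.
  by rewrite (dliftEw (@dinj_linear k V) xN).
apply: dsum_ext => m; rewrite (dliftEw (@dinj_linear k V) (N := maxn N m.+1)).
  have mN : (m < maxn N m.+1)%N by rewrite leq_max ltnSn orbT.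
  pose comp (y : dsum V) := component y m.
  have compL : linear comp by move=> a u v; rewrite /comp componentP.
  rewrite -[RHS]/(mklin compL _) linear_sum (bigD1 (Ordinal mN)) //.
  rewrite mklinE /comp component_dinj big1 => [|i /eqP im].
    exact: (esym (addr0 _)).
  rewrite mklinE /comp component_dinj_neq //.
  by apply/eqP => ij; apply/im/val_inj.
by move=> n; rewrite geq_max => /andP[/xN].
Qed.

Lemma dsum_ind (V : nat -> lmodType k) (P : dsum V -> Prop) : subspace P ->
  (forall n (v : V n), P (dinj v)) -> forall x, P x.
Proof.
move=> PS Pv x; have [N ->] := dsum_decomp x.
by apply: subspace_sum => // i _; apply: Pv.
Qed.

Lemma C_ind (P : C -> Prop) : subspace P ->
  (forall s, P (word_class s)) -> forall x, P x.
Proof.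
move=> PS Pw; apply: dsum_ind => // -[|n] v.
  by rewrite (_ : v = 0) ?dinj0; [exact: PS.1 | apply/matrixP => i []].
move: (v : HR k X n.+1); apply: HR_ind => [|t]; last by rewrite word_class_tuple.
exact: (subspace_preim (@dinj_linear _ (HRbar k X) n.+1) PS).
Qed.

Lemma H_ind (P : H -> Prop) : subspace P ->
  (forall s, P (aug_word s)) -> forall x, P x.
Proof.
move=> PS Pw [c a]; have -> : (c, a) = a *: aug_word [::] + aug_incl c :> H.
  by rewrite /aug_incl -[RHS]/(_, _) /= scaler0 add0r addr0 [a *: _]mulr1.
apply: PS.2; first exact: Pw.
move: c; apply: C_ind => [|[|x s]]; last exact: (Pw (x :: s)).
  exact: (subspace_preim aug_incl_linear PS).
by rewrite word_class_nil (lin0 aug_incl_linear); apply: PS.1.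
Qed.

Section Lift.
Variables (U : lmodType k) (f : seq X -> U).

Let f' (s : seq X) : U := if (0 : G) \in (s : seq G) then 0 else f s.

Fact reduced_word n (t : n.-tuple X) : rack_pt X \in t -> f' t = 0.
Proof. by rewrite /f' => t0; rewrite ifT. Qed.

(** The linear map given on words by f, when f vanishes on the words with a zero
    letter; f' enforces this condition. *)
Definition C_lift : C -> U :=
  dlift (fun n => if n is m.+1 return HRbar k X n -> U
    then fun x : HR k X m.+1 => CR_lift (@reduced_word m.+1) (chain k G m.+1 x)
    else fun=> 0).

Lemma C_lift_linear : linear C_lift.
Proof.
apply: dlift_linear => -[|n]; first by move=> a x y; rewrite scaler0 addr0.
exact: (linear_comp (linearP _) (linearP _)).
Qed.

Definition H_lift (h : H) : U := C_lift h.1 + h.2 *: f [::].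

Lemma H_lift_linear : linear H_lift.
Proof.
move=> a u v; rewrite /H_lift /= C_lift_linear scalerDl !scalerDr scalerA.
exact: addrACA.
Qed.

Hypothesis f0 : forall s : seq X, (0 : G) \in (s : seq G) -> f s = 0.

Lemma C_liftE x s : C_lift (word_class (x :: s)) = f (x :: s).
Proof.
rewrite /C_lift word_class_cons dlift_dinj => [|[|n]]; last 2 first.
- by move=> a u v; rewrite scaler0 addr0.
- exact: (linear_comp (linearP _) (linearP _)).
by rewrite rack_classK CR_liftE /f'; case: ifP => // /f0.
Qed.

Lemma H_liftE s : H_lift (aug_word s) = f s.
Proof.
case: s => [|x s]; rewrite /H_lift /=.
  by rewrite (lin0 C_lift_linear) add0r scale1r.
by rewrite C_liftE scale0r addr0.
Qed.

End Lift.
End AbelianRackHomology.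

(** * Linearity of the tensor operations *)

Section TensorLinear.
Variable k : fieldType.

Lemma bilinZ (V W U : lmodType k) (f : V -> W -> U) : bilin f ->
  forall a v w, f (a *: v) w = a *: f v w /\ f v (a *: w) = a *: f v w.
Proof.
move=> [fl fr] a v w; have l0 := lin0 (fl w); have r0 := lin0 (fr v).
split; [have := fl w a v 0 | have := fr v a w 0].
  by rewrite addr0 l0 addr0.
by rewrite addr0 r0 addr0.
Qed.

Lemma pure_linl (V W : lmodType k) (w : W) : linear (fun v : V => v ⊗ w).
Proof. exact: (pure_bilin V W).1. Qed.
Lemma pure_linr (V W : lmodType k) (v : V) : linear (fun w : W => v ⊗ w).
Proof. exact: (pure_bilin V W).2. Qed.

Lemma tens_mapE (V V' W W' : lmodType k) (f : V -> V') (g : W -> W') v w :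
  linear f -> linear g -> tens_map f g (v ⊗ w) = f v ⊗ g w.
Proof. by move=> fL gL; rewrite /tens_map tens_liftE //;
  apply: tens_map_bilin.
Qed.

Lemma tens_map_linear (V V' W W' : lmodType k) (f : V -> V') (g : W -> W') :
  linear f -> linear g -> linear (tens_map f g).
Proof. by move=> fL gL; apply/tens_lift_linear/tens_map_bilin. Qed.

Lemma assoc_inner_bilin (U V W : lmodType k) (w : W) :
  bilin (fun (u : U) (v : V) => u ⊗ (v ⊗ w)).
Proof.
split=> [v|u]; first exact: pure_linl.
exact: (linear_comp (pure_linr _) (pure_linl _)).
Qed.

(** The vectors at which a family of linear maps depends linearly on its
    parameter form a subspace, so it suffices to test generators. *)
Lemma linear_param (U V W : lmodType k) (f : W -> V -> U) :
  (forall w, linear (f w)) -> subspace (fun v => linear (fun w => f w v)).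
Proof.
move=> fL; split=> [a w w'|b s t sL tL a w w'].
  by rewrite !(lin0 (fL _)) scaler0 addr0.
by rewrite !fL sL tL !scalerDr !scalerA mulrC addrACA.
Qed.

Lemma assoc_bilin (U V W : lmodType k) :
  bilin (fun (t : tens U V) (w : W) =>
           tens_lift (fun u v => u ⊗ (v ⊗ w)) t).
Proof.
have L (w : W) := tens_lift_linear (assoc_inner_bilin U V w).
split=> [w|t]; first exact: L.
move: t; apply: tens_ind => [|u v a w w']; first exact: linear_param.
have E (z : W) : tens_lift (fun u v => u ⊗ (v ⊗ z)) (u ⊗ v) = u ⊗ (v ⊗ z).
  exact: (tens_liftE (assoc_inner_bilin U V z)).
apply: (etrans (E _)); apply: (etrans (linear_comp (pure_linr u) (pure_linr v)
  a w w')).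
exact: (esym (congr2 (fun x y => a *: x + y) (E w) (E w'))).
Qed.

Lemma tens_assoc_linear (U V W : lmodType k) : linear (@tens_assoc k U V W).
Proof. exact/tens_lift_linear/assoc_bilin. Qed.

Lemma tens_assocE (U V W : lmodType k) (u : U) (v : V) (w : W) :
  tens_assoc (u ⊗ v ⊗ w) = u ⊗ (v ⊗ w).
Proof.
rewrite /tens_assoc tens_liftE; last exact: assoc_bilin.
by rewrite tens_liftE //; apply: assoc_inner_bilin.
Qed.

Lemma aug_lift_linear (V : nat -> lmodType k) (U : lmodType k)
    (f : nat -> augment V -> U) :
  (forall n, linear (f n)) -> linear (aug_lift f).
Proof.
move=> fL a [x c] [y d]; rewrite /aug_lift /=.
rewrite dlift_linear; last first.
  move=> n b u v; rewrite -fL; congr (f n _).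
  by rewrite dinj_linear -[RHS]/(_, _) /= scaler0 addr0.
have E : (0, a *: c + d) = a *: (0, c) + (0, d) :> augment V.
  by rewrite -[RHS]/(_, _) /= scaler0 addr0.
rewrite [X in f 0%N X]E fL !scalerDr.
exact: addrACA.
Qed.

Lemma aug_lift_fun_linear (V : nat -> lmodType k) (U : lmodType k)
    (f g h : nat -> augment V -> U) a x :
  (forall n v, f n v = a *: g n v + h n v) ->
  aug_lift f x = a *: aug_lift g x + aug_lift h x.
Proof.
move=> fgh; rewrite /aug_lift fgh scalerDr addrACA; congr (_ + _).
exact: dlift_fun_linear.
Qed.

Lemma twist_linear (V : nat -> lmodType k) : linear (@twist k V).
Proof.
apply: tens_lift_linear; split=> [b|a].
- apply: dlift_linear => m c x y; apply: dlift_fun_linear => n b'.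
  by rewrite dinj_linear pure_linr scalerDr !scalerA [c * _]mulrC.
- move=> c x y; apply: dlift_fun_linear => m a'.
  apply: dlift_linear => n d u v.
  by rewrite dinj_linear pure_linl scalerDr !scalerA [d * _]mulrC.
Qed.

End TensorLinear.

Section StarTensor.
Variables (k : fieldType) (C : nat -> lmodType k).
Local Notation H := (augment C).
Variable star : H -> H -> H.
Hypothesis star_bilin : bilin star.

(** The product star_tens is a universal lift in two tensors, meaningful once it
    is known to be linear in all four entries; star4 is its value on pure
    tensors, and star3 its value when only the first tensor is pure. *)
Definition star4 (a b c d : H) : tens H H :=
  aug_lift (fun m b' => aug_lift (fun n c' =>
    (-1) ^+ (m * n) *: (star a c' ⊗ star b' d)) c) b.

Lemma star4_lin4 a b c : linear (star4 a b c).
Proof.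
move=> e d d'; apply: aug_lift_fun_linear => m b'.
apply: aug_lift_fun_linear => n c'.
exact: (linear_scale _ (linear_comp (pure_linr _) (star_bilin.2 b'))).
Qed.

Lemma star4_inner m a b' d :
  linear (fun c => aug_lift (fun n c' =>
    (-1) ^+ (m * n) *: (star a c' ⊗ star b' d)) c).
Proof.
apply: aug_lift_linear => n.
exact: (linear_scale _ (linear_comp (pure_linl _) (star_bilin.2 a))).
Qed.

Lemma star4_lin3 a b d : linear (fun c => star4 a b c d).
Proof.
by move=> e c c'; apply: aug_lift_fun_linear => m b'; apply: star4_inner.
Qed.

Lemma star4_outer a c d m :
  linear (fun b' => aug_lift (fun n c' =>
    (-1) ^+ (m * n) *: (star a c' ⊗ star b' d)) c).
Proof.
move=> e b b'; apply: aug_lift_fun_linear => n c'.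
exact: (linear_scale _ (linear_comp (pure_linr _) (star_bilin.1 d))).
Qed.

Lemma star4_lin2 a c d : linear (fun b => star4 a b c d).
Proof. by apply: aug_lift_linear => m; apply: star4_outer. Qed.

Lemma star4_lin1 b c d : linear (fun a => star4 a b c d).
Proof.
move=> e a a'; apply: aug_lift_fun_linear => m b'.
apply: aug_lift_fun_linear => n c'.
exact: (linear_scale _ (linear_comp (pure_linl _) (star_bilin.1 c'))).
Qed.

Lemma star4_bilin a b : bilin (star4 a b).
Proof. by split=> [d|c]; [apply: star4_lin3 | apply: star4_lin4]. Qed.

Definition star3 (a b : H) (u : tens H H) : tens H H := tens_lift (star4 a b) u.

Lemma star3_linear a b : linear (star3 a b).
Proof. exact: (tens_lift_linear (star4_bilin a b)). Qed.

Lemma star3E a b c d : star3 a b (c ⊗ d) = star4 a b c d.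
Proof. exact: (tens_liftE (star4_bilin a b)). Qed.

Lemma star3_bilin u : bilin (fun a b => star3 a b u).
Proof.
split=> [b|a]; move: u; apply: tens_ind.
- exact: (linear_param (fun a => star3_linear a b)).
- move=> c d e a a'; apply: (etrans (star3E _ _ _ _)).
  apply: (etrans (star4_lin1 _ _ _ e a a')).
  exact: (esym (congr2 (fun x y => e *: x + y) (star3E _ _ _ _) (star3E _ _
    _ _))).
- exact: (linear_param (star3_linear a)).
- move=> c d e b b'; apply: (etrans (star3E _ _ _ _)).
  apply: (etrans (star4_lin2 _ _ _ e b b')).
  exact: (esym (congr2 (fun x y => e *: x + y) (star3E _ _ _ _) (star3E _ _
    _ _))).
Qed.

Lemma star_tens_linl u : linear (fun t => star_tens star t u).
Proof. exact: (tens_lift_linear (star3_bilin u)). Qed.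

Lemma star_tensE3 a b u : star_tens star (a ⊗ b) u = star3 a b u.
Proof. exact: (tens_liftE (star3_bilin u)). Qed.

Lemma star_tens_linr t : linear (star_tens star t).
Proof.
move: t; apply: tens_ind; first exact: (linear_param star_tens_linl).
move=> a b e u u'; apply: (etrans (star_tensE3 _ _ _)).
apply: (etrans (star3_linear _ _ e u u')).
exact: (esym (congr2 (fun x y => e *: x + y) (star_tensE3 _ _ _) (star_tensE3
  _ _ _))).
Qed.

Lemma star_tensE a b c d : star_tens star (a ⊗ b) (c ⊗ d) = star4 a b c d.
Proof. exact: (etrans (star_tensE3 _ _ _) (star3E _ _ _ _)). Qed.

End StarTensor.

(** * The reduced coproduct *)

Section TensorAlgebraStructure.
Variables (k : fieldType) (G : zmodType).
Local Notation X := (conj_rack G).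
Local Notation C := (dsum (HRbar k X)).
Local Notation H := (augment (HRbar k X)).
Local Notation word_class := (@word_class k G).
Local Notation aug_word := (@aug_word k G).
Local Notation unit := (aug_unit (HRbar k X)).
Local Notation twL := (@twist_linear k (HRbar k X)).

Lemma perm_cat_mem0 (a b l : seq X) : perm_eq (a ++ b) l ->
  (0 : G) \in (l : seq G) -> (0 : G) \in (a : seq G) \/ (0 : G) \in (b : seq G).
Proof.
move=> /perm_mem abl l0; apply/orP; rewrite -mem_cat.
by have := abl (0 : G) => ->.
Qed.

(** The first letter stays on the left. The term with an empty right factor
    contributes 0, since word_class is 0 on the empty word. *)
Definition word_coproduct (s : seq X) : tens C C :=
  if s is x :: l then ushsum (fun a b => word_class (x :: a) ⊗ word_class b) l
    else 0.

Lemma word_coproduct0 (s : seq X) :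
  (0 : G) \in (s : seq G) -> word_coproduct s = 0.
Proof.
case: s => // x l; rewrite inE => /orP[/eqP x0|l0]; apply: ushsum0 => a b ab.
  by rewrite word_class0 ?pure0l // inE x0 eqxx.
case: (perm_cat_mem0 ab l0) => s0.
  by rewrite word_class0 ?pure0l // inE s0 orbT.
by rewrite (word_class0 _ s0) pure0r.
Qed.

End TensorAlgebraStructure.

HB.lock Definition HR_coproduct (k : fieldType) (G : zmodType)
    (x : dsum (HRbar k (conj_rack G))) :
    tens (dsum (HRbar k (conj_rack G))) (dsum (HRbar k (conj_rack G))) :=
  C_lift (@word_coproduct k G) x.

Section ReducedCoproduct.
Variables (k : fieldType) (G : zmodType).
Local Notation X := (conj_rack G).
Local Notation C := (dsum (HRbar k X)).
Local Notation H := (augment (HRbar k X)).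
Local Notation word_class := (@word_class k G).
Local Notation aug_word := (@aug_word k G).
Local Notation unit := (aug_unit (HRbar k X)).
Local Notation twL := (@twist_linear k (HRbar k X)).
Local Notation D := (@HR_coproduct k G).

Lemma HR_coproduct_linear : linear D.
Proof. by rewrite HR_coproduct.unlock; apply: C_lift_linear. Qed.

Lemma HR_coproduct_word x l :
  D (word_class (x :: l)) =
  ushsum (fun a b => word_class (x :: a) ⊗ word_class b) l.
Proof. by rewrite HR_coproduct.unlock;
  exact: (C_liftE (@word_coproduct0 k G)).
Qed.

Lemma twist_word_class a b :
  twist (word_class a ⊗ word_class b) =
  (-1) ^+ (size a * size b) *: (word_class b ⊗ word_class a).
Proof.
case: a => [|x a]; first by rewrite word_class_nil pure0l pure0r (lin0 twL)
  scaler0.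
case: b => [|y b]; first by rewrite word_class_nil pure0l pure0r (lin0 twL)
  scaler0.
rewrite !word_class_cons; exact: twistE.
Qed.

(** The twist exchanges the unshuffles that keep the first letter on the left
    with those that send it to the right. *)
Lemma HR_coproduct_symm l :
  D (word_class l) + twist (D (word_class l)) =
    ushsum (fun a b => word_class a ⊗ word_class b) l.
Proof.
case: l => [|x l].
  by rewrite ushsum_nil word_class_nil (lin0 HR_coproduct_linear) (lin0 twL)
    addr0 pure0l.
have tE : twist (ushsum (fun a b => word_class (x :: a) ⊗ word_class b) l) =
    ushsum (fun a b => (-1) ^+ size a *: (word_class a ⊗ word_class (x :: b))) l.
  apply: (etrans (ushsum_linear _ _ twL)); rewrite [RHS]ushsum_comm.
  apply: eq_ushsum => a b _; rewrite (twist_word_class (x :: a) b) scalerA -exprD.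
  by rewrite /= mulSn addnC.
by rewrite HR_coproduct_word [RHS]ushsum_cons tE.
Qed.

Let idL : linear (fun x : C => x). Proof. by move=> a x y. Qed.
Let DtwL : linear (fun x => twist (D x)) := linear_comp twL HR_coproduct_linear.

(** The second factor is split by D and its twist, hence by all unshuffles, and
    the relation becomes ushsum_assoc on the letters after the first one. *)
Lemma coproduct_relation x :
  tens_assoc (tens_map D id (D x)) =
  tens_map id D (D x) + tens_map id (@twist _ _ \o D) (D x).
Proof.
have aL := @tens_assoc_linear k C C C.
have Dl := tens_map_linear HR_coproduct_linear idL.
have Dr := tens_map_linear idL HR_coproduct_linear.
have Tr := tens_map_linear idL DtwL.
move: x; apply: C_ind => [|[|x l]].
- apply: subspace_eq; first exact: (linear_comp aL (linear_comp Dl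
  HR_coproduct_linear)).
  exact: (linear_add (linear_comp Dr HR_coproduct_linear) (linear_comp Tr
    HR_coproduct_linear)).
- by rewrite word_class_nil (lin0 HR_coproduct_linear) (lin0 Dl) (lin0 aL)
  (lin0 Dr) (lin0 Tr) addr0.
rewrite HR_coproduct_word.
transitivity (ushsum (fun a b => ushsum (fun a1 a2 =>
    word_class (x :: a1) ⊗ (word_class a2 ⊗ word_class b)) a) l).
  apply: (etrans (ushsum_linear _ _ (linear_comp aL Dl))).
  apply: eq_ushsum => a b _.
  rewrite (tens_mapE _ _ HR_coproduct_linear idL) HR_coproduct_word.
  apply: (etrans (ushsum_linear _ _ (linear_comp aL (pure_linl (word_class b))))).
  apply: eq_ushsum => a1 a2 _; exact: tens_assocE.
rewrite (ushsum_assoc (fun a b c => word_class (x :: a) ⊗ (word_class b ⊗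
  word_class c))).
apply/esym.
apply: (etrans (ushsum_linear _ _ (linear_add Dr Tr))).
apply: eq_ushsum => a b _.
rewrite (tens_mapE _ _ idL HR_coproduct_linear) (tens_mapE _ _ idL DtwL).
transitivity (word_class (x :: a) ⊗ (D (word_class b) +
  twist (D (word_class b)))).
  have := pure_linr (word_class (x :: a)) 1 (D (word_class b)) (twist (D
    (word_class b))).
  by rewrite !scale1r.
rewrite HR_coproduct_symm; exact: (ushsum_linear _ _ (pure_linr _)).
Qed.

End ReducedCoproduct.

(** * The bialgebra of words *)

Section BialgebraStructure.
Variables (k : fieldType) (G : zmodType).
Local Notation X := (conj_rack G).
Local Notation C := (dsum (HRbar k X)).
Local Notation H := (augment (HRbar k X)).
Local Notation word_class := (@word_class k G).
Local Notation aug_word := (@aug_word k G).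
Local Notation unit := (aug_unit (HRbar k X)).
Local Notation incl := (@aug_incl k (HRbar k X)).
Local Notation twL := (@twist_linear k (HRbar k X)).
Local Notation D := (@HR_coproduct k G).

Lemma HR_coproduct_graded n (x : HRbar k X n) :
  D (dinj x) \in span (tens_homogeneous (C := HRbar k X) n).
Proof.
case: n x => [|n] x.
  rewrite (_ : x = 0) ?dinj0 ?(lin0 (@HR_coproduct_linear k G)) ?rpred0 //.
  by apply/matrixP => i [].
move: (x : HR k X n.+1); apply: HR_ind => [|t].
  exact: (subspace_preim (linear_comp (@HR_coproduct_linear k G)
    (@dinj_linear _ (HRbar k X) n.+1)) (subspace_span _)).
rewrite word_class_tuple; case: t => -[|y l] //= sz;
  rewrite HR_coproduct_word ushsum.unlock.
rewrite big_seq; apply: rpred_sum => u ul; apply: rpredZ.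
have /perm_size := unshuffles_perm ul; rewrite size_cat.
case: u.2.2 => [|z b] sl; first by rewrite word_class_nil pure0r rpred0.
rewrite !word_class_cons; apply: mem_span; apply: TensHomogeneous.
by rewrite addSn sl; apply/eqP.
Qed.

Lemma coradical_subspace r : subspace (coradical D r).
Proof.
case: r => [|r] /=.
  split=> [|a u v Du Dv]; first exact: (lin0 (@HR_coproduct_linear k G)).
  by rewrite (@HR_coproduct_linear k G) Du Dv scaler0 addr0.
exact: (subspace_preim (@HR_coproduct_linear k G) (subspace_span _)).
Qed.

(** Both factors in a splitting with nonempty right factor are shorter than the
    word, since the left one contains the first letter. *)
Lemma coradical_word r s : (size s <= r.+1)%N -> coradical D r (word_class s).
Proof.
elim: r s => [|r IH] [|x l] sr /=; rewrite ?word_class_nil ?(lin0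
  (@HR_coproduct_linear k G)) ?rpred0 //.
  by case: l sr => // _; rewrite HR_coproduct_word ushsum_nil word_class_nil
    pure0r.
rewrite HR_coproduct_word ushsum.unlock big_seq; apply: rpred_sum => u ul;
  apply: rpredZ.
have /perm_size := unshuffles_perm ul; rewrite size_cat => sl.
case bE: u.2.2 sl => [|z b] sl; first by rewrite word_class_nil pure0r rpred0.
rewrite /= ltnS in sr.
apply: mem_span; exists (word_class (x :: u.2.1)), (word_class (z :: b));
  split=> //; apply: IH.
  by apply: leq_trans sr; rewrite /= -sl /= addnS ltnS leq_addr.
by apply: (leq_trans _ sr); rewrite -sl leq_addl.
Qed.

Lemma coradical_mono r s x : (r <= s)%N -> coradical D r x -> coradical D s x.
Proof.
elim: r s x => [|r IH] [|s] x //= rs; first by move=> ->; apply: rpred0.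
apply: span_sub => _ [a [b [ra rb ->]]]; apply: mem_span.
by exists a, b; split=> //; apply: IH.
Qed.

Lemma HR_connected : connected D.
Proof.
apply: C_ind => [|s]; last by exists (size s); apply: coradical_word.
split=> [|a u v [r ru] [s sv]]; first by exists 0%N;
  apply: (coradical_subspace 0).1.
exists (maxn r s); apply: (coradical_subspace _).2.
  exact: coradical_mono (leq_maxl _ _) ru.
exact: coradical_mono (leq_maxr _ _) sv.
Qed.

(** The bilinear extension of concatenation. *)
Definition HR_star (x y : H) : H :=
  H_lift (fun s => H_lift (fun t => aug_word (s ++ t)) y) x.

Lemma HR_star_linl y : linear (HR_star^~ y).
Proof. exact: H_lift_linear. Qed.

Lemma aug_word_cat0l (s t : seq X) : (0 : G) \in (s : seq G) ->
  aug_word (s ++ t) = 0.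
Proof. by move=> s0; apply: aug_word0; rewrite mem_cat s0. Qed.
Lemma aug_word_cat0r (s t : seq X) : (0 : G) \in (t : seq G) ->
  aug_word (s ++ t) = 0.
Proof. by move=> t0; apply: aug_word0; rewrite mem_cat t0 orbT. Qed.

Lemma HR_star_wordl s y : HR_star (aug_word s) y =
  H_lift (fun t => aug_word (s ++ t)) y.
Proof.
apply: (H_liftE (f := fun s => H_lift (fun t => aug_word (s ++ t)) y)) => {}s s0.
have fL := H_lift_linear (fun t => aug_word (s ++ t)).
move: y; apply: H_ind => [|t].
  by apply: (subspace_eq fL) => a u v; rewrite scaler0 addr0.
by rewrite (H_liftE (fun t => aug_word_cat0r s (t := t))) aug_word_cat0l.
Qed.

Lemma HR_star_word s t : HR_star (aug_word s) (aug_word t) = aug_word (s ++ t).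
Proof.
by rewrite HR_star_wordl (H_liftE (fun t => aug_word_cat0r s (t := t))).
Qed.

Lemma HR_star_bilin : bilin HR_star.
Proof.
split=> [|x]; first exact: HR_star_linl.
move: x; apply: H_ind; first exact: (linear_param HR_star_linl).
move=> s a y z; rewrite !HR_star_wordl; exact: H_lift_linear.
Qed.

Let SL := HR_star_bilin.1.
Let SR := HR_star_bilin.2.

Lemma HR_star_assoc : associative HR_star.
Proof.
move=> x y z; move: x; apply: H_ind => [|s].
  exact: (subspace_eq (SL _) (linear_comp (SL z) (SL y))).
move: y; apply: H_ind => [|t].
  exact: (subspace_eq (linear_comp (SR _) (SL z)) (linear_comp (SL z) (SR _))).
move: z; apply: H_ind => [|u].
  exact: (subspace_eq (linear_comp (SR _) (SR _)) (SR _)).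
by rewrite !HR_star_word catA.
Qed.

Let idL : linear (fun x : H => x). Proof. by move=> a x y. Qed.

Lemma HR_star_1l : left_id unit HR_star.
Proof.
apply: H_ind => [|s]; first exact: (subspace_eq (SR _) idL).
exact: (HR_star_word [::] s).
Qed.

Lemma HR_star_1r : right_id unit HR_star.
Proof.
apply: H_ind => [|s]; first exact: (subspace_eq (SL _) idL).
by rewrite -[unit]/(aug_word [::]) HR_star_word cats0.
Qed.

Lemma HR_star_ideal (x : C) (y : H) : (HR_star (incl x) y).2 = 0.
Proof.
have sndL : linear (fun h : H => h.2 : k^o) by move=> a u v.
have zL (V : lmodType k) : linear (fun _ : V => 0 : k^o).
  by move=> a u v; rewrite scaler0 addr0.
move: x; apply: C_ind => [|[|x s]].
- apply: (subspace_eq (f := fun x => (HR_star (incl x) y).2 : k^o)) (zL _).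
  exact: (linear_comp sndL (linear_comp (SL y) (@aug_incl_linear k G))).
- by rewrite word_class_nil (lin0 (@aug_incl_linear k G)) (lin0 (SL y)).
move: y; apply: H_ind => [|t]; last by rewrite -aug_word_incl HR_star_word.
apply: (subspace_eq (f := fun y => (HR_star (incl (word_class (x :: s))) y).2
  : k^o)) (zL _).
exact: (linear_comp sndL (SR _)).
Qed.

Lemma homogeneous_words n (x : H) : aug_homogeneous n x ->
  x \in span (fun h => exists2 s, size s = n & h = aug_word s).
Proof.
case: x => c a [/= cn an].
have cE : c = dinj (component c n).
  apply: dsum_ext => m; have [<-|nm] := eqVneq n m;
    first by rewrite component_dinj.
  by rewrite component_dinj_neq // cn // eq_sym.
case: n cn an cE => [|n] cn an cE.
  rewrite (_ : (c, a) = a *: aug_word [::]).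
    by apply/rpredZ/mem_span; exists [::].
  rewrite {}cE (_ : component c 0 = 0) ?dinj0; last by apply/matrixP => i [].
  by rewrite -[RHS]/(_, _) /= scaler0 [a *: _]mulr1.
rewrite an // cE -[(_, _)]/(incl _); move: (component c n.+1 : HR k X n.+1).
apply: HR_ind => [|t].
  exact: (subspace_preim (linear_comp (@aug_incl_linear k G)
    (@dinj_linear _ (HRbar k X) n.+1)) (subspace_span _)).
rewrite word_class_tuple; apply: mem_span; exists t; first exact: size_tuple.
by case: t => -[].
Qed.

Lemma aug_homogeneous_subspace n : subspace (@aug_homogeneous k (HRbar k X) n).
Proof.
split=> [|a [u c] [v d] [/= un cn] [/= vn dn]]; first by split.
split=> /= [m mn|n0]; last by rewrite cn // dn // scaler0 addr0.
by apply: etrans (componentP a u v m) _; rewrite un // vn // scaler0 addr0.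
Qed.

Lemma aug_homogeneous_word s : aug_homogeneous (size s) (aug_word s).
Proof.
case: s => [|x s]; split=> //= m mn; rewrite word_class_cons
  component_dinj_neq //.
by rewrite eq_sym.
Qed.

Lemma HR_star_graded m n (x y : H) : aug_homogeneous m x ->
  aug_homogeneous n y -> aug_homogeneous (m + n) (HR_star x y).
Proof.
move=> /homogeneous_words xm /homogeneous_words yn.
have PS := aug_homogeneous_subspace (m + n).
move: xm; apply: (span_ind (P := fun x => aug_homogeneous (m + n) (HR_star x y))).
  exact: (subspace_preim (SL y) PS).
move=> _ [s <- ->]; move: yn.
apply: (span_ind (P := fun y =>
  aug_homogeneous (size s + n) (HR_star (aug_word s) y))).
  exact: (subspace_preim (SR _) (aug_homogeneous_subspace _)).
move=> _ [t <- ->]; rewrite HR_star_word; have := aug_homogeneous_word (s ++ t).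
by rewrite size_cat.
Qed.

End BialgebraStructure.

(** * The semi-Hopf relation *)

Section SemiHopf.
Variables (k : fieldType) (G : zmodType).
Local Notation X := (conj_rack G).
Local Notation C := (dsum (HRbar k X)).
Local Notation H := (augment (HRbar k X)).
Local Notation word_class := (@word_class k G).
Local Notation aug_word := (@aug_word k G).
Local Notation unit := (aug_unit (HRbar k X)).
Local Notation incl := (@aug_incl k (HRbar k X)).
Local Notation inclL := (@aug_incl_linear k G).
Local Notation twL := (@twist_linear k (HRbar k X)).
Local Notation DL := (@HR_coproduct_linear k G).
Local Notation D := (@HR_coproduct k G).
Local Notation star := (@HR_star k G).

Let ttL : linear (tens_map incl incl) := tens_map_linear inclL inclL.

Lemma coproduct_prec_linear : linear (coproduct_prec D).
Proof.
exact: (linear_add (linear_comp (pure_linl _) inclL) (linear_comp ttL DL)).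
Qed.

Lemma coproduct_linear : linear (coproduct D).
Proof.
have f1 : linear (fun h : H => h.1) by move=> a u v.
have f2 : linear (fun h : H => h.2 *: (unit ⊗ unit)).
  by move=> a u v; rewrite /= scalerDl scalerA.
have i1 := linear_comp inclL f1.
have t1 := linear_comp (linear_comp ttL (linear_add DL (linear_comp twL DL))) f1.
exact: (linear_add (linear_add (linear_add (linear_comp (pure_linl unit) i1)
  (linear_comp (pure_linr unit) i1)) t1) f2).
Qed.

(** The summand x (x) 1 supplies the unshuffle with empty right factor. *)
Lemma coproduct_prec_word x l :
  coproduct_prec D (word_class (x :: l)) =
  ushsum (fun a b => aug_word (x :: a) ⊗ aug_word b) l.
Proof.
have E a b : aug_word (x :: a) ⊗ aug_word b =
    (if b is [::] then aug_word (x :: a) ⊗ unit else 0) +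
    incl (word_class (x :: a)) ⊗ incl (word_class b).
  by case: b => [|y b]; rewrite ?word_class_nil ?(lin0 inclL) ?pure0r ?addr0
    ?add0r.
transitivity (ushsum (fun a b =>
    (if b is [::] then aug_word (x :: a) ⊗ unit else 0) +
    incl (word_class (x :: a)) ⊗ incl (word_class b)) l); last first.
  by apply: eq_ushsum => a b _; rewrite E.
rewrite ushsumD (ushsum_emptyr (fun a => aug_word (x :: a) ⊗ unit))
  /coproduct_prec.
apply: (congr1 (fun y => _ + y)); rewrite HR_coproduct_word.
apply: (etrans (ushsum_linear _ _ ttL)).
by apply: eq_ushsum => a b _; apply: (tens_mapE _ _ inclL inclL).
Qed.

(** The summands x (x) 1 and 1 (x) x supply the two unshuffles with an empty
    factor. *)
Lemma coproduct_word l : coproduct D (aug_word l) =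
  ushsum (fun a b => aug_word a ⊗ aug_word b) l.
Proof.
case: l => [|x l].
  rewrite ushsum_nil /coproduct /= (lin0 inclL) pure0l pure0r (lin0 DL).
  by rewrite (lin0 twL) !addr0 (lin0 ttL) !add0r scale1r.
transitivity (ushsum (fun a b => ((if b is [::] then aug_word a ⊗ unit else 0) +
    (if a is [::] then unit ⊗ aug_word b else 0)) +
      incl (word_class a) ⊗ incl (word_class b)) (x :: l)).
  rewrite !ushsumD (ushsum_emptyr (fun a => aug_word a ⊗ unit)).
  rewrite (ushsum_emptyl (fun b => unit ⊗ aug_word b)) /coproduct /=
    scale0r addr0.
  apply: (congr1 (fun y => _ + y)); rewrite HR_coproduct_symm.
  apply: (etrans (ushsum_linear _ _ ttL)).
  by apply: eq_ushsum => a b _; apply: (tens_mapE _ _ inclL inclL).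
apply: eq_ushsum => -[|y a] [|z b] // => [/perm_size //|_|_|_].
- by rewrite word_class_nil (lin0 inclL) pure0l addr0 add0r.
- by rewrite word_class_nil (lin0 inclL) pure0r !addr0.
- by rewrite !add0r.
Qed.

Lemma aug_lift_word (U : lmodType k) (f : nat -> H -> U) s :
  (forall n, linear (f n)) -> aug_lift f (aug_word s) = f (size s) (aug_word s).
Proof.
move=> fL; case: s => [|x s]; rewrite /aug_lift /=.
  by rewrite (lin0 (dlift_linear _)) ?add0r // => n a u v;
    rewrite -fL dinj_linear -[RHS]/(f n (_, _)) /= scaler0 addr0.
rewrite word_class_cons dlift_dinj => [|n a u v]; last first.
  by rewrite -fL dinj_linear -[RHS]/(f n (_, _)) /= scaler0 addr0.
by rewrite -[(0, 0)]/(0 : H) (lin0 (fL 0%N)) addr0.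
Qed.

Lemma star_tens_word a b c d :
  star_tens star (aug_word a ⊗ aug_word b) (aug_word c ⊗ aug_word d) =
  (-1) ^+ (size b * size c) *: (aug_word (a ++ c) ⊗ aug_word (b ++ d)).
Proof.
apply: (etrans (star_tensE (@HR_star_bilin k G) _ _ _ _)).
apply: (etrans (aug_lift_word _ (star4_outer (@HR_star_bilin k G) _ _ _))).
apply: (etrans (aug_lift_word _ _)) => [n|].
  exact: (linear_scale _ (linear_comp (pure_linl _) ((@HR_star_bilin k G).2 _))).
by rewrite !HR_star_word.
Qed.

(** On words, both sides are the sum over the unshuffles of a concatenation that
    keep its first letter on the left. *)
Lemma semi_hopf (x : C) (y : H) :
  coproduct_prec D (star (incl x) y).1 =
  star_tens star (coproduct_prec D x) (coproduct D y).
Proof.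
have [SL SR] := @HR_star_bilin k G.
have f1 : linear (fun h : H => h.1) by move=> a u v.
have PL := linear_comp coproduct_prec_linear f1.
have TL u := star_tens_linl (@HR_star_bilin k G) u.
have TR t := star_tens_linr (@HR_star_bilin k G) t.
move: x; apply: C_ind => [|[|x l]].
- apply: subspace_eq; first exact: (linear_comp PL (linear_comp (SL y) inclL)).
  exact: (linear_comp (TL _) coproduct_prec_linear).
- rewrite word_class_nil (lin0 inclL) (lin0 (SL y)) /=
  (lin0 coproduct_prec_linear).
  by rewrite (lin0 (TL _)).
move: y; apply: H_ind => [|m].
  apply: subspace_eq; first exact: (linear_comp PL (SR _)).
  exact: (linear_comp (TR _) coproduct_linear).
rewrite -aug_word_incl HR_star_word /= !coproduct_prec_word coproduct_word.
apply: (etrans (ushsum_cat _ _ _)); apply/esym.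
apply: (etrans (ushsum_linear _ _ (TL _))); apply: eq_ushsum => a b _.
apply: (etrans (ushsum_linear _ _ (TR _))); apply: eq_ushsum => c d _.
exact: star_tens_word.
Qed.

Lemma HR_bialgebra : coZinbiel_assoc_bialgebra D star.
Proof.
split.
- split; [exact: DL | exact: HR_coproduct_graded | exact: coproduct_relation].
- exact: HR_star_bilin.
- by move=> m n x y; apply: HR_star_graded.
- exact: HR_star_assoc.
- exact: HR_star_1l.
- exact: HR_star_1r.
- exact: HR_star_ideal.
- exact: semi_hopf.
Qed.

End SemiHopf.

(** * The structures are induced from chains *)

Section InducedStructure.
Variables (k : fieldType) (G : zmodType).
Local Notation X := (conj_rack G).
Local Notation C := (dsum (HRbar k X)).
Local Notation H := (augment (HRbar k X)).
Local Notation CRtot := (dsum (CR k X)).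
Local Notation word_class := (@word_class k G).
Local Notation aug_word := (@aug_word k G).
Local Notation D := (@HR_coproduct k G).
Local Notation star := (@HR_star k G).

Fact counit_word (t : 0.-tuple X) : rack_pt X \in t -> 1 = 0 :> k^o.
Proof. by case: t => -[]. Qed.

(** The identification of HR_0 with the ground field, where the empty word has
    the value 1. *)
Definition counit : {linear HR k X 0 -> k^o} :=
  mklin (linear_comp (linearP (CR_lift counit_word)) (linearP (chain k G 0))).

Lemma counit_hr (t : 0.-tuple X) : counit (rack_class (CR_word k t)) = 1.
Proof. by rewrite mklinE rack_classK CR_liftE. Qed.

Lemma counit_bij : bijective counit.
Proof.
exists (fun c : k^o => (c : k) *: rack_class (CR_word k [tuple])) => [x|c].
  move: x; apply: HR_ind => [|t]; last first.
    rewrite counit_hr scale1r; congr (rack_class (CR_word k _)).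
    by apply/val_inj; case: t => -[].
  apply: subspace_eq => // a x y.
  by rewrite linearP scalerDl scalerA.
by rewrite linearZ_LR counit_hr; apply: mulr1.
Qed.

Lemma HR_incl_linear n : linear (@HR_incl k X counit n).
Proof.
case: n => [|n] a x y; rewrite /HR_incl.
  by rewrite linearP -[RHS]/(_, _) /= scaler0 addr0.
have := @dinj_linear k (HRbar k X) n.+1 a x y => ->.
exact: (@aug_incl_linear k G a (dinj (x : HRbar k X n.+1)) (dinj (y : HRbar k
  X n.+1))).
Qed.

Lemma HR_incl_word n (t : n.-tuple X) :
  HR_incl counit (rack_class (CR_word k t)) = aug_word t.
Proof.
case: n t => [|n] t; first by rewrite /HR_incl counit_hr; case: t => -[].
by rewrite /HR_incl word_class_tuple; case: t => -[].
Qed.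

Lemma CR_star_linl p q (b : CR k X q) : linear (fun a : CR k X p => CR_star a b).
Proof. exact: (linear_comp (linearP _) (linearP _)). Qed.

Lemma CR_star_linr p q (a : CR k X p) : linear (fun b : CR k X q => CR_star a b).
Proof.
move: a; apply: CR_ind; first exact: (linear_param (@CR_star_linl p q)).
move=> s; rewrite /CR_star; apply: (linear_comp (linearP _)) => c x y.
by rewrite /CR_cross !CR_liftE linearP.
Qed.

Lemma HR_product_induced : product_induced counit star.
Proof.
move=> p q a b x y /rack_class_eq -> /rack_class_eq ->.
exists (rack_class (CR_star a b)); first exact: rack_class_represents.
have [SL SR] := @HR_star_bilin k G.
have IL n := linear_comp (@HR_incl_linear n) (@rack_class_linear k G n).
move: a; apply: CR_ind => [|s].
  apply: (subspace_eq (linear_comp (SL _) (IL p))).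
  exact: (linear_comp (IL (p + q)%N) (CR_star_linl b)).
move: b; apply: CR_ind => [|t].
  apply: (subspace_eq (linear_comp (SR _) (IL q))).
  exact: (linear_comp (IL (p + q)%N) (CR_star_linr _)).
by rewrite CR_starE !HR_incl_word HR_star_word.
Qed.

Definition chain_word (s : seq X) : CRtot := dinj (CR_word k (in_tuple s)).

Lemma chain_word_tuple n (t : n.-tuple X) : dinj (CR_word k t) = chain_word t.
Proof.
case: t => s sz; have sn := eqP sz; case: n / sn sz => sz.
by congr (dinj (CR_word k _)); apply: val_inj.
Qed.

Lemma chain_word_represents x s :
  HRbar_represents (chain_word (x :: s)) (word_class (x :: s)).
Proof.
rewrite /chain_word word_class_cons; split=> [|n];
  first exact: component_dinj_neq.
have [<-|sn] := eqVneq (size s) n.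
  by rewrite !component_dinj; apply: rack_class_represents.
rewrite !component_dinj_neq ?eqSS //.
have := rack_class_represents (0 : CR k X n.+1); rewrite linear0; exact.
Qed.

Lemma shuffle_act_abelian n p (s : {perm 'I_n}) (t : n.-tuple X) i :
  shuffle_act p s t i = tnth t (s i).
Proof.
rewrite /shuffle_act; elim: [seq _ <- _ | _] (tnth t (s i)) => //= l ls IH x.
by rewrite [conj_op _ _]conj_opE IH.
Qed.

Lemma unshuffle_word x n (t : n.-tuple X) :
  unshuffle k [tuple of x :: t] = ushsum (fun a b =>
    if b is [::] then 0 else chain_word (x :: a) ⊗ chain_word b) t.
Proof.
rewrite -(sum_shuffle1 (fun a b => chain_word a ⊗ chain_word b)).
apply: eq_bigr => p _; apply: eq_bigr => s _; rewrite /split_perm.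
apply: (congr1 (fun y => _ *: y)); apply: (congr2 (@pure _ _ _));
  apply: (etrans (chain_word_tuple _)); congr chain_word.
  apply: (@eq_from_nth _ x) => [|j]; rewrite size_tuple.
    by rewrite size_takel // size_perm_seq leq_ord.
  move=> jp; rewrite nth_take // -(tnth_nth _ _ (Ordinal jp)) tnth_mktuple.
  have jn : (j < n.+1)%N by rewrite (leq_trans jp) // leq_ord.
  rewrite (nth_perm_seq _ _ _ (Ordinal jn)); congr (tnth _ (s _)).
  exact: val_inj.
apply: (@eq_from_nth _ x) => [|j]; rewrite size_tuple.
  by rewrite size_drop size_perm_seq.
move=> jp; rewrite nth_drop -(tnth_nth _ _ (Ordinal jp)) tnth_mktuple.
have jn : (p + j < n.+1)%N by rewrite -ltn_subRL.
rewrite shuffle_act_abelian (nth_perm_seq _ _ _ (Ordinal jn)).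
by congr (tnth _ (s _)); apply: val_inj.
Qed.

Lemma CRtens_d0 : CRtens_d (0 : tens CRtot CRtot) = 0.
Proof.
have d0 (a : CRtot) : CRtot_d a = 0.
  by rewrite /CRtot_d /dlift big1 // => n _; rewrite rack_d_abelian dinj0.
rewrite /CRtens_d /tens_lift /free_lift big1 // => -[a b] _ /=.
rewrite !d0 pure0l add0r /dlift big1 ?scaler0 // => n _.
by rewrite pure0r scaler0.
Qed.

(** One decomposition must serve both the tensor of chains and that of homology
    classes; the pairs below keep the two in step, and their span in the product
    module contains a pair if and only if such a decomposition exists. *)
Inductive represented_tensor : tens CRtot CRtot * tens C C -> Prop :=
| RepresentedTensor a b a' b' of HRbar_represents a a' & HRbar_represents b b' :
    represented_tensor (a ⊗ b, a' ⊗ b').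

Lemma componentZ (V : nat -> lmodType k) c (a : dsum V) n :
  component (c *: a) n = c *: component a n.
Proof. by []. Qed.

Lemma represented_tensorZ c z : represented_tensor z ->
  represented_tensor (c *: z).
Proof.
case=> a b a' b' [a0 aa'] bb'.
rewrite (_ : c *: _ = ((c *: a) ⊗ b, (c *: a') ⊗ b')).
  apply: RepresentedTensor => //; split=> [|n].
    by rewrite componentZ a0 scaler0.
  have := represents_linear c (aa' n) (rack_class_represents (0 : CR k X n.+1)).
  by rewrite linear0 !addr0 !componentZ.
have l1 := (bilinZ (pure_bilin CRtot CRtot) c a b).1.
have l2 := (bilinZ (pure_bilin C C) c a' b').1.
exact: (congr2 pair (esym l1) (esym l2)).
Qed.

Lemma coproduct_represented n (z : CR k X n.+1) :
  (CR_coproduct k X n.+1 z, D (dinj (rack_class z : HRbar k X n.+1))) \in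
    span represented_tensor.
Proof.
move: z; apply: CR_ind => [|t].
  pose f z := (CR_coproduct k X n.+1 z, D (dinj (rack_class z : HRbar k X n.+1))).
  have DL := linear_comp (@HR_coproduct_linear k G)
    (linear_comp (@dinj_linear k (HRbar k X) n.+1) (@rack_class_linear k G n.+1)).
  have fL : linear f.
    by move=> a u v; apply: (congr2 pair (linearP _ a u v) (DL a u v)).
  exact: (subspace_preim fL (subspace_span _)).
rewrite word_class_tuple /CR_coproduct CR_liftE; case/tupleP: t => x t.
rewrite unshuffle_word HR_coproduct_word ushsum.unlock.
elim: (unshuffles t) => [|u us IH]; first by rewrite !big_nil; apply: rpred0.
rewrite !big_cons.
set F1 := (-1) ^+ u.1 *: _; set F2 := (-1) ^+ u.1 *: _;
  set S1 := \sum_(_ <- _) _ in IH *.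
set S2 := \sum_(_ <- _) _ in IH *.
have -> : (F1 + S1, F2 + S2) = (F1, F2) + (S1, S2) by [].
apply: rpredD => //.
rewrite /F1 /F2; case: u.2.2 => [|y b].
  by rewrite word_class_nil pure0r !scaler0; apply: rpred0.
apply: mem_span; apply: (represented_tensorZ ((-1) ^+ u.1)
  (RepresentedTensor (chain_word_represents x u.2.1) (chain_word_represents
    y b))).
Qed.

(** As the tensor complex has zero differential, homologous means equal, and the
    decomposition is read off from coproduct_represented. *)
Lemma HR_coproduct_induced : coproduct_induced D.
Proof.
move=> n z h /rack_class_eq ->; have := coproduct_represented z.
case/asboolP => m [c [r [Rr zE]]].
have dec i : exists y, [/\ HRbar_represents y.1.1 y.1.2,
    HRbar_represents y.2.1 y.2.2 & c i *: r i = (y.1.1 ⊗ y.2.1, y.1.2 ⊗ y.2.2)].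
  by have [a b a' b' aa' bb'] := represented_tensorZ (c i) (Rr i); exists ((a,
    a'), (b, b')).
pose y i := projT1 (cid (dec i)).
have yP i := projT2 (cid (dec i)).
have fstL : linear (fun p : tens CRtot CRtot * tens C C => p.1) by move=> a u v.
have sndL : linear (fun p : tens CRtot CRtot * tens C C => p.2) by move=> a u v.
exists m, (fun i => (y i).1.1), (fun i => (y i).2.1), (fun i => (y i).1.2),
  (fun i => (y i).2.2); split=> [i|i||]; try by case: (yP i).
  exists 0; rewrite CRtens_d0 addr0.
  apply: (etrans (congr1 fst zE)); rewrite -[fst _]/(mklin fstL _) linear_sum.
  by apply: eq_bigr => i _; have [_ _ ->] := yP i.
apply: (etrans (congr1 snd zE)); rewrite -[snd _]/(mklin sndL _) linear_sum.
by apply: eq_bigr => i _; have [_ _ ->] := yP i.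
Qed.

End InducedStructure.

(** * Tensor powers and the antisymmetrization map *)

Section TensorPower.
Variables (k : fieldType) (G : zmodType).
Local Notation X := (conj_rack G).
Local Notation V := (free_nonzero k G).

Lemma pure_pow_multilinear (W : lmodType k) n : multilinear (@pure_pow k W n).
Proof.
move=> t i a u v; apply/eqP; rewrite -subr_eq0 /pure_pow -linearP -linearB /=.
exact/eqP/quo_pi_rel/MultilinRel.
Qed.

(** The generator of g, set to zero for g = 0, so that degenerate words go to
    zero. *)
Definition letter (g : G) : V := if insub g is Some u then << u >> else 0.

Lemma letter_val (g : nonzero G) : letter (val g) = << g >>.
Proof. by rewrite /letter valK. Qed.

Lemma letter0 : letter 0 = 0.
Proof. by rewrite /letter insubF ?eqxx. Qed.

Definition tensor_word n (t : n.-tuple X) : tens_pow V n :=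
  pure_pow [tuple letter (tnth t i) | i < n].

Fact tensor_word0 n (t : n.-tuple X) : rack_pt X \in t -> tensor_word t = 0.
Proof.
case/tnthP => i ti; rewrite /tensor_word; set w := mktuple _.
have wi : tnth w i = 0 by rewrite tnth_mktuple -ti letter0.
by rewrite -(upd_id w i) wi; apply: lin0 (pure_pow_multilinear w i).
Qed.

Definition HR_to_tens n : {linear HR k X n -> tens_pow V n} :=
  mklin (linear_comp (linearP (CR_lift (@tensor_word0 n))) (linearP (chain k
    G n))).

Lemma HR_to_tens_word n (t : n.-tuple X) :
  HR_to_tens n (rack_class (CR_word k t)) = tensor_word t.
Proof. by rewrite mklinE rack_classK CR_liftE. Qed.

Lemma HR_to_tens_nonzero n (g : n.-tuple (nonzero G)) :
  HR_to_tens n (rack_class (CR_word k ([tuple val (tnth g i) | i < n] :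
    n.-tuple X))) =
  pure_pow [tuple << tnth g i >> | i < n].
Proof.
rewrite HR_to_tens_word; congr pure_pow.
by apply/eq_from_tnth => i; rewrite !tnth_mktuple letter_val.
Qed.

Local Notation M := (words k G).

(** The inverse map is an iterated prepending of letters, which is multilinear
    by foldr_multilinear. *)
Definition prepend (v : V) (a : M) : M :=
  free_lift (fun g : nonzero G => mcons (val g) a) v.

Lemma prepend_bilin : bilin prepend.
Proof.
split=> [a|v]; first exact: linearP.
move: v; apply: malg_ind; first exact: (linear_param (fun a => linearP
  (free_lift _))).
move=> g c a b; rewrite /prepend !free_liftE; exact: linearP.
Qed.

Definition chain_of_word n (s : seq G) : CR k X n :=
  if size s == n then CR_word k ([tuple s`_i | i < n] : n.-tuple X) else 0.

Definition chain_of_words n : {linear M -> CR k X n} :=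
  word_lift (chain_of_word n).

Fact tens_to_HR_rel n r : multilin_rel r ->
  free_lift (fun t : n.-tuple V =>
    rack_class (chain_of_words n (foldr prepend (word k [::]) t))) r = 0.
Proof.
apply: multilin_rel_lift.
exact: (foldr_multilinear (word k [::]) prepend_bilin
  (linear_comp (@rack_class_linear k G n) (linearP (chain_of_words n)))).
Qed.

Definition tens_to_HR n : {linear tens_pow V n -> HR k X n} :=
  quo_map (@tens_to_HR_rel n).

Lemma tens_to_HRE n (g : n.-tuple (nonzero G)) :
  tens_to_HR n (pure_pow [tuple << tnth g i >> | i < n]) =
  rack_class (CR_word k ([tuple val (tnth g i) | i < n] : n.-tuple X)).
Proof.
rewrite /tens_to_HR quo_mapE; apply: (etrans (free_liftE _ _)).
congr (rack_class _).
have -> : foldr prepend (word k [::]) [tuple << tnth g i >> | i < n] =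
    word k [seq val x | x <- g].
  rewrite (_ : tval _ = [seq << x >> | x <- g]).
    elim: (g : seq _) => //= x s ->.
    by rewrite /prepend free_liftE mconsE.
  have -> : [tuple << tnth g i >> | i < n] = map_tuple (fun x => << x >> : V) g.
    by apply/eq_from_tnth => i; rewrite tnth_mktuple tnth_map.
  by [].
rewrite /chain_of_words word_liftE /chain_of_word size_map size_tuple eqxx.
congr CR_word; apply/eq_from_tnth => i; rewrite !tnth_mktuple.
by rewrite -(tnth_nth 0 (map_tuple val g)) tnth_map.
Qed.

Lemma HR_to_tens_bij n : bijective (HR_to_tens n).
Proof.
exists (tens_to_HR n).
  apply: HR_ind => [|t].
    apply: subspace_eq; last by [].
    exact: (linear_comp (linearP _) (linearP _)).
  have [t0|t0] := boolP ((0 : G) \in (t : seq G)).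
    by rewrite CR_word0 // !linear0.
  have tn i : tnth t i != 0 :> G by apply: contraNneq t0 => <-; apply: mem_tnth.
  pose g := [tuple Sub (tnth t i) (tn i) : nonzero G | i < n].
  have tg : t = [tuple val (tnth g i) | i < n].
    by apply/eq_from_tnth => i; rewrite !tnth_mktuple SubK.
  by rewrite tg HR_to_tens_nonzero tens_to_HRE.
apply: quo_ind; apply: malg_ind => [|t].
  apply: (subspace_eq (f := fun r => HR_to_tens n (tens_to_HR n (quo_pi r)))).
    exact: (linear_comp (linearP _) (linear_comp (linearP _) (linearP _))).
  exact: linearP quo_pi.
pose B (v : V) := exists g : nonzero G, v = << g >>.
pose f (t : n.-tuple V) :=
  HR_to_tens n (tens_to_HR n (pure_pow t)) - pure_pow t.
suff : f t = 0 by move/eqP; rewrite subr_eq0 => /eqP.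
apply: (@multilinear_eq0 _ _ _ _ B).
- apply: malg_ind => [|g]; first exact: subspace_span.
  by apply: mem_span; exists g.
- move=> t' i; apply: linear_sub; last exact: pure_pow_multilinear.
  apply: (linear_comp (linearP _) (linear_comp (linearP _) _)).
  exact: pure_pow_multilinear.
move=> {}t tB; pose g := [tuple projT1 (cid (tB i)) | i < n].
have tg : t = [tuple << tnth g i >> | i < n].
  by apply/eq_from_tnth => i; rewrite !tnth_mktuple; case: (cid _).
by rewrite /f [in X in X - _]tg tens_to_HRE HR_to_tens_nonzero -tg subrr.
Qed.

Definition antisym_map n : {linear HR k X n -> group_homology k G n} :=
  mklin (linear_comp (linearP (pontryagin k G n)) (linear_comp
    (linearP (tens_to_ext (nonzero_to_scal k G) n)) (linearP (HR_to_tens n)))).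

Lemma nonzero_to_scal_letter (g : G) :
  nonzero_to_scal k G (letter g) = scal_pure g 1.
Proof.
rewrite /letter; case: insubP => [u _ ug|/negPn/eqP ->].
  by rewrite /nonzero_to_scal /= free_liftE -ug.
by rewrite linear0 scal_pure0.
Qed.

(** Both maps send a word to the class of the antisymmetrization of its letters;
    a zero letter becomes zero in the scalar extension. *)
Lemma antisym_map_induced n : antisym_induced (antisym_map n).
Proof.
move=> a x /rack_class_eq ->; suff : bar_represents (CR_antisym k G n a)
    (pontryagin k G n (tens_to_ext (nonzero_to_scal k G) n (HR_to_tens n
      (rack_class a)))) by [].
move: a; apply: CR_ind => [|t].
  apply: (represents_subspace (linearP (CR_antisym k G n))).
  exact: (linear_comp (linearP (pontryagin k G n)) (linear_comp
    (linearP (tens_to_ext (nonzero_to_scal k G) n))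
    (linear_comp (linearP (HR_to_tens n)) (@rack_class_linear k G n)))).
rewrite HR_to_tens_word /tensor_word (CR_liftE _ t : CR_antisym k G n _ = _).
rewrite [tens_to_ext _ _ _](_ : _ =
    wedge [tuple scal_pure (tnth t i) (1 : k) | i < n]).
  exact: pontryagin_represents.
rewrite /tens_to_ext quo_mapE; apply: (etrans (free_liftE _ _)); congr wedge.
apply/eq_from_tnth => i; rewrite !tnth_mktuple; exact: nonzero_to_scal_letter.
Qed.

End TensorPower.

Theorem mainTheorem2 (G : zmodType) (k : fieldType) :
  (exists (e0 : {linear HR k (conj_rack G) 0 -> k^o})
          (D : dsum (HRbar k (conj_rack G)) ->
               tens (dsum (HRbar k (conj_rack G))) (dsum (HRbar k (conj_rack G))))
          (star : augment (HRbar k (conj_rack G)) ->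
                  augment (HRbar k (conj_rack G)) ->
                  augment (HRbar k (conj_rack G))),
     [/\ bijective e0 /\
         (exists2 x, HR_represents (CR_word k [tuple]) x & e0 x = 1),
         coproduct_induced D,
         product_induced e0 star,
         coZinbiel_assoc_bialgebra D star &
         connected D]) /\
  (exists Psi : forall n, {linear HR k (conj_rack G) n ->
                                  tens_pow (free_nonzero k G) n},
     (forall n,
        bijective (Psi n) /\
        (forall g : n.-tuple (nonzero G),
           exists2 x, HR_represents
                        (CR_word k ([tuple val (tnth g i) | i < n] :
                                      n.-tuple (conj_rack G))) x &
                      Psi n x = pure_pow [tuple << tnth g i >> | i < n])) /\
     ([pchar k] =i pred0 ->
      forall n,
      exists (Phi : {linear ext_pow (scal_ext G k) n -> group_homology k G n})
             (S : {linear HR k (conj_rack G) n -> group_homology k G n}),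
        [/\ bijective Phi,
            (forall g : n.-tuple G,
               bar_represents (antisym k g)
                 (Phi (wedge [tuple scal_pure (tnth g i) (1 : k) | i < n]))),
            antisym_induced S &
            forall x, S x = Phi (tens_to_ext (nonzero_to_scal k G) n (Psi n x))])).
Proof.
split.
  exists (counit k G), (@HR_coproduct k G), (@HR_star k G); split.
  - split; first exact: counit_bij.
    by exists (rack_class (CR_word k [tuple]));
      [exact: rack_class_represents | exact: counit_hr].
  - exact: HR_coproduct_induced.
  - exact: HR_product_induced.
  - exact: HR_bialgebra.
  - exact: HR_connected.
exists (HR_to_tens k G); split=> [n|k0 n].
  split=> [|g]; first exact: HR_to_tens_bij.
  by eexists; [exact: rack_class_represents | exact: HR_to_tens_nonzero].
have k_char0 m : (m.+1)%:R != 0 :> k by rewrite ((pcharf0P k).1 k0).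
exists (pontryagin k G n), (antisym_map k G n); split=> //.
- exact: pontryagin_bij.
- exact: pontryagin_represents.
- exact: antisym_map_induced.
Qed.
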